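(* Let $r,s\in(0,\infty)$. Let $P$ be a Borel probability measure on $\mathbb{R}^d$ whose absolutely continuous part satisfies $P^a\neq 0$ and such that $\int_{\mathbb{R}^d}\|x\|^{r+\eta}\,dP(x)<+\infty$ for some $\eta>0$. Let $(\alpha_n)_{n\ge1}$ be an asymptotically $L^r$-optimal sequence of $n$-quantizers for $P$. Then $$\liminf_{n\to\infty} n^{s/d}\int_{\mathbb{R}^d} d(x,\alpha_n)^s\,dP(x)\;\ge\; Q_{r,s}(P).$$
   Context: $\mathbb{R}^d$ ($d\ge 1$) is equipped with an arbitrary norm $\|\cdot\|$; $d(x,A)=\inf_{a\in A}\|x-a\|$; $\lambda_d$ is Lebesgue measure. $P^a=f\cdot\lambda_d$ denotes the absolutely continuous part of $P$ with respect to $\lambda_d$, with density $f$. For a probability measure $\mu$ on $\mathbb{R}^d$ with finite $r$-th moment, $e_{n,r}(\mu)=\inf\{(\int d(x,\alpha)^r\,d\mu(x))^{1/r}:\alpha\subset\mathbb{R}^d,\ 1\le \mathrm{card}(\alpha)\le n\}$. A sequence $(\alpha_n)_{n\ge1}$ of finite nonempty subsets of $\mathbb{R}^d$ is called an asymptotically $L^r$-optimal sequence of $n$-quantizers for $P$ if $\mathrm{card}(\alpha_n)\le n$ for every $n$ and $\int d(x,\alpha_n)^r\,dP(x)\sim e_{n,r}(P)^r$ as $n\to\infty$ (i.e. the ratio tends to $1$). For $s>0$, $J_{s,d}:=\inf_{n\ge1} n^{s/d}e_{n,s}(U([0,1]^d))^s\in(0,\infty)$, where $U([0,1]^d)$ is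 the uniform distribution on $[0,1]^d$. Under the moment assumption, $\int f^{d/(d+r)}d\lambda_d<+\infty$, and $$Q_{r,s}(P):=J_{s,d}\left(\int_{\mathbb{R}^d}f^{d/(d+r)}\,d\lambda_d\right)^{s/d}\int_{\{f>0\}}f^{1-s/(d+r)}\,d\lambda_d\in(0,+\infty].$$ *)

(* Defs.v *)
From HB Require Import structures.
From mathcomp Require Import all_boot all_order all_algebra.
From mathcomp Require Import all_classical all_reals all_analysis.
From mathcomp Require Import measurable_realfun.

Set Implicit Arguments.
Unset Strict Implicit.
Unset Printing Implicit Defensive.

Import Order.TTheory GRing.Theory Num.Theory.
Import numFieldNormedType.Exports.

Local Open Scope classical_set_scope.
Local Open Scope ring_scope.

(* 'rV[R]_n is R^n with its Borel sigma-algebra; the library topology on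
   matrices is that of the sup norm, hence of any norm. *)
Section borel_rV.
Context (R : realType) (n : nat).

Let rV_measurableC (A : set 'rV[R]_n) : <<s open >> A -> <<s open >> (~` A).
Proof. exact: sigma_algebraC. Qed.

HB.instance Definition _ := @isMeasurable.Build
  (sigma_display (@open 'rV[R]_n)) 'rV[R]_n <<s open >>
  (@sigma_algebra0 _ setT open) rV_measurableC
  (@sigma_algebra_bigcup _ setT open).

End borel_rV.

Lemma rV_open_measurable (R : realType) n (U : set 'rV[R]_n) :
  open U -> measurable U.
Proof. by move=> oU; exact: sub_gen_smallest. Qed.

Lemma rV_open_cover_rat (R : realType) n (U : set 'rV[R]_n) : open U ->
  U = \bigcup_(p in [set p : 'rV[rat]_n * nat |
                      ball (map_mx ratr p.1 : 'rV[R]_n) (p.2.+1%:R^-1 : R) `<=` U])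
        ball (map_mx ratr p.1 : 'rV[R]_n) (p.2.+1%:R^-1 : R).
Proof.
move=> oU; apply/seteqP; split=> [x Ux|x [p /= pU]]; last exact: pU.
have /nbhs_ballP[e /= e0 eU] : nbhs x U by exact: open_nbhs_nbhs.
have [k ke] : exists k : nat, (k.+1%:R^-1 : R) < e / 2.
  have e20 : 0 < e / 2 by rewrite divr_gt0.
  near \oo => k; exists k; near: k; exact: near_infty_natSinv_lt (PosNum e20).
set d : R := k.+1%:R^-1.
have d0 : 0 < d by rewrite invr_gt0.
have qP i : exists q : rat, ball (x 0 i) d (ratr q).
  have x0 : ball (x 0 i) d !=set0 by exists (x 0 i); exact: ballxx.
  have [y [xy [q _ qy]]] := dense_rat x0 (ball_open (x 0 i) d).
  by exists q; rewrite qy.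
have [q qE] := choice qP.
pose v : 'rV[rat]_n := \row_i q i.
have vx : ball (map_mx ratr v : 'rV[R]_n) d x.
  split => // i j; rewrite ord1 !mxE; apply: ball_sym; exact: qE.
exists (v, k) => //= y vy; apply: eU.
apply: (@le_ball _ _ _ (d + d)).
  by rewrite [leRHS](splitr e) lerD// ltW.
by apply: ball_triangle vy; exact: ball_sym.
Unshelve. all: by end_near. Qed.

Definition rV_cons (R : realType) n (p : measurableTypeR R * 'rV[R]_n) : 'rV[R]_(1 + n) :=
  row_mx (const_mx p.1) p.2.

Lemma rV_cons_ord0 (R : realType) n (p : measurableTypeR R * 'rV[R]_n) :
  rV_cons p 0 ord0 = p.1.
Proof.
rewrite (_ : ord0 = lshift n (0 : 'I_1)); last exact/val_inj.
by rewrite /rV_cons row_mxEl mxE.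
Qed.

Lemma rV_cons_lift (R : realType) n (p : measurableTypeR R * 'rV[R]_n)
    (i : 'I_n) :
  rV_cons p 0 (lift ord0 i) = p.2 0 i.
Proof.
rewrite (_ : lift ord0 i = rshift 1 i); last exact/val_inj.
by rewrite /rV_cons row_mxEr.
Qed.

Lemma measurable_rV_cons (R : realType) n :
  measurable_fun [set: measurableTypeR R * 'rV[R]_n] (@rV_cons R n).
Proof.
apply: (@measurability _ _ _ _ _ _ (@open 'rV[R]_(1 + n))) => //= _ [U oU <-]; rewrite setTI.
rewrite (rV_open_cover_rat oU) preimage_bigcup bigcup_mkcond.
apply: countable_bigcupT_measurable => [|[v k]]; first exact: countableP.
case: ifPn => // _ /=.
have lshift00 : lshift n (0 : 'I_1) = 0 by exact/val_inj.
set c : 'rV[R]_(1 + n) := map_mx ratr v; set e : R := _^-1.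
have e0 : 0 < e by rewrite invr_gt0.
rewrite (_ : _ @^-1` _ = ball (c 0 0) e `*` ball (rsubmx c) e); last first.
  apply/seteqP; split=> [[x w] [_ /= xw]|[x w] [/= cx [_ cw]]].
    split=> /=.
      by have := xw 0 (lshift n 0); rewrite row_mxEl lshift00 [const_mx _ _ _]mxE.
    by split => // i j; have := xw i (rshift 1 j); rewrite row_mxEr !mxE.
  split => // i j; rewrite ord1; have [l ->|l ->] := split_ordP j.
    by rewrite row_mxEl ord1 lshift00 [const_mx _ _ _]mxE.
  by rewrite row_mxEr; have := cw 0 l; rewrite !mxE.
apply: measurableX; first exact: measurable_ball.
by apply: rV_open_measurable; exact: ball_open.
Qed.

Lemma continuous_rsubmx (R : realType) m n :
  continuous (@rsubmx R 1 m n).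
Proof.
move=> v A /nbhs_ballP[e /= e0 eA].
by apply/nbhs_ballP; exists e => //= w [_ vw]; apply: eA; split => // i j; rewrite !mxE.
Qed.

Lemma measurable_rV_coord (R : realType) n (i : 'I_n) :
  measurable_fun [set: 'rV[R]_n] (fun v => v 0 i : measurableTypeR R).
Proof.
apply: (@measurability _ _ _ _ _ _ (@RGenOpens.G R)).
  exact: RGenOpens.measurableE.
move=> _ [_ [a [b ->]] <-]; rewrite setTI; apply: rV_open_measurable.
apply: open_comp (@itv_open_ends_open _ _ `]a, b[ isT) => v _.
exact: coord_continuous.
Qed.

Lemma measurable_rV_behead (R : realType) n :
  measurable_fun [set: 'rV[R]_(1 + n)] (@rsubmx R 1 1 n).
Proof.
apply: (@measurability _ _ _ _ _ _ (@open 'rV[R]_n)) => //.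
move=> _ [U oU <-]; rewrite setTI; apply: rV_open_measurable.
by apply: open_comp oU => v _; exact: continuous_rsubmx.
Qed.

Section lebesgue_rV_step.
Context (R : realType) (n : nat).
Variable m : {sigma_finite_measure set 'rV[R]_n -> \bar R}.

Definition lebesgue_rV_step : set 'rV[R]_(1 + n) -> \bar R :=
  pushforward (lebesgue_measure \x m)%E (@rV_cons R n).

Let mcons := @measurable_rV_cons R n.

HB.instance Definition _ := Measure.copy lebesgue_rV_step
  (measure_function_pushforward__canonical__measure_function_Measure
     (lebesgue_measure \x m)%E mcons).

Let step_sigma_finite : sigma_finite setT lebesgue_rV_step.
Proof.
have /sigma_finiteP[F [FT ndF Foo]] :=
  sigma_finiteT (@lebesgue_measure R : {sigma_finite_measure set _ -> \bar R}).
have /sigma_finiteP[G [GT ndG Goo]] := sigma_finiteT m.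
pose u (v : 'rV[R]_(1 + n)) := (v 0 (lshift n 0), rsubmx v).
have mu : measurable_fun setT u.
  apply/measurable_fun_pairP; split.
    exact: measurable_rV_coord.
  exact: measurable_rV_behead.
exists (fun k => u @^-1` (F k `*` G k)).
  rewrite -preimage_bigcup; apply/esym/seteqP; split=> // v _ /=.
  have [i _ Fi] : (\bigcup_i F i) (v 0 (lshift n 0)) by rewrite -FT.
  have [j _ Gj] : (\bigcup_i G i) (rsubmx v) by rewrite -GT.
  exists (maxn i j) => //; split => /=.
    by move: Fi; exact/subsetPset/ndF/leq_maxl.
  by move: Gj; exact/subsetPset/ndG/leq_maxr.
move=> k; have [mFk Fkoo] := Foo k; have [mGk Gkoo] := Goo k; split.
  by rewrite -[X in measurable X]setTI; apply: mu => //; exact: measurableX.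
rewrite /lebesgue_rV_step /pushforward -comp_preimage.
rewrite (_ : _ \o _ = id) ?preimage_id.
  by rewrite product_measure1E// lte_mul_pinfty// ge0_fin_numE.
apply/funext => -[x w]; rewrite /u /rV_cons /=; congr (_, _).
  by rewrite row_mxEl mxE.
by rewrite row_mxKr.
Qed.

HB.instance Definition _ :=
  Measure_isSigmaFinite.Build _ _ _ lebesgue_rV_step step_sigma_finite.

End lebesgue_rV_step.

(* Lebesgue measure on R^n, as an iterated product; [lebesgue_rV_box] gives its
   value on boxes, which determines it. *)
Fixpoint lebesgue_rV (R : realType) (n : nat) :
    {sigma_finite_measure set 'rV[R]_n -> \bar R} :=
  match n with
  | 0 => \d_(0 : 'rV[R]_0)
  | n'.+1 => lebesgue_rV_step (lebesgue_rV R n')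
  end.

Lemma measurable_rV_box (R : realType) n (A : 'I_n -> set (measurableTypeR R)) :
  (forall i, measurable (A i)) ->
  measurable [set v : 'rV[R]_n | forall i, A i (v 0 i)].
Proof.
move=> mA; rewrite (_ : [set _ | _] =
    \bigcap_(i in [set: 'I_n]) [set v : 'rV[R]_n | A i (v 0 i)]); last first.
  by apply/seteqP; split => v /= Av i; [move=> _; exact: Av|exact: Av].
apply: fin_bigcap_measurable => // i _; rewrite -[X in measurable X]setTI.
exact: (@measurable_rV_coord R n i).
Qed.

Lemma lebesgue_rV_box (R : realType) n (A : 'I_n -> set (measurableTypeR R)) :
  (forall i, measurable (A i)) ->
  lebesgue_rV R n [set v : 'rV[R]_n | forall i, A i (v 0 i)] =
  (\prod_(i < n) lebesgue_measure (A i))%E.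
Proof.
elim: n A => [|n IHn] A mA.
  by rewrite big_ord0 /= diracE mem_set// => -[].
rewrite big_ord_recl -IHn => [|i]; last exact: mA.
rewrite -product_measure1E => //; last exact: (measurable_rV_box (fun i => mA _)).
congr (product_measure1 _ _ _); apply/seteqP.
split=> [[x v] /= xv|[x v] [/= x0 vA] i].
  split => [|i] /=; first by move: (xv ord0); rewrite rV_cons_ord0.
  by move: (xv (lift ord0 i)); rewrite rV_cons_lift.
have [j ->|->] := unliftP ord0 i; last by rewrite rV_cons_ord0.
by rewrite rV_cons_lift; exact: vA.
Qed.

Section uniform_cube.
Context (R : realType) (d : nat).

Definition unit_cube : set 'rV[R]_d :=
  [set v | forall i, `[0, 1]%classic (v 0 i)].

Lemma measurable_unit_cube : measurable unit_cube.
Proof. by apply: (@measurable_rV_box R d (fun=> `[0, 1]%classic)). Qed.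

Lemma lebesgue_unit_cube : lebesgue_rV R d unit_cube = 1%E.
Proof.
rewrite (@lebesgue_rV_box R d (fun=> `[0, 1]%classic))//.
by rewrite big1// => i _; rewrite lebesgue_measure_itv/= lte_fin ltr01 -EFinB subr0.
Qed.

(* No normalization is needed, by [lebesgue_unit_cube]. *)
Definition uniform_cube : set 'rV[R]_d -> \bar R :=
  mrestr (lebesgue_rV R d) measurable_unit_cube.

HB.instance Definition _ := Measure.on uniform_cube.

Let uniform_cube_setT : uniform_cube setT = 1%E.
Proof. by rewrite /uniform_cube /mrestr setTI lebesgue_unit_cube. Qed.

HB.instance Definition _ :=
  Measure_isProbability.Build _ _ _ uniform_cube uniform_cube_setT.

End uniform_cube.

Definition is_norm (R : realType) (V : lmodType R) (N : V -> R) : Prop :=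
  [/\ forall x, N x = 0 -> x = 0,
      forall (a : R) x, N (a *: x) = `|a| * N x &
      forall x y, N (x + y) <= N x + N y].

Section quantization.
Context (R : realType) (d : nat) (N : 'rV[R]_d -> R).
Local Open Scope ereal_scope.
Implicit Types (mu P : probability 'rV[R]_d R) (A : set 'rV[R]_d).

Definition dist (x : 'rV[R]_d) A : R := inf [set N (x - a)%R | a in A].

Definition distortion mu (r : R) A : \bar R :=
  \int[mu]_x (dist x A `^ r)%:E.

(* e_{n,r}(mu); [A #<= `I_n] says that A is finite with card A <= n. *)
Definition quantization_error mu (n : nat) (r : R) : \bar R :=
  ereal_inf [set distortion mu r A `^ r^-1 |
             A in [set A | A !=set0 /\ (A #<= `I_n)%card]].

(* The ratio is taken in \bar R, where x / 0 = +oo for x > 0; a sequence alpha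
   is only constrained for n >= 1. *)
Definition asymptotically_optimal P (r : R) (alpha : nat -> set 'rV[R]_d) :=
  (forall n, (0 < n)%N -> alpha n !=set0 /\ (alpha n #<= `I_n)%card) /\
  distortion P r (alpha n) / quantization_error P n r `^ r @[n --> \oo] --> 1.

(* J_{s,d} *)
Definition quantization_const (s : R) : \bar R :=
  ereal_inf [set (n%:R `^ (s / d%:R))%:E *
                 quantization_error (@uniform_cube R d) n s `^ s |
             n in [set n | (0 < n)%N]].

(* Q_{r,s}(P), in terms of the density f of the absolutely continuous part *)
Definition mismatch_bound (r s : R) (f : 'rV[R]_d -> R) : \bar R :=
  quantization_const s *
  (\int[lebesgue_rV R d]_x (f x `^ (d%:R / (d%:R + r)))%:E) `^ (s / d%:R) *
  \int[lebesgue_rV R d]_(x in [set x | (0 < f x)%R])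
    (f x `^ (1 - s / (d%:R + r)))%:E.

End quantization.

Section lebesgue_decomposition.
Context (disp : measure_display) (T : measurableType disp) (R : realType).
Local Open Scope ereal_scope.

Definition mutually_singular (m1 m2 : set T -> \bar R) : Prop :=
  exists2 A, measurable A & m1 A = 0 /\ m2 (~` A) = 0.

(* Lebesgue decomposition: Ma is the absolutely continuous part of M, unique for
   M finite and mu sigma-finite. *)
Definition is_ac_part (mu M Ma : {measure set T -> \bar R}) : Prop :=
  Ma `<< mu /\
  exists Ms : {measure set T -> \bar R}, mutually_singular Ms mu /\
    forall A, measurable A -> M A = Ma A + Ms A.

Definition is_density (mu M : {measure set T -> \bar R}) (f : T -> R) : Prop :=
  [/\ measurable_fun setT f, forall x, (0 <= f x)%R &
      forall A, measurable A -> M A = \int[mu]_(x in A) (f x)%:E].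

End lebesgue_decomposition.

(* Main.v *)
From HB Require Import structures.
Require Import Defs.
From mathcomp Require Import all_boot all_order all_algebra.
From mathcomp Require Import all_classical all_reals all_analysis.
From mathcomp Require Import measurable_realfun ring lra zify.

Set Implicit Arguments.
Unset Strict Implicit.
Unset Printing Implicit Defensive.

Import Order.TTheory GRing.Theory Num.Theory.
Import numFieldNormedType.Exports.

Local Open Scope classical_set_scope.
Local Open Scope ring_scope.

(** Write [sg = s / d], [q = r / d], [p = d / (d + r)], [S] for the integral of [f `^ p] and
    [J_s] for the quantization constant of the exponent [s].

    Everything rests on a lower bound with a free weight ([weighted_lower_bound]): for every
    bounded step function [psi >= 0] with bounded domain of integration, every quantizer
    [al] with at most [n] points satisfies, for [n] large,
      J_s (1 + sg) \int psi^sg f^(1/(1+sg))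
        <= n^sg \int dist(x, al)^s f(x) dx + J_s sg (1/n) \sum_(a in al) psi(a)^(1+sg) + e.
    Indeed, in a small cube of side [l] where [f] is about the constant [c] and which contains
    [m] of the [n] points, the distortion is at least [J_s c l^(d+s) m^(-sg)], because [J_s] is
    an infimum over all sizes of quantizers. Young's inequality ([young_dual]) bounds this
    convex function of [m] below by an affine one, whose slope is a free parameter
    [psi]; the affine terms then add up to the sum over the quantizer.

    The bound is applied three times.

    For the exponent [r] and the indicator of a box, with quantizers that have the rate
    [n^(-q)], it shows that [S] is finite ([integral_powR_density_lty]).

    For the exponent [r] and the weight [S (1 - h phi)^(1/(1+q))], it shows where the points
    of an asymptotically optimal sequence lie. Distributing points with density
    proportional to [f `^ p] gives quantizers with normalized distortion close to
    [J_r S^(1+q)] ([zador_upper_bound]), so an asymptotically optimal sequence does not exceed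
    this value. For [h] small, the bound then reads, to first order in [h],
      (1/n) \sum_(a in al) phi(a) <= S^(-1) \int phi f^p + e      ([point_density_le]).

    For the exponent [s] and the weight [psi = S f^(1/(1+sg) - p)] on a bounded set where [f] is
    bounded and bounded away from [0], the left-hand side is
    [J_s (1 + sg) S^sg \int f^(1 - p sg)], and by the preceding estimate for [phi] proportional
    to [psi^(1+sg)] the sum over the quantizer is at most [J_s sg S^sg \int f^(1 - p sg)]. The
    difference is the claimed bound on that set ([mismatch_core]), as [p sg = s / (d + r)], and
    such sets exhaust the set where [f] is positive.

    The singular part of [P] can only increase distortions, so it is harmless in the lower
    bounds. In the upper bound it is covered by a set of small Lebesgue measure, which
    receives enough of the points for its contribution to be negligible ([good_weights]).
*)

(** * Power inequalities *)

Section power_inequalities.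
Context {R : realType}.
Implicit Types c w l m x y t p a : R.

(** Young's inequality for the exponents [1 + a] and [(1 + a) / a]. With [w] read as a
    density of points, [c * w `^ (- a)] is a local distortion, which is thus bounded below
    by an affine function of [w]; for [l] positive it is the tangent at
    [w = c `^ (1 + a)^-1 / l]. *)
Lemma young_dual a c w l : 0 < a -> 0 <= c -> 0 < w -> 0 <= l ->
  (1 + a) * c `^ (1 + a)^-1 * l `^ a <= c * w `^ (- a) + a * l `^ (1 + a) * w.
Proof.
move=> a0 c0 w0 l0.
have a1 : 0 < 1 + a by rewrite addr_gt0.
have a1n : 1 + a != 0 by rewrite gt_eqF.
have an : a != 0 by rewrite gt_eqF.
have q0 : 0 < (1 + a) / a by rewrite divr_gt0.
pose u := (c * w `^ (- a)) `^ (1 + a)^-1.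
pose v := (l `^ (1 + a) * w) `^ (a / (1 + a)).
have pq : (1 + a)^-1 + ((1 + a) / a)^-1 = 1 by field; rewrite an a1n.
have := conjugate_powR (powR_ge0 _ _ : 0 <= u) (powR_ge0 _ _ : 0 <= v) a1 q0 pq.
have -> : u `^ (1 + a) = c * w `^ (- a).
  by rewrite /u -powRrM mulVf// powRr1 ?mulr_ge0 ?powR_ge0.
have -> : v `^ ((1 + a) / a) = l `^ (1 + a) * w.
  rewrite /v -powRrM (_ : _ / _ * _ = 1); last by field; rewrite an a1n.
  by rewrite powRr1// mulr_ge0 ?powR_ge0 ?ltW.
have -> : u * v = c `^ (1 + a)^-1 * l `^ a.
  rewrite /u /v !powRM ?powR_ge0 ?(ltW w0)// -!powRrM.
  rewrite (_ : (1 + a) * (a / (1 + a)) = a); last by field.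
  rewrite -mulrA; congr (_ * _).
  rewrite mulrCA -powRD; last by rewrite (gt_eqF w0) implybT.
  by rewrite (_ : _ + _ = 0) ?powRr0 ?mulr1//; field.
move=> uv; rewrite -mulrA -ler_pdivlMl//; apply: (le_trans uv).
rewrite le_eqVlt; apply/orP; left; apply/eqP; field.
by rewrite an a1n.
Qed.

(** Convexity: the case [c = 1], [l = t^-1] of [young_dual] is the tangent at [t]. *)
Lemma powRN_tangent a t x : 0 < a -> 0 < t -> 0 < x ->
  (1 + a) * t `^ (- a) <= x `^ (- a) + a * t `^ (- a - 1) * x.
Proof.
move=> a0 t0 x0.
have t1 : 0 <= t^-1 by rewrite invr_ge0 ltW.
have := young_dual a0 ler01 x0 t1.
have invE y : t^-1 `^ y = t `^ (- y).
  by rewrite -(powR_inv1 (ltW t0)) -powRrM mulN1r.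
by rewrite powR1 mulr1 mul1r !invE opprD (addrC (-1)).
Qed.

Lemma powR_1B_ge p y : 0 < p -> 0 <= y -> y < 1 ->
  1 - p * (y / (1 - y)) <= (1 - y) `^ p.
Proof.
move=> p0 y0 y1.
have z0 : 0 < 1 - y by rewrite subr_gt0.
have zi : 0 < (1 - y)^-1 by rewrite invr_gt0.
have := powRN_tangent p0 ltr01 zi.
rewrite !powR1 !mulr1 -(powR_inv1 (ltW z0)) -powRrM mulN1r opprK.
rewrite powR_inv1 ?(ltW z0)// -lerBlDr; apply: le_trans.
rewrite le_eqVlt; apply/orP; left; apply/eqP; field.
by rewrite gt_eqF.
Qed.

Lemma powR_subadd p x y : 0 < p -> p <= 1 -> 0 <= x -> 0 <= y ->
  (x + y) `^ p <= x `^ p + y `^ p.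
Proof.
move=> p0 p1; rewrite le_eqVlt => /predU1P[<- _|x0].
  by rewrite !add0r powR0 ?gt_eqF// add0r.
rewrite le_eqVlt => /predU1P[<-|y0].
  by rewrite !addr0 powR0 ?gt_eqF// addr0.
have s0 : 0 < x + y by rewrite addr_gt0.
have h z : 0 < z -> z <= x + y -> z / (x + y) * (x + y) `^ p <= z `^ p.
  move=> z0 zs; rewrite -ler_pdivlMr ?powR_gt0//.
  have -> : z `^ p / (x + y) `^ p = (z / (x + y)) `^ p.
    rewrite powRM ?(ltW z0) ?invr_ge0 ?(ltW s0)//; congr (_ * _).
    by rewrite -(powR_inv1 (ltW s0)) -powRrM mulN1r powRN.
  apply: ger1_powR => //; rewrite divr_gt0//= ler_pdivrMr// mul1r//.
have -> : (x + y) `^ p = x / (x + y) * (x + y) `^ p + y / (x + y) * (x + y) `^ p.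
  by rewrite -mulrDl -mulrDl divff ?gt_eqF// mul1r.
by apply: lerD; apply: h => //; rewrite ?lerDl ?lerDr ltW.
Qed.

Lemma powR_div p x y : 0 <= x -> 0 < y -> (x / y) `^ p = x `^ p * y `^ (- p).
Proof.
move=> x0 y0; rewrite powRM ?invr_ge0 ?(ltW y0)//; congr (_ * _).
by rewrite -(powR_inv1 (ltW y0)) -powRrM mulN1r.
Qed.

Lemma ler_powRN p x y : 0 <= p -> 0 < x -> x <= y -> y `^ (- p) <= x `^ (- p).
Proof.
move=> p0 x0 xy; have y0 := lt_le_trans x0 xy.
rewrite !powRN lef_pV2 ?posrE ?powR_gt0//.
by apply: ge0_ler_powR => //; rewrite nnegrE ltW.
Qed.

Lemma powR_continuous (a e : R) : 0 < a -> {for a, continuous (fun x : R => x `^ e)}.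
Proof.
move=> a0; apply: differentiable_continuous; apply/derivable1_diffP.
by apply: derivable_powR; rewrite in_itv/= a0.
Qed.

Lemma powR_le_between (a y m : R) : 1 <= m -> m^-1 <= y <= m -> y `^ a <= m `^ `|a|.
Proof.
move=> m1 /andP[ym my]; have m0 : 0 < m by exact: lt_le_trans m1.
have y0 : 0 < y by apply: lt_le_trans ym; rewrite invr_gt0.
have [a0|a0] := leP 0 a.
  by rewrite ger0_norm//; apply: ge0_ler_powR; rewrite ?nnegrE ?(ltW y0) ?(ltW m0).
rewrite ltr0_norm//; have -> : a = - (- a) by rewrite opprK.
have na0 : 0 <= - a by rewrite oppr_ge0 ltW.
have m10 : 0 < m^-1 by rewrite invr_gt0.
apply: (le_trans (ler_powRN na0 m10 ym)).
by rewrite opprK -powR_inv1 ?(ltW m0)// -powRrM mulN1r.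
Qed.

Lemma powR_le_1D (a y : R) : 0 <= y -> 0 < a -> a <= 1 -> y `^ a <= 1 + y.
Proof.
move=> y0 a0 a1; have [y1|y1] := leP y 1.
  apply: (@le_trans _ _ 1); last by rewrite lerDl.
  have p1 : 1 = 1 `^ a :> R by rewrite powR1.
  by rewrite [leRHS]p1; apply: ge0_ler_powR; rewrite ?nnegrE ?(ltW a0).
apply: (@le_trans _ _ y); last by rewrite lerDr.
rewrite -[leRHS]powRr1//; apply: ler_powR => //; exact: ltW.
Qed.

End power_inequalities.

(** * Norms on row vectors and distances to sets *)

Section norm_and_distance.
Context {R : realType} {d : nat}.
Variable N : 'rV[R]_d -> R.
Hypothesis hN : is_norm N.

Let N0 : forall x, N x = 0 -> x = 0. Proof. by case: hN. Qed.
Let NZ : forall (a : R) x, N (a *: x) = `|a| * N x. Proof. by case: hN. Qed.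
Let ND : forall x y, N (x + y) <= N x + N y. Proof. by case: hN. Qed.

Lemma normZ (a : R) x : N (a *: x) = `|a| * N x. Proof. exact: NZ. Qed.

Lemma norm_at0 : N 0 = 0.
Proof. by rewrite -(scale0r 0) NZ normr0 mul0r. Qed.

Lemma normN x : N (- x) = N x.
Proof. by rewrite -scaleN1r NZ normrN normr1 mul1r. Qed.

Lemma norm_ge0 x : 0 <= N x.
Proof.
have := ND x (- x); rewrite subrr norm_at0 normN => h.
by rewrite -(pmulr_rge0 _ (ltr0n R 2)) mulr_natl mulr2n.
Qed.

Lemma norm_sub x y : N (x - y) = N (y - x).
Proof. by rewrite -normN opprB. Qed.

Lemma norm_le_coord : exists2 b : R, 0 < b &
  forall (x : 'rV[R]_d) rho, 0 <= rho -> (forall t, `|x 0 t| <= rho) -> N x <= b * rho.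
Proof.
pose b := 1 + \sum_t N (delta_mx 0 t).
have b0 : 0 < b by rewrite ltr_pwDl// sumr_ge0// => t _; exact: norm_ge0.
exists b => // x rho r0 xr.
have Nsum (I : Type) (s : seq I) (F : I -> 'rV[R]_d) :
    N (\sum_(i <- s) F i) <= \sum_(i <- s) N (F i).
  elim/big_ind2 : _ => [|u u' v v' uv uv'|//]; first by rewrite norm_at0.
  by apply: (le_trans (ND _ _)); exact: lerD.
rewrite [x]row_sum_delta; apply: (le_trans (Nsum _ _ _)).
rewrite mulrDl mul1r -[leLHS]add0r lerD// mulr_suml; apply: ler_sum => t _.
by rewrite NZ mulrC ler_wpM2l ?norm_ge0.
Qed.

Lemma norm_lip_continuous (f : 'rV[R]_d -> R) :
  (forall x y, f x - f y <= N (x - y)) -> continuous f.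
Proof.
move=> fN; have [b b0 Nb] := norm_le_coord.
move=> x A /nbhs_ballP[e /= e0 eA]; apply/nbhs_ballP.
exists (e / (2 * b)); first by rewrite /= divr_gt0// mulr_gt0.
move=> y [_ xy]; apply: eA.
rewrite /ball /=; apply: (@le_lt_trans _ _ (N (x - y))).
  by rewrite ler_norml fN andbT lerNl opprB norm_sub fN.
apply: (@le_lt_trans _ _ (b * (e / (2 * b)))).
  apply: Nb; first by rewrite divr_ge0// ?mulr_ge0 ?ltW.
  by move=> t; have /ltW := xy 0 t; rewrite !mxE.
rewrite (_ : b * _ = e / 2); last by field; rewrite gt_eqF.
by rewrite ltr_pdivrMr// ltr_pMr// ltrDl.
Qed.

Lemma norm_continuous : continuous N.
Proof.
apply: norm_lip_continuous => x y; rewrite lerBlDr.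
by apply: le_trans (ND _ _); rewrite subrK.
Qed.

(** By compactness the continuous function [N] has a positive minimum on every face
    [x_t = 1] of the unit cube of the sup norm; homogeneity does the rest. *)
Lemma coord_le_norm : exists2 a : R, 0 < a & forall (x : 'rV[R]_d) t, `|x 0 t| <= a * N x.
Proof.
pose K (t : 'I_d) := [set v : 'rV[R]_d | forall i,
  (if i == t then [set (1 : R)] else `[(-1 : R), 1]%classic) (v ord0 i)].
have cK t : compact (K t).
  apply: (@rV_compact _ _ (fun i => if i == t then [set (1 : R)] else `[(-1 : R), 1]%classic)) => i.
  by case: ifP => _; [exact: compact_set1|exact: segment_compact].
have h t : exists2 c : R, 0 < c & forall v, K t v -> c <= N v.
  have [|c cK' cmin] := EVT_min_rV _ (cK t) (continuous_subspaceT norm_continuous).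
    exists (\row_i (i == t)%:R) => i /=; rewrite mxE; case: ifP => // _ /=.
    by rewrite in_itv/= ler01 andbT lerNl oppr0 ler01.
  exists (N c).
    rewrite lt0r norm_ge0 andbT; apply/eqP => /N0 c0.
    move: cK'; rewrite inE => /(_ t) /=; rewrite eqxx c0 mxE => /eqP.
    by rewrite eq_sym oner_eq0.
  by move=> v Kv; apply: cmin; rewrite inE.
have [c c0 cP] : exists2 c : 'I_d -> R, (forall t, 0 < c t) &
    forall t v, K t v -> c t <= N v.
  have /choice[c cP] : forall t, exists c : R, 0 < c /\ forall v, K t v -> c <= N v.
    by move=> t; have [c] := h t; exists c.
  by exists c => t; have [] := cP t.
pose a := 1 + \sum_t (c t)^-1.
have ca t : (c t)^-1 <= a.
  rewrite /a (bigD1 t)//= -[leLHS]add0r lerD ?ler01// lerDl sumr_ge0// => i _.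
  by rewrite invr_ge0 ltW.
have a0 : 0 < a.
  by rewrite ltr_pwDl// sumr_ge0// => i _; rewrite invr_ge0 ltW.
exists a => // x t.
pose m := [arg max_(i > t) `|x 0 i|]%O.
have mP i : `|x 0 i| <= `|x 0 m|.
  by rewrite /m; case: arg_maxP => //= j _; exact.
apply: (le_trans (mP t)).
have [->|xm0] := eqVneq (x 0 m) 0; first by rewrite normr0 mulr_ge0 ?norm_ge0 ?ltW.
have : K m ((x 0 m)^-1 *: x).
  move=> i /=; rewrite mxE; have [->|im] := eqVneq i m; first by rewrite /= mulVf.
  rewrite /= in_itv/= -ler_norml normrM normfV mulrC ler_pdivrMr ?normr_gt0//.
  by rewrite mul1r.
move=> /cP; rewrite NZ normfV mulrC ler_pdivlMr ?normr_gt0// mulrC => h1.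
rewrite -(ler_pdivlMr _ _ (c0 m)) in h1.
by apply: (le_trans h1); rewrite mulrC ler_wpM2r ?norm_ge0.
Qed.

Lemma dist_ge0 x A : 0 <= dist N x A.
Proof.
rewrite /dist; have [->|/set0P[a Aa]] := eqVneq A set0.
  by rewrite image_set0 inf0.
apply: lb_le_inf; first by exists (N (x - a)); exists a.
by move=> _ [y _ <-]; exact: norm_ge0.
Qed.

Lemma dist_le x (A : set 'rV[R]_d) a : A a -> dist N x A <= N (x - a).
Proof.
move=> Aa; apply: ge_inf; last by exists a.
by exists 0 => _ [y _ <-]; exact: norm_ge0.
Qed.

Lemma dist_ge x (A : set 'rV[R]_d) c : A !=set0 ->
  (forall a, A a -> c <= N (x - a)) -> c <= dist N x A.
Proof.
move=> [a Aa] h; apply: lb_le_inf; first by exists (N (x - a)); exists a.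
by move=> _ [y Ay <-]; exact: h.
Qed.

Lemma dist_mono x (A B : set 'rV[R]_d) : A !=set0 -> A `<=` B ->
  dist N x B <= dist N x A.
Proof. by move=> A0 AB; apply: dist_ge => // a /AB; exact: dist_le. Qed.

Lemma dist_lip x y A : A !=set0 -> dist N x A <= dist N y A + N (x - y).
Proof.
move=> A0; rewrite -lerBlDr; apply: dist_ge => // a Aa.
rewrite lerBlDr; apply: (le_trans (dist_le x Aa)).
by apply: le_trans (ND _ _); rewrite [y - a + _]addrC addrA addrNK.
Qed.

Lemma continuous_rV_measurable (f : 'rV[R]_d -> R) :
  continuous f -> measurable_fun [set: 'rV[R]_d] (f : _ -> measurableTypeR R).
Proof.
move=> cf; apply: (@measurability _ _ _ _ _ _ (@RGenOpens.G R)).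
  exact: RGenOpens.measurableE.
move=> _ [_ [a [b ->]] <-]; rewrite setTI; apply: rV_open_measurable.
by apply: open_comp (@itv_open_ends_open _ _ `]a, b[ isT) => v _; exact: cf.
Qed.

Lemma measurable_norm : measurable_fun [set: 'rV[R]_d] N.
Proof. by apply: continuous_rV_measurable; exact: norm_continuous. Qed.

Lemma measurable_dist A : measurable_fun [set: 'rV[R]_d] (fun x => dist N x A).
Proof.
have [->|/set0P A0] := eqVneq A set0.
  rewrite (_ : (fun x => _) = cst 0); first exact: measurable_cst.
  by apply/funext => x; rewrite /dist image_set0 inf0.
apply: continuous_rV_measurable; apply: norm_lip_continuous => x y.
by rewrite lerBlDl; exact: dist_lip.
Qed.

End norm_and_distance.

(** * Integrals of nonnegative functions *)

Section nonnegative_integrals.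
Context d (T : measurableType d) (R : realType) (mu : {measure set T -> \bar R}).
Implicit Types F G : T -> R.
Local Open Scope ereal_scope.

Lemma ge0_le_integral_fin (D : set T) F G : measurable D ->
  measurable_fun setT F -> measurable_fun setT G ->
  (forall x, D x -> 0 <= F x)%R -> (forall x, D x -> F x <= G x)%R ->
  \int[mu]_(x in D) (F x)%:E <= \int[mu]_(x in D) (G x)%:E.
Proof.
move=> mD mF mG F0 FG; apply: ge0_le_integral => //.
- by apply/measurable_EFinP; exact: measurable_funTS.
- by apply/measurable_EFinP; exact: measurable_funTS.
Qed.

Lemma ge0_subset_integral_fin (A B : set T) F : measurable A -> measurable B ->
  measurable_fun setT F -> (forall x, 0 <= F x)%R -> A `<=` B ->
  \int[mu]_(x in A) (F x)%:E <= \int[mu]_(x in B) (F x)%:E.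
Proof.
move=> mA mB mF F0 AB; apply: ge0_subset_integral => //.
  by apply/measurable_EFinP; exact: measurable_funTS.
by move=> x _; rewrite lee_fin.
Qed.

Lemma ge0_integralZl_fin (D : set T) F (k : R) : measurable D ->
  measurable_fun setT F -> (forall x, D x -> 0 <= F x)%R -> (0 <= k)%R ->
  \int[mu]_(x in D) (k * F x)%:E = k%:E * \int[mu]_(x in D) (F x)%:E.
Proof.
move=> mD mF F0 k0; under eq_integral do rewrite EFinM.
rewrite ge0_integralZl//.
by apply/measurable_EFinP; exact: measurable_funTS.
Qed.

Lemma ge0_integralD_fin (D : set T) F G : measurable D ->
  measurable_fun setT F -> measurable_fun setT G ->
  (forall x, D x -> 0 <= F x)%R -> (forall x, D x -> 0 <= G x)%R ->
  \int[mu]_(x in D) (F x + G x)%:E =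
  \int[mu]_(x in D) (F x)%:E + \int[mu]_(x in D) (G x)%:E.
Proof.
move=> mD mF mG F0 G0; under eq_integral do rewrite EFinD.
rewrite ge0_integralD//; by apply/measurable_EFinP; exact: measurable_funTS.
Qed.

Lemma ge0_integral_cover (I : eqType) (s : seq I) (C : I -> set T) (D : set T) F :
  measurable D -> (forall i, measurable (C i)) ->
  measurable_fun setT F -> (forall x, 0 <= F x)%R ->
  (forall x, D x -> exists2 i, i \in s & C i x) ->
  \int[mu]_(x in D) (F x)%:E <= \sum_(i <- s) \int[mu]_(x in C i) (F x)%:E.
Proof.
move=> mD mC mF F0; elim: s D mD => [|i s IHs] D mD Ds.
  rewrite big_nil (_ : D = set0) ?integral_set0//.
  by apply/seteqP; split => // x /Ds[].
have mDC : measurable (D `&` C i) by exact: measurableI.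
have mDD : measurable (D `\` C i) by exact: measurableD.
rewrite big_cons -(setUIDK D (C i)) ge0_integral_setU//; last 3 first.
- by apply/measurable_EFinP; exact: measurable_funTS.
- by move=> x _; rewrite lee_fin.
- by apply/disj_setPS => x [[_ Cx] [_ /(_ Cx)]].
apply: leeD; first exact: ge0_subset_integral_fin.
apply: IHs => // x [Dx nCx]; have [j] := Ds x Dx.
by rewrite inE => /predU1P[->//|js Cj]; exists j.
Qed.

Lemma integral_le_cst (D : set T) F (k m : R) : measurable D ->
  measurable_fun setT F -> (forall x, D x -> 0 <= F x)%R ->
  (forall x, D x -> F x <= k)%R -> (0 <= k)%R -> mu D <= m%:E ->
  \int[mu]_(x in D) (F x)%:E <= (k * m)%:E.
Proof.
move=> mD mF F0 Fk k0 Dm.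
apply: (@le_trans _ _ (\int[mu]_(x in D) k%:E)).
  by apply: ge0_le_integral => //; apply/measurable_EFinP; exact: measurable_funTS.
by rewrite integral_cst// EFinM lee_wpmul2l// lee_fin.
Qed.

Lemma integral_exhaust (X : nat -> set T) (Y : set T) F (c : \bar R) :
  (forall k, measurable (X k)) -> nondecreasing_seq X -> \bigcup_k X k = Y ->
  measurable_fun setT F -> (forall x, 0 <= F x)%R ->
  c < \int[mu]_(x in Y) (F x)%:E ->
  exists k0, forall k, (k0 <= k)%N -> c < \int[mu]_(x in X k) (F x)%:E.
Proof.
move=> mX ndX XY mF F0 cY.
have cvgX : \int[mu]_(x in X i) (F x)%:E @[i --> \oo] --> \int[mu]_(x in Y) (F x)%:E.
  rewrite -XY; apply: ge0_nondecreasing_set_cvg_integral => //.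
    by move=> i; apply/measurable_EFinP; exact: measurable_funTS.
  by move=> i x _; rewrite lee_fin.
have [k0 _ k0P] := cvgX _ (open_ereal_gt' cY).
by exists k0 => k kk; exact: k0P.
Qed.

Lemma integral_tail (X : nat -> set T) F (e : R) :
  (forall k, measurable (X k)) -> nondecreasing_seq X -> \bigcup_k X k = setT ->
  measurable_fun setT F -> (forall x, 0 <= F x)%R ->
  \int[mu]_x (F x)%:E < +oo -> (0 < e)%R ->
  exists k0, forall k, (k0 <= k)%N -> \int[mu]_(x in ~` X k) (F x)%:E <= e%:E.
Proof.
move=> mX ndX XT mF F0 Foo e0.
have Ffin : \int[mu]_x (F x)%:E \is a fin_num.
  by rewrite ge0_fin_numE// integral_ge0// => x _; rewrite lee_fin.
have [|k0 k0P] := @integral_exhaust X setT F (\int[mu]_x (F x)%:E - e%:E) mX ndX XT mF F0.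
  by rewrite lte_subel_addl// lteDr// lte_fin.
exists k0 => k /k0P.
have mXk := mX k; have mCk : measurable (~` X k) by exact: measurableC.
have split_k : \int[mu]_x (F x)%:E =
    \int[mu]_(x in X k) (F x)%:E + \int[mu]_(x in ~` X k) (F x)%:E.
  rewrite -(setUv (X k)) ge0_integral_setU//.
  - by rewrite setUv; apply/measurable_EFinP.
  - by move=> x _; rewrite lee_fin.
  - by apply/disj_setPS => x [].
have a0 : 0 <= \int[mu]_(x in X k) (F x)%:E.
  by apply: integral_ge0 => x _; rewrite lee_fin.
have b0 : 0 <= \int[mu]_(x in ~` X k) (F x)%:E.
  by apply: integral_ge0 => x _; rewrite lee_fin.
move: Ffin; rewrite split_k.
move: a0 b0; case: (\int[mu]_(x in X k) _) => [a| |]; case: (\int[mu]_(x in ~` _) _) => [b| |] //=.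
rewrite -EFinD -EFinB lte_fin !lee_fin => _ _ _; lra.
Qed.

Import HBNNSimple.

Lemma powR_nnsfun_cvg (v : R^nat) (l e : R) : (0 < e)%R ->
  (forall n, 0 <= v n <= l)%R -> v @ \oo --> l ->
  (v n `^ e)%R @[n --> \oo] --> (l `^ e)%R.
Proof.
move=> e0 vl cvl.
have l0 : (0 <= l)%R by have /andP[] := vl 0%N; exact: le_trans.
move: l0; rewrite le_eqVlt => /predU1P[l0|l0].
  have v0 n : v n = 0%R by apply/eqP; rewrite eq_le andbC; move: (vl n); rewrite -l0.
  rewrite (_ : (fun n => _) = cst (l `^ e)%R); first exact: cvg_cst.
  by apply/funext => n /=; rewrite v0 l0.
apply: (cvg_comp _ (fun x : R => (x `^ e)%R) cvl).
have : {for l, continuous (fun x : R => (x `^ e)%R)}.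
  apply: differentiable_continuous; apply/derivable1_diffP.
  by apply: derivable_powR; rewrite in_itv/= l0.
exact.
Qed.

(** Monotone convergence along simple functions that increase to [v]. *)
Lemma integral_powR_nnsfun (D : set T) (a v : T -> R) (e : R) (c : \bar R) :
  measurable D -> measurable_fun setT a -> measurable_fun setT v ->
  (forall x, 0 <= a x)%R -> (forall x, 0 <= v x)%R -> (0 < e)%R ->
  c < \int[mu]_(x in D) (a x * v x `^ e)%:E ->
  exists h : {nnsfun T >-> R}, (forall x, h x <= v x)%R /\
    c < \int[mu]_(x in D) (a x * h x `^ e)%:E.
Proof.
move=> mD ma mv a0 v0 e0 cD.
have mv' : measurable_fun setT (EFin \o v) by exact/measurable_EFinP.
pose h := nnsfun_approx measurableT mv'.
have v0' x : setT x -> (0 <= (EFin \o v) x)%E by rewrite lee_fin.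
have hv x : h n x @[n --> \oo] --> v x.
  by apply: (@fine_cvg _ _ _ _ (EFin \o (fun n => h n x))); exact: (cvg_nnsfun_approx measurableT mv' v0').
have hnd x : {homo (fun n => h n x) : n m / (n <= m)%N >-> (n <= m)%R}.
  by move=> n m nm; exact/lefP/nd_nnsfun_approx.
have hlev n x : (h n x <= v x)%R.
  rewrite -(cvg_lim _ (hv x))//.
  apply: (nondecreasing_cvgn_le (hnd x)).
  by apply/cvg_ex; exists (v x); exact: hv.
have mg n : measurable_fun D (fun x => (a x * h n x `^ e)%:E).
  apply/measurable_EFinP/measurable_funM; apply: measurable_funTS => //.
  exact: (measurableT_comp (measurable_powR e)).
have cvgI : \int[mu]_(x in D) (a x * h n x `^ e)%:E @[n --> \oo] -->
    \int[mu]_(x in D) (a x * v x `^ e)%:E.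
  rewrite (eq_integral (fun x => limn (fun n => (a x * h n x `^ e)%:E))).
    apply: cvg_monotone_convergence => //.
      by move=> n x _; rewrite lee_fin mulr_ge0 ?powR_ge0.
    move=> x _ n m nm; rewrite lee_fin ler_wpM2l// ge0_ler_powR ?nnegrE ?(ltW e0)//.
    exact: hnd.
  move=> x _; apply/esym/cvg_lim => //; apply/cvg_EFin; first by near=> n.
  apply: cvgMr; apply: powR_nnsfun_cvg => // n.
  by rewrite hlev andbT.
have [n0 _ nP] := cvgI _ (open_ereal_gt' cD).
by exists (h n0); split; [move=> x; exact: hlev|exact: (nP n0 (leqnn n0))].
Unshelve. all: by end_near. Qed.

End nonnegative_integrals.

Section density.
Context d (T : measurableType d) (R : realType).
Context (mu : {sigma_finite_measure set T -> \bar R}).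
Local Open Scope ereal_scope.

(** The Radon-Nikodym derivative of [nu] satisfies this identity and equals [f] almost
    everywhere. *)
Lemma integral_density (nu : {measure set T -> \bar R}) (f u : T -> R) (X : set T) :
  nu setT < +oo -> is_density mu nu f -> measurable X ->
  measurable_fun setT u -> (forall x, 0 <= u x)%R ->
  \int[nu]_(x in X) (u x)%:E = \int[mu]_(x in X) (u x * f x)%:E.
Proof.
move=> nufin [mf f0 nuf] mX mu_ u0.
have finnu : fin_num_fun nu.
  move=> A mA; rewrite ge0_fin_numE// (le_lt_trans _ nufin)//.
  by apply: le_measure; rewrite ?inE.
pose H1 := isFinite.Build _ _ _ nu finnu.
have sfnu : sigma_finite setT nu.
  by apply: fin_num_fun_sigma_finite => //; rewrite measure0.
pose H2 := isSFinite.Build _ _ _ nu (sfinite_measure_sigma_finite sfnu).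
pose H3 := isSigmaFinite.Build _ _ _ nu sfnu.
pose nu' : {finite_measure set T -> \bar R} :=
  HB.pack_for (FiniteMeasure.type T R) (Measure.sort nu) H1 H2 H3.
have numu : nu' `<< mu.
  apply/null_content_dominatesP => A mA muA; rewrite /= nuf//.
  by apply: null_set_integral => //; apply/measurable_EFinP; exact: measurable_funTS.
have mfE : measurable_fun setT (EFin \o f) by exact/measurable_EFinP.
have fE : ae_eq mu X (Radon_Nikodym_SigmaFinite.f nu' mu) (EFin \o f).
  apply: integral_ae_eq => //.
  - by apply: (integrableS measurableT) => //; exact: Radon_Nikodym_SigmaFinite.f_integrable.
  - exact: measurable_funTS.
  - by move=> A _ mA; rewrite -Radon_Nikodym_SigmaFinite.f_integral//= nuf.
have mRN := measurable_int _ (Radon_Nikodym_SigmaFinite.f_integrable numu).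
have muX : measurable_fun X (fun x => (u x)%:E).
  by apply/measurable_EFinP; exact: measurable_funTS.
have u0' x : 0 <= (u x)%:E by rewrite lee_fin.
rewrite -[LHS]/(\int[nu']_(x in X) (u x)%:E).
rewrite -(Radon_Nikodym_SigmaFinite.change_of_variables numu u0' mX muX).
apply: ge0_ae_eq_integral => //.
- by apply: emeasurable_funM => //; exact: measurable_funTS.
- by apply/measurable_EFinP; apply: measurable_funM; exact: measurable_funTS.
- by move=> x _; rewrite mule_ge0// Radon_Nikodym_SigmaFinite.f_ge0.
- by move=> x _; rewrite lee_fin mulr_ge0.
- by apply: filterS fE => x fEx Xx; rewrite fEx.
Qed.

(** The null set is one that carries the singular part. *)
Lemma ac_part_density (P : probability T R) (Pa : {measure set T -> \bar R}) (f : T -> R) :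
  is_ac_part mu P Pa -> is_density mu Pa f ->
  exists A, [/\ measurable A, mu A = 0 &
    forall (X : set T) (u : T -> R), measurable X -> X `<=` ~` A ->
      measurable_fun setT u -> (forall x, 0 <= u x)%R ->
      \int[P]_(x in X) (u x)%:E = \int[mu]_(x in X) (u x * f x)%:E].
Proof.
move=> [_ [Ps [[B mB [PsB muB]] PE]]] dPa.
exists (~` B); split => //; first exact: measurableC.
move=> X u mX; rewrite setCK => XB mu_ u0.
have PX Y : measurable Y -> Y `<=` X -> P Y = Pa Y.
  move=> mY YX; rewrite PE// [X in _ + X](_ : _ = 0) ?adde0//.
  apply/eqP; rewrite eq_le measure_ge0 andbT -PsB.
  by apply: le_measure; rewrite ?inE//; exact: subset_trans XB.
rewrite -(integral_density _ dPa mX mu_ u0); last first.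
  apply: (@le_lt_trans _ _ (P setT)); last by rewrite probability_setT ltry.
  by rewrite PE// leeDl.
by apply: eq_measure_integral => Y mY YX; exact: PX.
Qed.

End density.

(** * Finite lists as quantizers *)

Section quantizer_lists.
Context {R : realType} {d : nat}.
Implicit Types (A : set 'rV[R]_d) (s : seq 'rV[R]_d).

Lemma quantizer_seq A n : A !=set0 -> (A #<= `I_n)%card ->
  exists s, [/\ s != [::], (size s <= n)%N & A = [set` s]].
Proof.
move=> [a Aa] An.
have fA : finite_set A by exact: card_le_finite An (finite_II n).
exists (finmap.enum_fset (fset_set A)); split.
- by apply/eqP => s0; move: Aa; rewrite -(fset_setK fA) => /=; rewrite -[_ \in _]/(_ \in finmap.enum_fset _) s0.
- exact: geq_card_fset_set.
- by rewrite -[LHS](fset_setK fA).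
Qed.

Lemma seq_card_le s : ([set` s] #<= `I_(size s))%card.
Proof.
have -> : [set` s] = nth 0 s @` `I_(size s).
  apply/seteqP; split => [x /= xs|_ [i /= si <-]].
    by exists (index x s); rewrite ?nth_index//= index_mem.
  exact: mem_nth.
exact: card_image_le.
Qed.

Lemma seq_nonempty s : s != [::] -> [set` s] !=set0.
Proof. by case: s => // x s _; exists x => /=; rewrite mem_head. Qed.

End quantizer_lists.

(** * Scaling of Lebesgue measure *)

Section lebesgue_scaling.
Context {R : realType} {d : nat}.
Local Notation lam := (lebesgue_rV R d).
Implicit Types (c x y : 'rV[R]_d).

Definition open_box (p : 'rV[R]_d * 'rV[R]_d) : set 'rV[R]_d :=
  [set v | forall i, `]p.1 0 i, p.2 0 i[%classic (v 0 i)].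

Lemma lebesgue_open_box p :
  lam (open_box p) = (\prod_(i < d) Num.max 0 (p.2 0 i - p.1 0 i))%:E.
Proof.
rewrite /open_box (@lebesgue_rV_box R d (fun i => `]p.1 0 i, p.2 0 i[%classic))//.
rewrite (big_morph EFin EFinM (erefl _)); apply: eq_bigr => i _.
rewrite lebesgue_measure_itv/= lte_fin; case: ltP => h.
  by rewrite -EFinB max_r// subr_ge0 ltW.
by rewrite max_l// subr_le0.
Qed.

Lemma open_box_measurable p : measurable (open_box p).
Proof. by apply: (@measurable_rV_box R d (fun i => `]p.1 0 i, p.2 0 i[%classic)). Qed.

Lemma open_box_setI : setI_closed (range open_box).
Proof.
move=> _ _ [p _ <-] [q _ <-].
exists (\row_i Num.max (p.1 0 i) (q.1 0 i), \row_i Num.min (p.2 0 i) (q.2 0 i)) => //.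
apply/seteqP; split=> [v h|v [h1 h2] i].
  by split=> i; have := h i; rewrite /= !mxE !in_itv/= gt_max lt_min;
      move=> /andP[/andP[h1 h2] /andP[h3 h4]]; rewrite ?h1 ?h2 ?h3 ?h4.
have := h1 i; have := h2 i; rewrite /= !mxE !in_itv/= gt_max lt_min.
by move=> /andP[-> ->] /andP[-> ->].
Qed.

Lemma ball_open_box x (e : R) : 0 < e ->
  ball x e = open_box (\row_i (x 0 i - e), \row_i (x 0 i + e)).
Proof.
move=> e0; apply/seteqP; split=> [v [_ h] i|v h].
  by have := h 0 i; rewrite /= !mxE in_itv/= /ball/= distrC ltr_distl.
by split=> // i j; have := h j; rewrite /= !mxE in_itv/= ord1 /ball/= distrC ltr_distl.
Qed.

Lemma measurable_open_box : @measurable _ 'rV[R]_d = <<s range open_box >>.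
Proof.
apply/seteqP; split; last first.
  apply: smallest_sub; first exact: sigma_algebra_measurable.
  by move=> _ [p _ <-]; exact: open_box_measurable.
apply: smallest_sub; first exact: smallest_sigma_algebra.
move=> U oU; rewrite (rV_open_cover_rat oU).
have sg := @smallest_sigma_algebra _ [set: 'rV[R]_d] (range open_box).
rewrite bigcup_mkcond.
apply: (@countable_bigcupT_measurable _ (g_sigma_algebraType (range open_box))).
  exact: countableP.
move=> [v k] /=; case: ifPn => _; last exact: measurable0.
rewrite ball_open_box ?invr_gt0//; apply: sub_gen_smallest.
by eexists.
Qed.

Definition affine c (l : R) y : 'rV[R]_d := c + l *: y.

Lemma affine_measurable c (l : R) :
  measurable_fun [set: 'rV[R]_d] (affine c l).
Proof.
apply: (@measurability _ _ _ _ _ _ (range open_box)).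
  exact: measurable_open_box.
move=> _ [_ [p _ <-] <-]; rewrite setTI.
have -> : affine c l @^-1` open_box p = \bigcap_(i in [set: 'I_d])
   [set y : 'rV[R]_d | `]p.1 0 i, p.2 0 i[%classic (c 0 i + l * y 0 i)].
  apply/seteqP; split => [y h i _|y h i]; first by have := h i; rewrite /= !mxE.
  by have := h i I; rewrite /= !mxE.
apply: fin_bigcap_measurable => // i _; rewrite -[X in measurable X]setTI.
have mf : measurable_fun [set: 'rV[R]_d] (fun y : 'rV[R]_d => c 0 i + l * y 0 i).
  apply: measurable_funD => //; apply: measurable_funM => //.
  exact: measurable_rV_coord.
exact: mf.
Qed.

(** Both sides are measures that agree on the open boxes, a class stable under
    intersection that generates the Borel sets. *)
Lemma lebesgue_affine c (l : R) (A : set 'rV[R]_d) : 0 < l -> measurable A ->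
  lam A = ((l ^+ d)%:E * lam (affine c l @^-1` A))%E.
Proof.
move=> l0 mA; pose T := affine c l.
have mT : measurable_fun [set: 'rV[R]_d] T by exact: affine_measurable.
pose m1 : {measure set 'rV[R]_d -> \bar R} :=
  measure_function_pushforward__canonical__measure_function_Measure lam mT.
pose k : {nonneg R} := NngNum (exprn_ge0 d (ltW l0)).
rewrite -[RHS]/(mscale k m1 A).
pose g (n : nat) := open_box (const_mx (- n%:R), const_mx (n%:R)).
apply: (@measure_unique _ _ _ (range open_box) g measurable_open_box
  open_box_setI) => //.
- apply/seteqP; split=> // v _.
  pose M := \sum_i `|v 0 i|.
  exists (Num.truncn M).+1 => //= i; rewrite /= !mxE in_itv/= -ltr_norml.
  apply: (@le_lt_trans _ _ M); last exact: truncnS_gt.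
  by rewrite /M (bigD1 i)//= lerDl sumr_ge0.
- move=> _ [p _ <-]; apply: (etrans (lebesgue_open_box p)).
  rewrite /= /mscale/= /pushforward.
  have -> : T @^-1` open_box p =
      open_box (\row_i ((p.1 0 i - c 0 i) / l), \row_i ((p.2 0 i - c 0 i) / l)).
    apply/seteqP; split=> y h i; have := h i; rewrite /= !mxE !in_itv/=.
      by rewrite ltr_pdivrMr// ltr_pdivlMr// ltrBlDl ltrBrDl (mulrC l).
    by rewrite ltr_pdivrMr// ltr_pdivlMr// ltrBlDl ltrBrDl (mulrC l).
  rewrite lebesgue_open_box -EFinM; congr EFin.
  rewrite -[d in l ^+ d]card_ord -prodr_const -big_split/=; apply: eq_bigr => i _.
  rewrite !mxE maxr_pMr ?(ltW l0)// mulr0 -mulrBl mulrC divfK ?gt_eqF//.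
  by rewrite opprB addrA subrK.
- by move=> n; apply: (@le_lt_trans _ _ (lam (g n))) => //; rewrite lebesgue_open_box ltry.
Qed.

Lemma integral_affine c (l : R) (D : set 'rV[R]_d) (F : 'rV[R]_d -> R) :
  0 < l -> measurable D -> measurable_fun setT F -> (forall x, 0 <= F x) ->
  (\int[lam]_(x in D) (F x)%:E =
   (l ^+ d)%:E * \int[lam]_(y in affine c l @^-1` D) (F (affine c l y))%:E)%E.
Proof.
move=> l0 mD mF F0; pose T := affine c l.
have mT : measurable_fun [set: 'rV[R]_d] T by exact: affine_measurable.
pose m1 : {measure set 'rV[R]_d -> \bar R} :=
  measure_function_pushforward__canonical__measure_function_Measure lam mT.
pose k : {nonneg R} := NngNum (exprn_ge0 d (ltW l0)).
rewrite (@eq_measure_integral _ _ _ _ (mscale k m1)); last first.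
  by move=> A mA _; exact: (lebesgue_affine c l0 mA).
have mFD : measurable_fun D (fun x => (F x)%:E).
  by apply/measurable_EFinP; exact: measurable_funTS.
rewrite ge0_integral_mscale//; last by move=> x _; rewrite lee_fin.
congr (_ * _)%E; apply: (ge0_integral_pushforward mT lam mD mFD).
by move=> y _; rewrite lee_fin.
Qed.

(** ** Cubes *)

Definition cube c (l : R) : set 'rV[R]_d :=
  [set x | forall i, c 0 i <= x 0 i <= c 0 i + l].

Lemma measurable_cube c l : measurable (cube c l).
Proof.
rewrite (_ : cube c l = [set v | forall i, `[c 0 i, c 0 i + l]%classic (v 0 i)]).
  exact: (@measurable_rV_box R d (fun i => `[c 0 i, c 0 i + l]%classic)).
by apply/seteqP; split=> v h i; have := h i; rewrite /= in_itv.
Qed.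

Lemma affine_cube c l : 0 < l -> affine c l @^-1` cube c l = @unit_cube R d.
Proof.
move=> l0; apply/seteqP; split=> y h i; have := h i; rewrite /= in_itv/= !mxE.
  by rewrite lerDl lerD2l pmulr_rge0// -ler_pdivlMl// mulVf// gt_eqF.
by rewrite lerDl lerD2l pmulr_rge0// -ler_pdivlMl// mulVf// gt_eqF.
Qed.

Lemma integral_cube c l (F : 'rV[R]_d -> R) : 0 < l ->
  measurable_fun setT F -> (forall x, 0 <= F x) ->
  (\int[lam]_(x in cube c l) (F x)%:E =
   (l ^+ d)%:E * \int[lam]_(y in @unit_cube R d) (F (affine c l y))%:E)%E.
Proof.
move=> l0 mF F0; rewrite (integral_affine c l0)//; last exact: measurable_cube.
by rewrite affine_cube.
Qed.

Lemma integral_uniform_cube (F : 'rV[R]_d -> R) :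
  measurable_fun setT F -> (forall x, 0 <= F x) ->
  (\int[@uniform_cube R d]_x (F x)%:E = \int[lam]_(x in @unit_cube R d) (F x)%:E)%E.
Proof.
move=> mF F0; have mU := @measurable_unit_cube R d.
have mCU := measurableC mU.
rewrite -(setUv (@unit_cube R d)) ge0_integral_setU//; last 3 first.
- by rewrite setUv; apply/measurable_EFinP.
- by move=> x _; rewrite lee_fin.
- by apply/disj_setPS => x [].
rewrite [X in (_ + X)%E]null_set_integral ?adde0//; last 2 first.
- by apply/measurable_EFinP; exact: measurable_funTS.
- by rewrite /= /uniform_cube /mrestr setICl measure0.
apply: eq_measure_integral => A mA AU.
by rewrite /= /uniform_cube /mrestr setIidl.
Qed.

End lebesgue_scaling.

(** * Dyadic cells and step functions *)

Section side.
Context {R : realType}.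
Implicit Types k : nat.

Definition side k : R := (2 ^+ k)^-1.

Lemma side_gt0 k : 0 < side k.
Proof. by rewrite invr_gt0 exprn_gt0. Qed.

Lemma side_lt (e : R) : 0 < e -> exists k0, forall k, (k0 <= k)%N -> side k < e.
Proof.
move=> e0; exists (Num.truncn e^-1).+1 => m km.
rewrite /side -[e]invrK ltf_pV2 ?posrE ?exprn_gt0 ?invr_gt0//.
apply: (lt_le_trans (truncnS_gt _)); rewrite -natrX ler_nat.
by rewrite (leq_trans km)// ltnW// ltn_expl.
Qed.

End side.

Section dyadic_cells.
Context {R : realType} {d : nat}.
Local Notation lam := (lebesgue_rV R d).
Implicit Types (x y c : 'rV[R]_d) (j : 'rV[int]_d) (k m K : nat).

Definition cell k x : 'rV[int]_d := \row_t Num.floor (2 ^+ k * x 0 t).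

Definition corner k j : 'rV[R]_d := \row_t ((j 0 t)%:~R * side k).

Definition dyadic k j : set 'rV[R]_d := [set x | cell k x = j].

Definition step (U : Type) k (f : 'rV[R]_d -> U) :=
  forall x y, cell k x = cell k y -> f x = f y.

(** Half-open, so that it is a union of cells of every level. *)
Definition box K : set 'rV[R]_d := [set x | forall t, - K%:R <= x 0 t < K%:R].

Definition cells k K : seq 'rV[int]_d :=
  [seq \row_t ((f t : nat)%:Z - (K * 2 ^ k)%N%:Z) |
     f : {ffun 'I_d -> 'I_(2 * K * 2 ^ k)}].

Lemma cellP k x j : cell k x = j <->
  forall t, (j 0 t)%:~R * side k <= x 0 t < ((j 0 t)%:~R + 1) * side k.
Proof.
have h t : (Num.floor (2 ^+ k * x 0 t) == j 0 t) =
    ((j 0 t)%:~R * side k <= x 0 t < ((j 0 t)%:~R + 1) * side k).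
  rewrite floor_eq intrD /side ler_pdivrMr ?exprn_gt0// ltr_pdivlMr ?exprn_gt0//.
  by rewrite (mulrC (x 0 t)).
split=> [xj t|xj]; first by rewrite -h -xj mxE.
by apply/rowP => t; rewrite mxE; apply/eqP; rewrite h.
Qed.

Lemma cell_refine k m x y : (k <= m)%N -> cell m x = cell m y -> cell k x = cell k y.
Proof.
move=> km /rowP xy; apply/rowP => t; have := xy t; rewrite !mxE.
have mk z : 2 ^+ m * z = 2 ^+ (m - k) * (2 ^+ k * z) :> R.
  by rewrite mulrA -exprD subnK.
rewrite (mk (x 0 t)) (mk (y 0 t)).
set a := 2 ^+ k * _; set b := 2 ^+ k * _ => ab.
have E (z : R) (i : int) : (i <= Num.floor z) = ((2 ^ (m - k))%N%:Z * i <= Num.floor (2 ^+ (m - k) * z)).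
  rewrite !floor_ge_int intrM -(ler_pM2l (exprn_gt0 (m - k) (ltr0n R 2))).
  by rewrite -[X in X * _ <= _]natrX.
have eqE i : (i <= Num.floor a) = (i <= Num.floor b).
  by rewrite (E a) (E b) ab.
by apply/le_anti; rewrite -eqE lexx eqE lexx.
Qed.

Lemma step_refine (U : Type) k m (f : 'rV[R]_d -> U) : (k <= m)%N -> step k f -> step m f.
Proof. by move=> km fk x y /(cell_refine km); exact: fk. Qed.

Lemma cell_corner k j : cell k (corner k j) = j.
Proof.
apply/cellP => t; rewrite mxE lexx /= ltr_pM2r ?side_gt0//.
by rewrite ltrDl.
Qed.

Lemma dyadic_itv k j : dyadic k j =
  [set v | forall t, `[(j 0 t)%:~R * side k, ((j 0 t)%:~R + 1) * side k[%classic (v 0 t)].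
Proof.
apply/seteqP; split=> x.
  by move=> /cellP h t; have := h t; rewrite /= in_itv.
by move=> h; apply/cellP => t; have := h t; rewrite /= in_itv.
Qed.

Lemma dyadic_measurable k j : measurable (dyadic k j).
Proof.
rewrite dyadic_itv.
exact: (@measurable_rV_box R d
  (fun t => `[(j 0 t)%:~R * side k, ((j 0 t)%:~R + 1) * side k[%classic)).
Qed.

Lemma lebesgue_dyadic k j : lam (dyadic k j) = (side k ^+ d)%:E.
Proof.
rewrite dyadic_itv (@lebesgue_rV_box R d
  (fun t => `[(j 0 t)%:~R * side k, ((j 0 t)%:~R + 1) * side k[%classic))//.
rewrite -[d in _ ^+ d]card_ord -prodr_const (big_morph EFin EFinM (erefl _)).
apply: eq_bigr => t _; rewrite lebesgue_measure_itv/= lte_fin ltr_pM2r ?side_gt0//.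
by rewrite ltrDl ltr01 -EFinB -mulrBl addrC addKr mul1r.
Qed.

Lemma dyadic_sub_cube k j : dyadic k j `<=` cube (corner k j) (side k).
Proof.
move=> x /cellP h t; have /andP[h1 h2] := h t; rewrite mxE h1/=.
by move: h2; rewrite mulrDl mul1r; exact: ltW.
Qed.

Lemma step_measurable k (f : 'rV[R]_d -> R) : step k f -> measurable_fun setT f.
Proof.
move=> fk _ Y mY; rewrite setTI.
rewrite (_ : f @^-1` Y = \bigcup_(j in [set j | Y (f (corner k j))]) dyadic k j).
  rewrite bigcup_mkcond; apply: countable_bigcupT_measurable; first exact: countableP.
  by move=> j; case: ifPn => // _; exact: dyadic_measurable.
apply/seteqP; split=> [x /= Yx|x [j /= Yj xj]].
  exists (cell k x) => //=; rewrite (fk _ x)// cell_corner//.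
by rewrite /preimage/= (fk _ (corner k j))// cell_corner.
Qed.

Lemma step_on_dyadic (U : Type) k (f : 'rV[R]_d -> U) j x : step k f -> dyadic k j x ->
  f x = f (corner k j).
Proof. by move=> fk xj; apply: fk; rewrite cell_corner. Qed.

Lemma step_comp2 (U V W : Type) k (F : U -> V -> W) (f : 'rV[R]_d -> U) (g : 'rV[R]_d -> V) :
  step k f -> step k g -> step k (fun x => F (f x) (g x)).
Proof. by move=> fk gk x y xy; rewrite (fk _ _ xy) (gk _ _ xy). Qed.

Lemma box_cells k K x : box K x <-> cell k x \in cells k K.
Proof.
split=> [xK|/mapP[f _ /rowP xf] t].
  have h t : (Num.floor (2 ^+ k * x 0 t) + (K * 2 ^ k)%N%:Z >= 0) /\
      (Num.floor (2 ^+ k * x 0 t) + (K * 2 ^ k)%N%:Z < (2 * K * 2 ^ k)%N%:Z).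
    have /andP[x1 x2] := xK t; have k0 := exprn_gt0 k (ltr0n R 2).
    have E : (K * 2 ^ k)%N%:Z%:~R = 2 ^+ k * K%:R :> R.
      by rewrite -[LHS]/((K * 2 ^ k)%:R) natrM natrX mulrC.
    rewrite -lerBlDr sub0r floor_ge_int intrN E -mulrN ler_pM2l// x1; split=> //.
    rewrite -ltrBrDr -mulnA mul2n -addnn PoszD addrK floor_lt_int E ltr_pM2l//.
  pose g (t : 'I_d) := absz (Num.floor (2 ^+ k * x 0 t) + (K * 2 ^ k)%N%:Z).
  have gE t : (g t)%:Z = Num.floor (2 ^+ k * x 0 t) + (K * 2 ^ k)%N%:Z.
    by rewrite /g gez0_abs//; have [] := h t.
  have glt t : (g t < 2 * K * 2 ^ k)%N by rewrite -ltz_nat gE; have [] := h t.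
  apply/mapP; exists [ffun t => Ordinal (glt t)]; first by rewrite mem_enum.
  by apply/rowP => t; rewrite !mxE ffunE/= gE addrK.
have := xf t; rewrite !mxE => /eqP; rewrite floor_eq => /andP[h1 h2].
have k0 := exprn_gt0 k (ltr0n R 2).
have E : (K * 2 ^ k)%N%:Z%:~R = 2 ^+ k * K%:R :> R.
  by rewrite -[LHS]/((K * 2 ^ k)%:R) natrM natrX mulrC.
rewrite -(ler_pM2l k0) -(ltr_pM2l k0) mulrN -E; apply/andP; split.
  by apply: le_trans h1; rewrite intrB lerBrDr addNr ler0n.
apply: (lt_le_trans h2); rewrite -[X in _ <= X]/((K * 2 ^ k)%N%:Z%:~R) ler_int.
rewrite lezD1 ltrBlDr -PoszD ltz_nat addnn -mul2n mulnA; exact: ltn_ord.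
Qed.

Lemma cells_uniq k K : uniq (cells k K).
Proof.
rewrite map_inj_uniq ?enum_uniq// => f g /rowP fg; apply/ffunP => t.
by have := fg t; rewrite !mxE => /addIr [] /val_inj.
Qed.

Lemma box_bigcup k K : box K = \big[setU/set0]_(j <- cells k K) dyadic k j.
Proof.
apply/seteqP; split=> x; rewrite -bigcup_seq.
  by move=> /(box_cells k) xk; exists (cell k x).
by move=> [j /= jc xj]; apply/(box_cells k); rewrite xj.
Qed.

Lemma box_measurable K : measurable (box K).
Proof.
rewrite (box_bigcup 0); apply: bigsetU_measurable => j _.
exact: dyadic_measurable.
Qed.

Lemma box_mono K m : (K <= m)%N -> box K `<=` box m.
Proof.
move=> Km x xK t; have /andP[h1 h2] := xK t.
by rewrite (le_trans _ h1) ?(lt_le_trans h2)// ?lerN2 ler_nat.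
Qed.

Lemma box_nd : nondecreasing_seq box.
Proof. by move=> m n mn; apply/subsetPset; exact: box_mono. Qed.

Lemma box_cover : \bigcup_K box K = setT.
Proof.
apply/seteqP; split=> // v _; pose M := \sum_i `|v 0 i|.
exists (Num.truncn M).+1 => //= t.
have : `|v 0 t| < (Num.truncn M).+1%:R.
  apply: (@le_lt_trans _ _ M); last exact: truncnS_gt.
  by rewrite /M (bigD1 t)//= lerDl sumr_ge0.
by rewrite ltr_norml => /andP[/ltW -> ->].
Qed.

Lemma step_box k K : step k (box K).
Proof.
move=> x y xy; apply/propext.
by split=> /(box_cells k) h; apply/(box_cells k); move: h; rewrite xy.
Qed.

Lemma step_box_indic k K : step k (\1_(box K) : 'rV[R]_d -> R).
Proof.
move=> x y xy; rewrite !indicE (_ : (x \in box K) = (y \in box K))//.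
by apply/idP/idP; rewrite !inE (step_box _ xy).
Qed.

Lemma indic01 (T : Type) (A : set T) (x : T) : 0 <= (\1_A x : R) <= 1.
Proof. by rewrite indicE; case: (_ \in _); rewrite /= ?lexx ler01. Qed.

Lemma integral_cells (mu : {measure set 'rV[R]_d -> \bar R}) k K (F : 'rV[R]_d -> R) :
  measurable_fun setT F -> (forall x, 0 <= F x) ->
  (\int[mu]_(x in box K) (F x)%:E =
   \sum_(j <- cells k K) \int[mu]_(x in dyadic k j) (F x)%:E)%E.
Proof.
move=> mF F0; rewrite (box_bigcup k) ge0_integral_bigsetU//.
- by move=> j; exact: dyadic_measurable.
- exact: cells_uniq.
- by apply/trivIsetP => i j _ _ ij; apply/seteqP; split=> // x [/= xi xj]; move: ij; rewrite -xi -xj eqxx.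
- by apply/measurable_EFinP; exact: measurable_funTS.
- by move=> x _; rewrite lee_fin.
Qed.

Lemma integral_step_dyadic k j (F : 'rV[R]_d -> R) : step k F -> (forall x, 0 <= F x) ->
  (\int[lam]_(x in dyadic k j) (F x)%:E = (F (corner k j) * side k ^+ d)%:E)%E.
Proof.
move=> Fk F0.
rewrite (eq_integral (cst (F (corner k j))%:E)); last first.
  by move=> x; rewrite inE => xj; rewrite (step_on_dyadic Fk xj).
rewrite (integral_cst lam (dyadic_measurable k j)) EFinM.
by congr (_ * _)%E; exact: lebesgue_dyadic.
Qed.

Lemma integral_step k K (F : 'rV[R]_d -> R) : step k F -> (forall x, 0 <= F x) ->
  (\int[lam]_(x in box K) (F x)%:E =
   (\sum_(j <- cells k K) F (corner k j) * side k ^+ d)%:E)%E.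
Proof.
move=> Fk F0; rewrite (integral_cells lam k)//; last exact: step_measurable Fk.
rewrite -sumEFin; apply: eq_bigr => j _; exact: integral_step_dyadic.
Qed.

Lemma lebesgue_box_fin K : (lam (box K) < +oo)%E.
Proof.
have := @integral_step 0 K (cst 1) (fun _ _ _ => erefl) (fun _ => ler01).
rewrite (_ : \int[lam]_(x in box K) (cst 1 x)%:E = lam (box K))%E.
  by move=> ->; exact: ltry.
by rewrite -[LHS]/(\int[lam]_(x in box K) cst 1 x)%E (integral_cst lam (box_measurable K)) mul1e.
Qed.

End dyadic_cells.

(** * Approximation of measurable functions by step functions *)

Section step_approximation.
Context {R : realType} {d : nat}.
Variable mu : {measure set 'rV[R]_d -> \bar R}.
Hypothesis mu_fin : (mu setT < +oo)%E.

(** Equality off a set of small measure, rather than closeness in some norm, is preserved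
    by every pointwise operation. *)
Definition step_approx (f : 'rV[R]_d -> R) := forall e : R, 0 < e ->
  exists k g B, [/\ step k (g : 'rV[R]_d -> R), measurable B,
    forall x, g x <> f x -> B x & (mu B <= e%:E)%E].

Lemma step_approx_lim (f : 'rV[R]_d -> R) :
  (forall e : R, 0 < e -> exists g B, [/\ step_approx g, measurable B,
    forall x, g x <> f x -> B x & (mu B <= e%:E)%E]) -> step_approx f.
Proof.
move=> h e e0; have e20 : 0 < e / 2 by rewrite divr_gt0.
have [g [B [ag mB gB muB]]] := h _ e20.
have [k [g' [B' [kg' mB' gB' muB']]]] := ag _ e20.
exists k, g', (B `|` B'); split => //; first exact: measurableU.
  move=> x g'f; have [g'g|/gB'] := pselect (g' x = g x); last by right.
  by left; apply: gB => gf; apply: g'f; rewrite g'g.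
apply: (le_trans (measureU2 _ mB mB')).
by rewrite [e]splitr EFinD leeD.
Qed.

Lemma step_approx_comp2 (F : R -> R -> R) f g : step_approx f -> step_approx g ->
  step_approx (fun x => F (f x) (g x)).
Proof.
move=> af ag e e0; have e20 : 0 < e / 2 by rewrite divr_gt0.
have [k [f' [B [kf' mB fB muB]]]] := af _ e20.
have [m [g' [B' [mg' mB' gB' muB']]]] := ag _ e20.
exists (maxn k m), (fun x => F (f' x) (g' x)), (B `|` B'); split.
- apply: step_comp2; first by apply: step_refine kf'; rewrite leq_maxl.
  by apply: step_refine mg'; rewrite leq_maxr.
- exact: measurableU.
- move=> x h; have [f'f|/fB] := pselect (f' x = f x); last by left.
  have [g'g|/gB'] := pselect (g' x = g x); last by right.
  by case: h; rewrite f'f g'g.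
- apply: (le_trans (measureU2 _ mB mB')).
  by rewrite [e]splitr EFinD leeD.
Qed.

Lemma step_approx_step k f : step k f -> step_approx f.
Proof.
move=> fk e e0; exists k, f, set0; split=> //.
by rewrite measure0 lee_fin ltW.
Qed.

Lemma step_approx_nd (E : nat -> set 'rV[R]_d) :
  (forall n, measurable (E n)) -> nondecreasing_seq E ->
  (forall n, step_approx \1_(E n)) -> step_approx \1_(\bigcup_n E n).
Proof.
move=> mE ndE aE; apply: step_approx_lim => e e0.
have mU : measurable (\bigcup_n E n) by exact: bigcupT_measurable.
have finU : mu (\bigcup_n E n) \is a fin_num.
  rewrite ge0_fin_numE//; apply: le_lt_trans mu_fin.
  by apply: le_measure; rewrite ?inE.
have := @nondecreasing_cvg_mu _ _ _ mu E mE mU ndE.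
have lt : (mu (\bigcup_n E n) - e%:E < mu (\bigcup_n E n))%E.
  by rewrite lte_subel_addl// lteDr// lte_fin.
move=> /(_ _ (open_ereal_gt' lt))[n0 _ /(_ n0 (leqnn _)) /= hn].
exists \1_(E n0), (\bigcup_n E n `\` E n0); split=> //; first exact: measurableD.
  move=> x h; split.
    apply: contrapT => nUx; apply: h; rewrite !indicE !memNset//.
    by move=> Ex; apply: nUx; exists n0.
  by move=> Ex; apply: h; rewrite !indicE !mem_set//; exists n0.
rewrite measureD//; last by rewrite -ge0_fin_numE.
rewrite setIidr; last by move=> x Ex; exists n0.
have finE : mu (E n0) \is a fin_num.
  rewrite ge0_fin_numE//; apply: le_lt_trans mu_fin.
  by apply: le_measure; rewrite ?inE.
by rewrite leeBlDr// addeC -leeBlDr// ltW.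
Qed.

(** An open set is the increasing union of its level [k] parts, each made of the cells
    that it contains. *)
Lemma step_approx_open (U : set 'rV[R]_d) : open U -> step_approx \1_U.
Proof.
move=> oU; pose V k := [set x : 'rV[R]_d | forall y, cell k y = cell k x -> U y].
have sV k : step k (V k).
  move=> x y xy; apply/propext.
  by split=> h z zx; apply: h; rewrite zx xy.
have sV1 k : step k (\1_(V k) : 'rV[R]_d -> R).
  move=> x y xy; rewrite !indicE (_ : (x \in V k) = (y \in V k))//.
  by apply/idP/idP; rewrite !inE (sV k x y xy).
have -> : U = \bigcup_k V k.
  apply/seteqP; split=> x; last by move=> [k _]; exact.
  move=> Ux; have /nbhs_ballP[e /= e0 eU] : nbhs x U by exact: open_nbhs_nbhs.
  have [k kP] := side_lt e0; exists k => // y yx; apply: eU.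
  split=> // i t; rewrite ord1 /ball/=.
  have /cellP/(_ t)/andP[x1 x2] := erefl (cell k x).
  have /cellP/(_ t)/andP[y1 y2] := yx.
  apply: le_lt_trans (kP k (leqnn k)).
  rewrite ler_norml; move: x1 x2 y1 y2; rewrite mulrDl mul1r.
  by move: (_ * side k) => a; move=> *; apply/andP; split; lra.
apply: step_approx_nd => [n|m n mn|n].
- have := step_measurable (sV1 n); move=> /(_ measurableT [set 1] (measurable_set1 1)).
  rewrite setTI; congr measurable; apply/seteqP; split=> x /=.
    rewrite indicE; have [|_] := boolP (x \in V n); first by rewrite inE.
    by move=> /= /eqP; rewrite eq_sym oner_eq0.
  by move=> Vx; rewrite indicE mem_set.
- apply/subsetPset => x Vx y yx; apply: Vx; exact: cell_refine yx.
- exact: step_approx_step (sV1 n).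
Qed.

(** The sets with this property form a sigma-algebra that contains the open sets. *)
Lemma step_approx_indic (E : set 'rV[R]_d) : measurable E -> step_approx \1_E.
Proof.
suff : measurable `<=` [set E : set 'rV[R]_d | measurable E /\ step_approx \1_E].
  by move=> h /h[].
have a0 : step_approx \1_(set0 : set 'rV[R]_d).
  by apply: (@step_approx_step 0) => x y _; rewrite !indicE !in_set0.
apply: smallest_sub; last first.
  by move=> U oU; split; [exact: rV_open_measurable|exact: step_approx_open].
split.
- by split.
- move=> A [mA aA]; split; first by rewrite setTD; exact: measurableC.
  rewrite (_ : \1_(setT `\` A) = (fun x => 1 - \1_A x)); last first.
    by apply/funext => x; rewrite setTD !indicE in_setC; case: (x \in A); rewrite /= ?subrr ?subr0.
  exact: (step_approx_comp2 (fun a _ => 1 - a) aA aA).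
- move=> F hF; have mF n : measurable (F n) by have [] := hF n.
  split; first exact: bigcupT_measurable.
  pose G n := \big[setU/set0]_(i < n.+1) F i.
  have mG n : measurable (G n) by apply: bigsetU_measurable => i _.
  rewrite (_ : \bigcup_n F n = \bigcup_n G n); last first.
    exact/esym/bigcup_bigsetU_bigcup.
  apply: step_approx_nd => //.
    by move=> m n mn; apply/subsetPset; exact: subset_bigsetU.
  elim=> [|n IHn]; first by rewrite /G big_ord1; have [] := hF 0%N.
  rewrite /G big_ord_recr/= -/(G n).
  rewrite (_ : \1_ _ = (fun x => Num.max (\1_(G n) x) (\1_(F n.+1) x))); last first.
    apply/funext => x; rewrite !indicE in_setU.
    by case: (x \in G n); case: (x \in F n.+1); rewrite /= ?maxxx// ?(max_l ler01) ?(max_r ler01).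
  by apply: (step_approx_comp2 Num.max) => //; have [] := hF n.+1.
Qed.

Import HBNNSimple.

Lemma step_approx_sum (I : Type) (s : seq I) (F : I -> 'rV[R]_d -> R) :
  (forall i, step_approx (F i)) -> step_approx (fun x => \sum_(i <- s) F i x).
Proof.
move=> aF; elim: s => [|i s IHs].
  by apply: (@step_approx_step 0) => x y _; rewrite !big_nil.
rewrite (_ : (fun _ => _) = (fun x => F i x + \sum_(j <- s) F j x)).
  exact: (step_approx_comp2 +%R).
by apply/funext => x; rewrite big_cons.
Qed.

Lemma step_approx_nnsfun (h : {nnsfun 'rV[R]_d >-> R}) : step_approx h.
Proof.
rewrite (_ : (h : _ -> R) = (fun x => \sum_(i <- finmap.enum_fset (fset_set (range h))) i * \1_(h @^-1` [set i]) x)).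
  apply: step_approx_sum => i.
  have a : step_approx \1_(h @^-1` [set i]) by exact: step_approx_indic.
  exact: (step_approx_comp2 (fun u _ => i * u) a a).
by apply/funext => x; rewrite fimfunE fsbig_finite.
Qed.

(** Truncating the step function at [0] and [M] keeps it equal to [f] wherever it was. *)
Lemma step_approx_bounded (f : 'rV[R]_d -> R) (M e : R) : step_approx f ->
  (forall x, 0 <= f x <= M) -> 0 < e ->
  exists k g B, [/\ step k (g : 'rV[R]_d -> R), measurable B,
    forall x, 0 <= g x <= M, forall x, g x <> f x -> B x & (mu B <= e%:E)%E].
Proof.
move=> af fM e0; pose F u (_ : R) := Num.max 0 (Num.min u M).
have [k [g [B [kg mB gB muB]]]] := af _ e0.
have M0 : 0 <= M by have /andP[h1 h2] := fM 0; exact: le_trans h2.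
exists k, (fun x => F (g x) (g x)), B; split=> //.
- exact: step_comp2.
- by move=> x; rewrite /F le_max lexx/= ge_max M0 ge_min lexx orbT.
- move=> x h; apply: gB => gf; apply: h; rewrite gf /F.
  by have /andP[h1 h2] := fM x; rewrite min_l// max_r.
Qed.

End step_approximation.

(** * Quantizers with uniform rate *)

Section root_nat.
Context {R : realType}.

Lemma powR_root (d : nat) (y : R) : (0 < d)%N -> 0 <= y -> (y `^ d%:R^-1) ^+ d = y.
Proof.
move=> d0 y0; rewrite -powR_mulrn ?powR_ge0// -powRrM mulVf ?pnatr_eq0 -?lt0n//.
by rewrite powRr1.
Qed.

Lemma powR_pow_inv (d : nat) (y : R) : (0 < d)%N -> 0 <= y -> (y ^+ d) `^ d%:R^-1 = y.
Proof.
move=> d0 y0; rewrite -powR_mulrn// -powRrM mulfV ?pnatr_eq0 -?lt0n//.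
by rewrite powRr1.
Qed.

(** The root of [b * y], rounded down, works once the roots of [a * y] and [b * y] are at
    distance at least [1]. *)
Lemma pow_nat_between (d : nat) (a b : R) : (0 < d)%N -> 0 < a -> a < b ->
  exists y0, forall y, y0 <= y -> exists m : nat,
    (0 < m)%N /\ a * y <= m%:R ^+ d <= b * y.
Proof.
move=> d0 a0 ab; have b0 := lt_trans a0 ab.
set p := (d%:R^-1 : R).
have p0 : 0 < p by rewrite invr_gt0 ltr0n.
have apbp : a `^ p < b `^ p by apply: gt0_ltr_powR => //; rewrite nnegrE ltW.
have g0 : 0 < b `^ p - a `^ p by rewrite subr_gt0.
exists (Num.max 1 (Num.max ((b `^ p - a `^ p)^-1 ^+ d) b^-1)) => y.
rewrite !ge_max => /and3P[y1 yg yb].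
have y0 : 0 < y by exact: lt_le_trans y1.
exists (Num.truncn ((b * y) `^ p)).
have by0 : 0 <= b * y by rewrite mulr_ge0 ?ltW.
have /andP[m1 m2] := truncn_itv (powR_ge0 (b * y) p).
split.
  have p1 : 1 = 1 `^ p :> R by rewrite powR1.
  rewrite truncn_gt0 [leLHS]p1 ge0_ler_powR ?(ltW p0) ?nnegrE//.
  by rewrite mulrC -ler_pdivrMr// mul1r.
apply/andP; split; last first.
  rewrite -[leRHS](powR_root d0 by0) lerXn2r ?nnegrE ?ler0n ?powR_ge0//.
rewrite -(powR_root d0 (_ : 0 <= a * y)) ?mulr_ge0 ?(ltW a0) ?(ltW y0)//.
rewrite lerXn2r ?nnegrE ?ler0n ?powR_ge0// -/p.
move: m2; rewrite -natr1 -ltrBlDr => /ltW; apply: le_trans.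
rewrite !powRM ?(ltW a0) ?(ltW b0) ?(ltW y0)//.
rewrite lerBrDr -lerBrDl -mulrBl -ler_pdivrMl// mulr1.
rewrite -(powR_pow_inv d0 (_ : 0 <= (b `^ p - a `^ p)^-1)) ?invr_ge0 ?(ltW g0)//.
by rewrite ge0_ler_powR ?(ltW p0) ?nnegrE ?exprn_ge0 ?invr_ge0 ?(ltW g0) ?(ltW y0).
Qed.

End root_nat.

Section pierce.
Context {R : realType}.
Variables (m : R) (m_gt0 : 0 < m).

(** The images of [k] equidistant points of [[0, 1[] under [u |-> (1 - u) `^ (- m) - 1],
    a bijection onto the half-line, and their opposites: the gaps widen with the distance
    to the origin. *)
Definition pierce_pt (k : nat) (i : nat) : R :=
  if (i < k)%N then (1 - i%:R / k%:R) `^ (- m) - 1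
  else 1 - (1 - (i - k)%:R / k%:R) `^ (- m).

(** The mesh of the grid near [t] is [k^-1] times the derivative there of the
    parametrization, which is of order [(1 + `|t|) `^ (1 + m^-1)]. *)
Lemma pierce_pt_near k (t : R) : (0 < k)%N -> exists i : 'I_(2 * k),
  `|t - pierce_pt k i| <= m / k%:R * (1 + `|t|) `^ (1 + m^-1).
Proof.
move=> k0; have k0' : 0 < k%:R :> R by rewrite ltr0n.
pose a := (1 + `|t|) `^ (- m^-1).
have u1 : 1 <= 1 + `|t| by rewrite lerDl.
have u0 : 0 < 1 + `|t| by exact: lt_le_trans u1.
have a0 : 0 < a by rewrite powR_gt0.
have a1 : a <= 1.
  have -> : 1 = 1 `^ (- m^-1) :> R by rewrite powR1.
  by rewrite ler_powRN ?invr_ge0 ?(ltW m_gt0).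
have am : a `^ (- m) = 1 + `|t|.
  by rewrite /a -powRrM mulrNN mulVf ?gt_eqF// powRr1// ltW.
have am1 : a `^ (- m - 1) = (1 + `|t|) `^ (1 + m^-1).
  rewrite /a -powRrM; congr (_ `^ _); field; exact: lt0r_neq0.
have z0 : 0 <= (1 - a) * k%:R by rewrite mulr_ge0 ?subr_ge0// ltW.
pose i := Num.truncn ((1 - a) * k%:R).
have /andP[i1 i2] := truncn_itv z0; rewrite -/i in i1 i2.
have ik : (i < k)%N.
  by rewrite -(ltr_nat R); apply: (le_lt_trans i1); rewrite gtr_pMl// ltrBlDr ltrDl.
pose b := 1 - i%:R / k%:R : R.
have ab : a <= b by rewrite /b lerBrDr -lerBrDl ler_pdivrMr.
have b0 : 0 < b by exact: lt_le_trans ab.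
have ba : b - a <= k%:R^-1.
  have -> : b - a = ((1 - a) * k%:R - i%:R) / k%:R.
    by rewrite /b; field; exact: lt0r_neq0.
  rewrite ler_pdivrMr// mulVf ?gt_eqF//.
  have iS : i.+1%:R = i%:R + 1 :> R by rewrite -natr1.
  by move: i2; rewrite iS; lra.
have key : `| `|t| - (b `^ (- m) - 1)| <= m / k%:R * (1 + `|t|) `^ (1 + m^-1).
  have tE : `|t| - (b `^ (- m) - 1) = a `^ (- m) - b `^ (- m).
    by rewrite am opprB addrA (addrC 1).
  rewrite tE ger0_norm ?subr_ge0 ?ler_powRN ?(ltW m_gt0)//.
  have := powRN_tangent m_gt0 a0 b0.
  have aM : a `^ (- m) = a `^ (- m - 1) * a.
    rewrite -[X in _ = _ * X]powRr1 ?(ltW a0)// -powRD ?subrK//.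
    by rewrite (gt_eqF a0) implybT.
  rewrite mulrDl mul1r => h; apply: (@le_trans _ _ (m * a `^ (- m - 1) * (b - a))).
    rewrite mulrBr -[X in _ <= _ - X]mulrA -aM; lra.
  rewrite am1 -mulrA [X in _ <= X]mulrAC -mulrA ler_wpM2l ?(ltW m_gt0)//.
  by rewrite ler_wpM2l ?powR_ge0.
have [t0|t0] := leP 0 t.
  have ik2 : (i < 2 * k)%N by rewrite mul2n -addnn ltn_addr.
  by exists (Ordinal ik2); rewrite /pierce_pt/= ik; move: key; rewrite (ger0_norm t0).
have ik2 : (k + i < 2 * k)%N by rewrite mul2n -addnn ltn_add2l.
exists (Ordinal ik2); rewrite /pierce_pt/= ltnNge leq_addr/= addKn -/b.
move: key; rewrite (ltr0_norm t0) -normrN; apply: le_trans.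
by rewrite le_eqVlt; apply/orP; left; apply/eqP; congr (`| _ |); lra.
Qed.

End pierce.

Section rate.
Context {R : realType} {d : nat}.
Variable N : 'rV[R]_d -> R.
Hypothesis hN : is_norm N.
Hypothesis d_gt0 : (0 < d)%N.
Local Notation lam := (lebesgue_rV R d).
Local Notation dst x s := (dist N x [set` s]).
Implicit Types (s g : seq 'rV[R]_d).

(** Pierce's construction: a product grid covers the whole space at the optimal rate in
    the number [y] of points, and the price for leaving every bounded set is a power of
    the norm as close to [1] as desired. *)
Lemma pierce_quantizer (kap : R) : 0 < kap -> exists2 C : R, 0 < C &
  forall y, (2 ^ d)%:R <= y -> exists s, [/\ s != [::], (size s)%:R <= y &
    forall x, dst x s <= C * y `^ (- d%:R^-1) * (1 + N x) `^ (1 + kap)].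
Proof.
move=> kap0; have m0 : 0 < kap^-1 by rewrite invr_gt0.
have [b b0 Nb] := norm_le_coord hN; have [a a0 aN] := coord_le_norm hN.
pose A := Num.max 1 a.
have A1 : 1 <= A by rewrite le_max lexx.
have aA : a <= A by rewrite le_max lexx orbT.
pose C := 4 * b * kap^-1 * A `^ (1 + kap).
have A0 : 0 < A by exact: lt_le_trans A1.
exists C; first by rewrite /C !mulr_gt0 ?powR_gt0.
move=> y y2; have y0 : 0 < y by apply: lt_le_trans y2; rewrite ltr0n expn_gt0.
pose k := Num.truncn (y `^ d%:R^-1 / 2).
have y20 : 0 <= y `^ d%:R^-1 / 2 by rewrite divr_ge0 ?powR_ge0.
have /andP[k1 k2] := truncn_itv y20; rewrite -/k in k1 k2.
have y1 : 1 <= y `^ d%:R^-1 / 2.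
  rewrite ler_pdivlMr// mul1r -[leLHS](@powR_pow_inv _ d)// ge0_ler_powR ?nnegrE ?invr_ge0 ?ler0n ?exprn_ge0 ?(ltW y0)//.
  by rewrite -natrX.
have k0 : (0 < k)%N by rewrite truncn_gt0.
have k0' : 0 < k%:R :> R by rewrite ltr0n.
pose s : seq 'rV[R]_d := [seq \row_t pierce_pt kap^-1 k (f t) | f : {ffun 'I_d -> 'I_(2 * k)}].
have sz : size s = ((2 * k) ^ d)%N.
  by rewrite size_map -cardE card_ffun !card_ord.
exists s; split.
- by rewrite -size_eq0 sz expn_eq0 muln_eq0/= negb_and -lt0n k0.
- rewrite sz natrX -[leRHS](powR_root d_gt0 (ltW y0)) lerXn2r ?nnegrE ?ler0n ?powR_ge0//.
  by rewrite natrM mulrC -ler_pdivlMr.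
move=> x.
have [f fP] := choice (fun t : 'I_d => pierce_pt_near m0 (x 0 t) k0).
pose p : 'rV[R]_d := \row_t pierce_pt kap^-1 k (f t).
have ps : p \in s.
  apply/mapP; exists [ffun t => f t]; first by rewrite mem_enum.
  by apply/rowP => t; rewrite !mxE ffunE.
apply: (le_trans (dist_le hN x (ps : [set` s] p))).
pose rho := kap^-1 / k%:R * (A `^ (1 + kap) * (1 + N x) `^ (1 + kap)).
have kap1 : 0 <= 1 + kap by rewrite addr_ge0// ltW.
have Nx0 := norm_ge0 hN x.
apply: (@le_trans _ _ (b * rho)).
  apply: Nb; first by rewrite /rho !mulr_ge0 ?powR_ge0 ?divr_ge0 ?(ltW m0).
  move=> t; rewrite !mxE; apply: (le_trans (fP t)); rewrite invrK.
  rewrite ler_wpM2l ?divr_ge0 ?(ltW m0)// -powRM ?(ltW A0) ?addr_ge0//.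
  apply: ge0_ler_powR; rewrite ?nnegrE ?addr_ge0 ?mulr_ge0 ?(ltW A0) ?(ltW kap0) ?addr_ge0//.
  rewrite mulrDr mulr1 lerD//; apply: (le_trans (aN x t)).
  by rewrite ler_wpM2r.
have ik : k%:R^-1 <= 4 * y `^ (- d%:R^-1).
  rewrite powRN -[4]invrK -invfM lef_pV2 ?posrE ?mulr_gt0 ?invr_gt0 ?powR_gt0//.
  have kS : k.+1%:R = k%:R + 1 :> R by rewrite -natr1.
  move: k2; rewrite kS => k2.
  have k11 : 1 <= k%:R :> R by rewrite ler1n.
  by rewrite mulrC; lra.
rewrite /rho /C.
have -> : b * (kap^-1 / k%:R * (A `^ (1 + kap) * (1 + N x) `^ (1 + kap))) =
   (b * kap^-1 * A `^ (1 + kap) * (1 + N x) `^ (1 + kap)) * k%:R^-1 by ring.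
have -> : 4 * b / kap * A `^ (1 + kap) * y `^ (- d%:R^-1) * (1 + N x) `^ (1 + kap) =
   (b * kap^-1 * A `^ (1 + kap) * (1 + N x) `^ (1 + kap)) * (4 * y `^ (- d%:R^-1)) by ring.
by rewrite ler_wpM2l// !mulr_ge0 ?powR_ge0 ?(ltW b0) ?(ltW m0).
Qed.

(** ** The constant of the uniform distribution *)

Section uniform_constant.
Variables (s : R) (s_gt0 : 0 < s).
Local Notation sg := (s / d%:R).

Let sg_gt0 : 0 < sg. Proof. by rewrite divr_gt0// ltr0n. Qed.

Lemma measurable_dist_powR A (p : R) :
  measurable_fun [set: 'rV[R]_d] (fun x => dist N x A `^ p).
Proof.
exact: (measurableT_comp (measurable_powR p) (measurable_dist hN A)).
Qed.

Lemma distortion_uniform A : distortion N (@uniform_cube R d) s A =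
  (\int[lam]_(x in @unit_cube R d) (dist N x A `^ s)%:E)%E.
Proof.
rewrite /distortion integral_uniform_cube//; first exact: measurable_dist_powR.
by move=> x; exact: powR_ge0.
Qed.

Lemma poweR_lt_inv (x : \bar R) (t p : R) : (0 <= x)%E -> 0 <= t -> 0 < p ->
  (x `^ p < t%:E)%E -> (x < (t `^ p^-1)%:E)%E.
Proof.
move=> x0 t0 p0 xt; rewrite ltNge; apply/negP => h; move: xt; apply/negP.
rewrite -leNgt -[X in (X <= _)%E](_ : ((t `^ p^-1)%:E `^ p = t%:E)%E); last first.
  by rewrite poweR_EFin -powRrM mulVf ?gt_eqF// powRr1.
apply: gt0_ler_poweR => //; rewrite ?ltW// in_itv/= leey andbT//.
by rewrite lee_fin powR_ge0.
Qed.

Lemma distortion_ge0 (mu : probability 'rV[R]_d R) p A : (0 <= distortion N mu p A)%E.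
Proof. by apply: integral_ge0 => x _; rewrite lee_fin powR_ge0. Qed.

Lemma quantization_error_ge0 (mu : probability 'rV[R]_d R) n p :
  (0 <= quantization_error N mu n p)%E.
Proof. by apply: le_ereal_inf_tmp => _ [A _ <-]; exact: poweR_ge0. Qed.

Lemma quantization_error_le (mu : probability 'rV[R]_d R) n p (a : seq 'rV[R]_d) :
  0 < p -> a != [::] -> (size a <= n)%N ->
  (quantization_error N mu n p `^ p <= distortion N mu p [set` a])%E.
Proof.
move=> p0 a0 an.
have h : (quantization_error N mu n p <= distortion N mu p [set` a] `^ p^-1)%E.
  apply: ge_ereal_inf; exists (distortion N mu p [set` a] `^ p^-1)%E => //.
  exists [set` a] => //; split; first exact: seq_nonempty.
  apply: (card_le_trans (seq_card_le a)); apply: subset_card_le => i /= ia.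
  exact: leq_trans an.
rewrite -[leRHS](poweRe1 (distortion_ge0 mu p _)) -[in leRHS](mulVf (lt0r_neq0 p0)) poweRrM.
apply: gt0_ler_poweR => //; rewrite ?ltW// in_itv/= leey andbT.
  exact: quantization_error_ge0.
exact: poweR_ge0.
Qed.

Lemma quantization_const_le n (a : seq 'rV[R]_d) :
  (0 < n)%N -> a != [::] -> (size a <= n)%N ->
  (quantization_const N s <= (n%:R `^ sg)%:E *
     \int[lam]_(x in @unit_cube R d) (dst x a `^ s)%:E)%E.
Proof.
move=> n0 a0 an; rewrite -distortion_uniform.
apply: ge_ereal_inf; eexists; first by exists n.
by rewrite lee_wpmul2l ?lee_fin ?powR_ge0//; exact: quantization_error_le.
Qed.

Lemma quantization_const_near (t : R) : (quantization_const N s < t%:E)%E ->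
  exists n (a : seq 'rV[R]_d), [/\ (0 < n)%N, a != [::], (size a <= n)%N &
   ((n%:R `^ sg)%:E * \int[lam]_(x in @unit_cube R d) (dst x a `^ s)%:E < t%:E)%E].
Proof.
move=> /ereal_inf_lt[_ [n /= n0 <-]] h.
have n0' : 0 < n%:R `^ sg by rewrite powR_gt0// ltr0n.
have t0 : 0 < t.
  rewrite -lte_fin; apply: le_lt_trans h.
  by rewrite mule_ge0 ?lee_fin ?powR_ge0// poweR_ge0.
have h' : (quantization_error N (@uniform_cube R d) n s `^ s < (t / n%:R `^ sg)%:E)%E.
  by rewrite mulrC EFinM lte_pdivlMl.
have t0' : 0 <= t / n%:R `^ sg by rewrite divr_ge0 ?ltW.
have := poweR_lt_inv (quantization_error_ge0 _ _ _) t0' s_gt0 h'.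
move=> /ereal_inf_lt[_ [A [A0 An] <-]].
have [a [a0 an ->]] := quantizer_seq A0 An => hA.
exists n, a; split => //; rewrite -distortion_uniform.
rewrite muleC -lte_pdivlMr//; move: hA => /poweR_lt_inv.
move=> /(_ (distortion_ge0 _ _ _) (powR_ge0 _ _)).
rewrite invr_gt0 => /(_ s_gt0); rewrite invrK -powRrM mulVf ?gt_eqF// powRr1//.
Qed.

Lemma quantization_const_ge0 : (0 <= quantization_const N s)%E.
Proof.
by apply: le_ereal_inf_tmp => _ [n _ <-]; rewrite mule_ge0 ?lee_fin ?powR_ge0 ?poweR_ge0.
Qed.

Lemma norm_bound_cube : exists2 b : R, 0 < b & forall x, @unit_cube R d x -> N x <= b.
Proof.
have [b b0 Nb] := norm_le_coord hN; exists b => // x xc.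
rewrite -[b]mulr1; apply: Nb => // t.
by have := xc t; rewrite /= in_itv/= => /andP[h1 h2]; rewrite ger0_norm.
Qed.

Lemma quantization_const_lty : (quantization_const N s < +oo)%E.
Proof.
have [b b0 Nb] := norm_bound_cube.
apply: (le_lt_trans (@quantization_const_le 1 [:: 0] isT isT isT)).
rewrite powR1 mul1e.
apply: (@le_lt_trans _ _ (b `^ s * 1)%:E); last exact: ltry.
apply: integral_le_cst; rewrite ?powR_ge0//.
- exact: measurable_unit_cube.
- exact: measurable_dist_powR.
- by move=> x _; exact: powR_ge0.
- move=> x /Nb xb; apply: ge0_ler_powR; rewrite ?nnegrE ?(ltW s_gt0) ?(ltW b0)//.
    exact: dist_ge0.
  by apply: le_trans xb; rewrite -[X in N X]subr0; apply: dist_le => //=; rewrite mem_head.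
- by rewrite [leLHS]lebesgue_unit_cube.
Qed.

(** The cubes centred at the [n] points with total volume [1 / 2] leave half of the unit
    cube at distance at least of order [n `^ (- d%:R^-1)] from all of them. *)
Lemma quantization_const_gt0 : (0 < quantization_const N s)%E.
Proof.
have [a a0 aN] := coord_le_norm hN.
pose c : R := (2 * a) `^ (- s) * 2 `^ (- sg) / 2.
have c0 : 0 < c by rewrite /c !mulr_gt0 ?powR_gt0 ?invr_gt0 ?mulr_gt0.
suff : forall n (al : seq 'rV[R]_d), (0 < n)%N -> al != [::] -> (size al <= n)%N ->
    (c%:E <= (n%:R `^ sg)%:E * \int[lam]_(x in @unit_cube R d) (dst x al `^ s)%:E)%E.
  move=> h; rewrite ltNge; apply/negP => J0.
  have : (quantization_const N s < c%:E)%E by apply: (le_lt_trans J0); rewrite lte_fin.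
  by move=> /quantization_const_near[n [al [n0 al0 aln]]]; rewrite ltNge h.
move=> n al n0 al0 aln; have n0' : 0 < n%:R :> R by rewrite ltr0n.
pose w : R := (2 * n%:R) `^ (- d%:R^-1).
have w0 : 0 < w by rewrite powR_gt0// mulr_gt0.
have wd : w ^+ d = (2 * n%:R)^-1.
  by rewrite /w powRN exprVn powR_root// mulr_ge0.
pose rho := w / (2 * a).
have rho0 : 0 < rho by rewrite divr_gt0// mulr_gt0.
pose Q (p : 'rV[R]_d) := cube (p - const_mx (w / 2)) w.
pose E := @unit_cube R d `&` \big[setU/set0]_(p <- al) Q p.
have mQ p : measurable (Q p) by exact: measurable_cube.
have mQs : measurable (\big[setU/set0]_(p <- al) Q p).
  by apply: bigsetU_measurable => p _.
have mU := @measurable_unit_cube R d.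
have mE : measurable E by exact: measurableI.
have lamQ p : lam (Q p) = (w ^+ d)%:E.
  rewrite (lebesgue_affine (p - const_mx (w / 2)) w0)// affine_cube//.
  by rewrite lebesgue_unit_cube mule1.
have lamE : (lam E <= (2^-1)%:E)%E.
  apply: (@le_trans _ _ (lam (\big[setU/set0]_(p <- al) Q p))).
    by apply: le_measure; rewrite ?inE//; exact: subIsetr.
  apply: (@le_trans _ _ (\sum_(p <- al) lam (Q p))%E).
    elim: (al) => [|p l IHl]; first by rewrite !big_nil measure0.
    rewrite !big_cons; apply: (le_trans (measureU2 _ _ _)) => //.
      by apply: bigsetU_measurable => q _.
    by rewrite leeD2l.
  under eq_bigr do rewrite lamQ.
  rewrite sumEFin lee_fin big_const_seq count_predT iter_addr addr0 wd.
  rewrite -[X in X <= _]mulr_natr invfM -mulrA ler_piMr ?invr_ge0//.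
  by rewrite mulrC ler_pdivrMr// mul1r ler_nat.
have lamD : ((2^-1)%:E <= lam (@unit_cube R d `\` E))%E.
  rewrite measureD//; last by rewrite [ltLHS]lebesgue_unit_cube ltry.
  rewrite setIidr; last exact: subIsetl.
  rewrite [X in (_ <= X - _)%E](_ : _ = 1%E); last exact: lebesgue_unit_cube.
  rewrite leeBrDr; last first.
    by rewrite ge0_fin_numE// (le_lt_trans lamE)// ltry.
  by apply: (le_trans (leeD2l _ lamE)); rewrite -EFinD lee_fin; lra.
have far x : (@unit_cube R d `\` E) x -> rho <= dst x al.
  move=> [xU nEx]; apply: dist_ge; first exact: seq_nonempty.
  move=> p /= pal; rewrite leNgt; apply/negP => xp; apply: nEx; split=> //.
  rewrite -bigcup_seq; exists p => //= t; rewrite !mxE.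
  have := le_lt_trans (aN (x - p) t) _; rewrite !mxE => /(_ (w / 2)).
  move=> /(_ _)/ltW; rewrite ler_distl => h.
  have /h : a * N (x - p) < w / 2.
    by move: xp; rewrite /rho invfM mulrA ltr_pdivlMr// mulrC.
  by move=> /andP[h1 h2]; rewrite h1/=; lra.
have mD : measurable (@unit_cube R d `\` E) by exact: measurableD.
have -> : c = n%:R `^ sg * (rho `^ s * 2^-1).
  rewrite /rho powR_div ?(ltW w0) ?mulr_gt0// /w -powRrM mulNr (mulrC _ s).
  rewrite powRM// ?ler0n// [n%:R `^ (- _)]powRN /c; field.
  by rewrite gt_eqF// powR_gt0.
rewrite EFinM lee_wpmul2l ?lee_fin ?powR_ge0//.
apply: (@le_trans _ _ (\int[lam]_(x in @unit_cube R d `\` E) (cst (rho `^ s)%:E) x)%E).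
  rewrite integral_cst// EFinM lee_wpmul2l// lee_fin powR_ge0//.
apply: (@le_trans _ _ (\int[lam]_(x in @unit_cube R d `\` E) (dst x al `^ s)%:E)%E).
  apply: ge0_le_integral => //.
  - by move=> x _; rewrite lee_fin powR_ge0.
  - by apply/measurable_EFinP; apply: measurable_funTS; exact: measurable_dist_powR.
  - move=> x /far h; rewrite lee_fin ge0_ler_powR ?nnegrE ?(ltW s_gt0) ?(ltW rho0)//.
    exact: dist_ge0.
apply: ge0_subset_integral_fin => //; first exact: measurable_dist_powR.
by move=> x; exact: powR_ge0.
Qed.

End uniform_constant.

End rate.

(** * Quantizing a cube *)

Section cube_quantizers.
Context {R : realType} {d : nat}.
Variable N : 'rV[R]_d -> R.
Hypothesis hN : is_norm N.
Hypothesis d_gt0 : (0 < d)%N.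
Local Notation lam := (lebesgue_rV R d).
Local Notation dst x s := (dist N x [set` s]).
Variables (s : R) (s_gt0 : 0 < s).
Local Notation sg := (s / d%:R).

Let sg_gt0 : 0 < sg. Proof. by rewrite divr_gt0// ltr0n. Qed.

Definition qconst : R := fine (quantization_const N s).

Lemma qconstE : quantization_const N s = qconst%:E.
Proof.
rewrite /qconst fineK// ge0_fin_numE; first exact: quantization_const_lty.
exact: quantization_const_ge0.
Qed.

Lemma qconst_gt0 : 0 < qconst.
Proof. by rewrite -lte_fin -qconstE; exact: quantization_const_gt0. Qed.

Lemma affine_sub (c : 'rV[R]_d) (l : R) x y : affine c l x - affine c l y = l *: (x - y).
Proof. by rewrite /affine opprD addrACA subrr add0r scalerBr. Qed.

Lemma dist_affine (c : 'rV[R]_d) (l : R) y (be : seq 'rV[R]_d) : 0 < l -> be != [::] ->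
  dst (affine c l y) (map (affine c l) be) = l * dst y be.
Proof.
move=> l0 be0; have nb := seq_nonempty be0.
have nb' : [set` map (affine c l) be] !=set0 by apply: seq_nonempty; case: (be) be0.
apply/le_anti/andP; split.
  rewrite -ler_pdivrMl//; apply: dist_ge => // b bb; rewrite ler_pdivrMl//.
  have /(dist_le hN (affine c l y)) : [set` map (affine c l) be] (affine c l b).
    exact: map_f.
  by rewrite affine_sub (normZ hN) (gtr0_norm l0).
apply: dist_ge => // _ /mapP[b bb ->].
by rewrite affine_sub (normZ hN) (gtr0_norm l0) ler_pM2l//; exact: dist_le.
Qed.

Lemma integral_cube_affine (c : 'rV[R]_d) (l : R) (be : seq 'rV[R]_d) : 0 < l -> be != [::] ->
  (\int[lam]_(x in cube c l) (dst x (map (affine c l) be) `^ s)%:E =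
   (l ^+ d * l `^ s)%:E * \int[lam]_(y in @unit_cube R d) (dst y be `^ s)%:E)%E.
Proof.
move=> l0 be0.
have F0 x : 0 <= dst x (map (affine c l) be) `^ s by exact: powR_ge0.
apply: (etrans (integral_cube c l0 (measurable_dist_powR hN _ s) F0)).
rewrite EFinM -muleA; congr (_ * _)%E.
rewrite -ge0_integralZl_fin ?powR_ge0//.
- by apply: eq_integral => y _; rewrite dist_affine// powRM ?(ltW l0)//; exact: dist_ge0.
- exact: measurable_unit_cube.
- exact: measurable_dist_powR.
- by move=> x _; exact: powR_ge0.
Qed.

(** By scaling, as the constant is an infimum over all sizes of quantizers. *)
Lemma cube_distortion_ge (c : 'rV[R]_d) (l : R) n (al : seq 'rV[R]_d) :
  0 < l -> (0 < n)%N -> al != [::] -> (size al <= n)%N ->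
  ((qconst * (l ^+ d * l `^ s) * n%:R `^ (- sg))%:E <=
   \int[lam]_(x in cube c l) (dst x al `^ s)%:E)%E.
Proof.
move=> l0 n0 al0 aln.
pose be := map (fun a => l^-1 *: (a - c)) al.
have alE : al = map (affine c l) be.
  rewrite /be -map_comp -[LHS]map_id; apply: eq_map => a /=.
  by rewrite /affine scalerA mulfV ?gt_eqF// scale1r addrC subrK.
have be0 : be != [::] by rewrite /be; case: (al) al0.
have ben : (size be <= n)%N by rewrite size_map.
rewrite alE integral_cube_affine//.
have := quantization_const_le hN s_gt0 n0 be0 ben; rewrite qconstE => h.
have nsg : 0 < n%:R `^ sg by rewrite powR_gt0// ltr0n.
rewrite (_ : qconst * _ * _ = (l ^+ d * l `^ s) * (n%:R `^ (- sg) * qconst)); last by ring.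
rewrite EFinM; apply: lee_wpmul2l.
  by rewrite lee_fin mulr_ge0 ?powR_ge0 ?exprn_ge0 ?(ltW l0).
by rewrite powRN EFinM lee_pdivrMl.
Qed.

(** Tiling the cube by copies of one good quantizer is asymptotically optimal, because
    the constant is an infimum over all sizes; the additional points of a uniform
    quantizer control the distance at every point of the cube. *)
Lemma cube_quantizer (e : R) : 0 < e -> exists C k0, 0 < C /\
  forall k, (k0 <= k)%N -> exists be : seq 'rV[R]_d,
   [/\ be != [::], (size be <= k)%N,
    (\int[lam]_(x in @unit_cube R d) (dst x be `^ s)%:E <=
       ((qconst + e) * k%:R `^ (- sg))%:E)%E &
    forall x, @unit_cube R d x -> dst x be <= C * k%:R `^ (- d%:R^-1)].
Proof.
move=> e0; have J0 := qconst_gt0.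
have [b b0 Nb] := @norm_bound_cube R d N hN.
have [C0 C00 gam] := pierce_quantizer hN d_gt0 (ltr01 : 0 < (1 : R)).
have [|n1 [a1 [n10 a10 a1n D1]]] := quantization_const_near hN s_gt0 (t := qconst + e / 2).
  by rewrite qconstE lte_fin ltrDl divr_gt0.
pose rho := (qconst + e) / (qconst + e / 2).
have r0 : 0 < qconst + e / 2 by rewrite addr_gt0// divr_gt0.
have rho1 : 1 < rho by rewrite /rho ltr_pdivlMr// mul1r; lra.
have rho0 : 0 < rho by exact: lt_trans rho1.
(* the tiles use a proportion of the points between [th] and [th' < 1], which loses a
   factor [rho] at most; the other points control the distance everywhere *)
pose th := rho `^ (- sg^-1).
have th0 : 0 < th by rewrite powR_gt0.
have thsg : th `^ (- sg) = rho.
  by rewrite /th -powRrM mulrNN mulVf ?gt_eqF// powRr1// ltW.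
have th1 : th < 1.
  rewrite /th powRN invf_lt1 ?powR_gt0//.
  have p1 : 1 = 1 `^ sg^-1 :> R by rewrite powR1.
  by rewrite [ltLHS]p1; apply: gt0_ltr_powR; rewrite ?invr_gt0 ?nnegrE ?(ltW rho0).
pose th' := (th + 1) / 2.
have th'1 : th < th' by rewrite /th'; lra.
have th'2 : 0 < 1 - th' by rewrite /th'; lra.
have [y0 y0P] := pow_nat_between d_gt0 th0 th'1.
have n10' : 0 < n1%:R :> R by rewrite ltr0n.
pose C := C0 * (1 - th') `^ (- d%:R^-1) * (1 + b) `^ 2.
have b10 : 0 < 1 + b by rewrite addr_gt0.
exists C, (Num.truncn (Num.max (y0 * n1%:R) ((2 ^ d)%:R / (1 - th')))).+1.
split; first by rewrite /C !mulr_gt0 ?powR_gt0.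
move=> k kk; have {kk} : Num.max (y0 * n1%:R) ((2 ^ d)%:R / (1 - th')) <= k%:R.
  by apply: ltW; apply: (lt_le_trans (truncnS_gt _)); rewrite ler_nat.
rewrite ge_max => /andP[ky ky'].
have k0 : 0 < k%:R :> R.
  by apply: lt_le_trans ky'; rewrite divr_gt0// ltr0n expn_gt0.
have [|m [m0 /andP[m1 m2]]] := y0P (k%:R / n1%:R); first by rewrite ler_pdivlMr.
have [|g [g0 gs gd]] := gam ((1 - th') * k%:R); first by rewrite mulrC -ler_pdivrMr.
have m0' : 0 < m%:R^-1 :> R by rewrite invr_gt0 ltr0n.
pose cn (f : {ffun 'I_d -> 'I_m}) : 'rV[R]_d := \row_t ((f t)%:R / m%:R).
pose F := enum {ffun 'I_d -> 'I_m}.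
have sF : size F = (m ^ d)%N by rewrite -cardE card_ffun !card_ord.
pose tile f := map (affine (cn f) m%:R^-1) a1.
pose be := flatten [seq tile f | f <- F] ++ g.
have tile_be f : [set` tile f] `<=` [set` be].
  move=> x /= xf; rewrite mem_cat; apply/orP; left; apply/flattenP.
  by exists (tile f) => //; apply: map_f; rewrite mem_enum.
have g_be : [set` g] `<=` [set` be] by move=> x /= xg; rewrite mem_cat xg orbT.
have tile0 f : tile f != [::] by rewrite /tile; case: (a1) a10.
exists be; split.
- by rewrite /be; case: (flatten _) => //=.
- rewrite -(ler_nat R) size_cat natrD size_flatten /shape -map_comp.
  have -> : sumn [seq (size \o [eta tile]) i | i <- F] = (m ^ d * size a1)%N.
    rewrite (eq_map (g := fun=> size a1)); last by move=> f /=; rewrite size_map.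
    by rewrite -sF; elim: (F) => //= f l ->; rewrite mulSn.
  have : (m ^ d * size a1)%:R <= th' * k%:R.
    rewrite natrM natrX; apply: (@le_trans _ _ (m%:R ^+ d * n1%:R)).
      by rewrite ler_wpM2l ?exprn_ge0// ler_nat.
    by rewrite -ler_pdivlMr// -mulrA.
  by move: gs; lra.
- apply: (@le_trans _ _ (\sum_(f <- F) \int[lam]_(x in cube (cn f) m%:R^-1) (dst x be `^ s)%:E)%E).
    apply: ge0_integral_cover.
    + exact: measurable_unit_cube.
    + by move=> f; exact: measurable_cube.
    + exact: measurable_dist_powR.
    + by move=> x; exact: powR_ge0.
    + move=> x xU; have h t : exists i : 'I_m, i%:R / m%:R <= x 0 t <= i%:R / m%:R + m%:R^-1.
        have := xU t; rewrite /= in_itv/= => /andP[x0 x1].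
        have mm : 0 < m%:R :> R by rewrite ltr0n.
        have [xe|xne] := eqVneq (x 0 t) 1.
          have im : (m.-1 < m)%N by rewrite prednK.
          exists (Ordinal im) => /=; rewrite xe ler_pdivrMr// mul1r ler_nat leq_pred/=.
          by rewrite -[X in _ + X]mul1r -mulrDl natr1 prednK// mulfV// gt_eqF.
        have xm0 : 0 <= x 0 t * m%:R by rewrite mulr_ge0.
        have /andP[i1 i2] := truncn_itv xm0.
        have im : (Num.truncn (x 0 t * m%:R)%R < m)%N.
          rewrite -(ltr_nat R); apply: (le_lt_trans i1); rewrite gtr_pMl//.
          by rewrite lt_neqAle xne.
        exists (Ordinal im) => /=; rewrite ler_pdivrMr// i1/=.
        rewrite -[X in _ + X]mul1r -mulrDl natr1 ler_pdivlMr//; exact: ltW.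
      have [f fP] := choice h; exists [ffun t => f t]; first by rewrite mem_enum.
      by move=> t; rewrite !mxE ffunE.
  apply: (@le_trans _ _ (\sum_(f <- F) ((m%:R^-1 ^+ d * m%:R^-1 `^ s)%:E *
      \int[lam]_(y in @unit_cube R d) (dst y a1 `^ s)%:E))%E).
    apply: lee_sum => f _; rewrite -(integral_cube_affine (cn f) m0' a10).
    apply: ge0_le_integral_fin.
    + exact: measurable_cube.
    + exact: measurable_dist_powR.
    + exact: measurable_dist_powR.
    + by move=> x _; exact: powR_ge0.
    + move=> x _; apply: ge0_ler_powR; rewrite ?nnegrE ?(ltW s_gt0)//; try exact: dist_ge0.
      by apply: (dist_mono hN); [exact: seq_nonempty (tile0 f)|exact: tile_be].
  have I0 : (0 <= \int[lam]_(y in @unit_cube R d) (dst y a1 `^ s)%:E)%E.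
    by apply: integral_ge0 => y _; rewrite lee_fin powR_ge0.
  have n1sg : 0 < n1%:R `^ sg by rewrite powR_gt0.
  move: I0 D1; case: (\int[lam]_(y in _) _)%E => [v| |//]; last first.
    by rewrite gt0_muley// ltNge leey.
  rewrite lee_fin -EFinM lte_fin => v0 D1.
  under eq_bigr do rewrite -EFinM.
  rewrite sumEFin lee_fin big_const_seq count_predT iter_addr addr0 sF.
  rewrite -[leLHS]mulr_natr natrX exprVn.
  have md : m%:R ^+ d != 0 :> R by rewrite expf_neq0// pnatr_eq0 -lt0n.
  rewrite (_ : _ * _ * v * _ = m%:R^-1 `^ s * v); last by field.
  have ms : m%:R^-1 `^ s <= rho * k%:R `^ (- sg) * n1%:R `^ sg.
    rewrite -thsg -(powR_inv1 (ltW (_ : 0 < m%:R)))%R ?ltr0n//.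
    rewrite -powRrM mulN1r.
    have -> : m%:R `^ (- s) = (m%:R ^+ d) `^ (- sg) :> R.
      rewrite -powR_mulrn ?ler0n// -powRrM; congr (_ `^ _); field.
      by rewrite pnatr_eq0 -lt0n.
    apply: (le_trans (ler_powRN (ltW sg_gt0) _ m1)).
      by rewrite mulr_gt0// divr_gt0.
    rewrite powRM ?(ltW th0) ?divr_ge0 ?ler0n// powR_div ?ler0n//.
    by rewrite opprK mulrA.
  have vle : v <= (qconst + e / 2) * n1%:R `^ (- sg).
    by rewrite powRN ler_pdivlMr// mulrC ltW.
  apply: (@le_trans _ _ ((rho * k%:R `^ (- sg) * n1%:R `^ sg) *
     ((qconst + e / 2) * n1%:R `^ (- sg)))).
    by apply: ler_pM => //; exact: powR_ge0.
  rewrite [n1%:R `^ (- sg)]powRN /rho le_eqVlt; apply/orP; left; apply/eqP; field.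
  by rewrite (gt_eqF n1sg)/= gt_eqF//; lra.
- move=> x xU; apply: (@le_trans _ _ (dst x g)).
    by apply: (dist_mono hN); [exact: seq_nonempty g0|exact: g_be].
  apply: (le_trans (gd x)).
  rewrite powRM ?(ltW th'2) ?(ltW k0)// /C.
  rewrite [leRHS](_ : _ = C0 * ((1 - th') `^ (- d%:R^-1) * k%:R `^ (- d%:R^-1)) *
    (1 + b) `^ 2); last by ring.
  rewrite ler_wpM2l ?mulr_ge0 ?powR_ge0 ?(ltW C00)//.
  have Nx0 := norm_ge0 hN x.
  have -> : 1 + 1 = 2 :> R by [].
  by apply: ge0_ler_powR; rewrite ?nnegrE ?addr_ge0 ?(ltW b0)// lerD2l Nb.
Qed.

End cube_quantizers.

(** * The localized lower bound *)

Lemma mul_divS_le (R : realType) (A e : R) : 0 <= A -> 0 <= e -> A * (e / (A + 1)) <= e.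
Proof.
move=> A0 e0; rewrite mulrA ler_pdivrMr ?ltr_wpDl//.
by rewrite mulrC mulrDr mulr1 lerDl.
Qed.

Lemma leeDr_le (R : realType) (a b c : R) (x : \bar R) :
  a + c <= b -> (b%:E <= x + c%:E)%E -> (a%:E <= x)%E.
Proof.
case: x => [x| |]//; first by rewrite -EFinD !lee_fin; lra.
by move=> _ _; rewrite leey.
Qed.

Section off_bad_set.
Context d (T : measurableType d) (R : realType) (mu : {measure set T -> \bar R}).
Local Open Scope ereal_scope.

Lemma integral_off_bad (D B : set T) (F G : T -> R) (W eta : R) :
  measurable D -> measurable B -> measurable_fun setT F -> measurable_fun setT G ->
  (forall x, 0 <= F x)%R -> (forall x, 0 <= G x)%R ->
  (forall x, D x -> F x <= W)%R -> (0 <= W)%R ->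
  (forall x, D x -> ~ B x -> F x <= G x)%R -> mu (B `&` D) <= eta%:E ->
  \int[mu]_(x in D) (F x)%:E <= \int[mu]_(x in D) (G x)%:E + (W * eta)%:E.
Proof.
move=> mD mB mF mG F0 G0 FW W0 FG muB.
have mBD : measurable (B `&` D) by exact: measurableI.
have mDB : measurable (D `\` B) by exact: measurableD.
pose C (b : bool) := if b then D `\` B else B `&` D.
have := @ge0_integral_cover _ _ _ mu bool [:: true; false] C D F mD.
rewrite 2!big_cons big_nil adde0 /= => h; apply: le_trans; first apply: h => //.
- by case.
- move=> x Dx; have [Bx|Bx] := pselect (B x); first by exists false.
  by exists true.
apply: leeD.
  apply: (@le_trans _ _ (\int[mu]_(x in D `\` B) (G x)%:E)).
    by apply: ge0_le_integral_fin => // x [Dx nBx]; exact: FG.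
  by apply: ge0_subset_integral_fin => //; exact: subDsetl.
by apply: integral_le_cst => // x [_ Dx]; exact: FW.
Qed.

End off_bad_set.

Section lower_bound.
Import HBNNSimple.
Context {R : realType} {d : nat}.
Variable N : 'rV[R]_d -> R.
Hypothesis hN : is_norm N.
Hypothesis d_gt0 : (0 < d)%N.
Local Notation lam := (lebesgue_rV R d).
Local Notation dst x s := (dist N x [set` s]).
Variables (s : R) (s_gt0 : 0 < s).
Local Notation sg := (s / d%:R).
Local Notation J := (qconst N s).

Let sg_gt0 : 0 < sg. Proof. by rewrite divr_gt0// ltr0n. Qed.

Lemma le_integral_dist (mu : {measure set 'rV[R]_d -> \bar R}) D (A B : set 'rV[R]_d) :
  measurable D -> (forall x, D x -> dist N x A <= dist N x B) ->
  (\int[mu]_(x in D) (dist N x A `^ s)%:E <= \int[mu]_(x in D) (dist N x B `^ s)%:E)%E.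
Proof.
move=> mD AB; apply: ge0_le_integral_fin => //; try exact: measurable_dist_powR.
  by move=> x _; exact: powR_ge0.
move=> x /AB xAB; apply: ge0_ler_powR; rewrite ?nnegrE ?(ltW s_gt0)//;
  exact: dist_ge0.
Qed.

Lemma dist_lt_ex (x : 'rV[R]_d) (al : seq 'rV[R]_d) (t : R) : al != [::] ->
  dst x al < t -> exists2 p, p \in al & N (x - p) < t.
Proof.
move=> al0 xt; apply: contrapT => h; move: xt; apply/negP; rewrite -leNgt.
apply: dist_ge; first exact: seq_nonempty.
by move=> p pal; rewrite leNgt; apply/negP => xp; apply: h; exists p.
Qed.

(** The points outside the cell are at distance at least [del / a0] from [x], and some point
    of [al] is nearer than that. *)
Lemma cell_nearest (a0 del : R) k (j : 'rV[int]_d) (al : seq 'rV[R]_d) (x : 'rV[R]_d) :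
  (forall (y : 'rV[R]_d) t, `|y 0 t| <= a0 * N y) -> 0 < a0 ->
  (forall t, (j 0 t)%:~R * side k + del <= x 0 t <= ((j 0 t)%:~R + 1) * side k - del) ->
  al != [::] -> a0 * dst x al < del ->
  let al' := [seq p <- al | cell k p == j] in
  al' != [::] /\ dst x al' <= dst x al.
Proof.
move=> a0N a00 xj al0 xal al'.
have [p pal xp] : exists2 p, p \in al & N (x - p) < del / a0.
  by apply: dist_lt_ex => //; rewrite ltr_pdivlMr// mulrC.
have pj : cell k p = j.
  apply/cellP => t; have := a0N (x - p) t; rewrite !mxE => h.
  have {}h : `|x 0 t - p 0 t| < del.
    by apply: (le_lt_trans h); rewrite mulrC -ltr_pdivlMr.
  have /andP[x1 x2] := xj t; move: h; rewrite ltr_norml => /andP[h1 h2].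
  by apply/andP; split; lra.
have pal' : p \in al' by rewrite mem_filter pj eqxx.
split; first by apply/eqP => al'0; move: pal'; rewrite al'0.
apply: dist_ge; first exact: seq_nonempty.
move=> y /= yal; have [yj|yj] := eqVneq (cell k y) j.
  by apply: (dist_le hN); rewrite /= mem_filter yj eqxx.
apply: (@le_trans _ _ (del / a0)).
  by apply: (le_trans (dist_le hN x (pal' : [set` al'] p))); exact: ltW.
rewrite leNgt; apply/negP => xy; move/eqP : yj; apply; apply/cellP => t.
have := a0N (x - y) t; rewrite !mxE => h.
have {}h : `|x 0 t - y 0 t| < del.
  by apply: (le_lt_trans h); rewrite mulrC -ltr_pdivlMr.
have /andP[x1 x2] := xj t; move: h; rewrite ltr_norml => /andP[h1 h2].
by apply/andP; split; lra.
Qed.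

(** Young's inequality trades the number of points of the quantizer in a cell against
    the distortion of that cell. *)
Lemma cell_young (a0 del g l : R) k (j : 'rV[int]_d) n (al : seq 'rV[R]_d) :
  (forall (y : 'rV[R]_d) t, `|y 0 t| <= a0 * N y) -> 0 < a0 ->
  0 < del < 1 -> 0 <= g -> 0 <= l -> (0 < n)%N -> al != [::] ->
  (forall x, dyadic k j x -> a0 * dst x al < del / 2 * side k) ->
  ((J * ((1 - del) ^+ d * (1 - del) `^ s) * ((1 + sg) * (g `^ (1 + sg)^-1 * l `^ sg * side k ^+ d)))%:E <=
   (n%:R `^ sg * g)%:E * \int[lam]_(x in dyadic k j) (dst x al `^ s)%:E +
   (J * sg / n%:R * (l `^ (1 + sg) * (count (fun p => cell k p == j) al)%:R))%:E)%E.
Proof.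
move=> a0N a00 /andP[del0 del1] g0 l0 n0 al0 al_fine.
have J0 := qconst_gt0 hN d_gt0 s_gt0.
have sd0 := @side_gt0 R k.
pose al' := [seq p <- al | cell k p == j].
pose c : 'rV[R]_d := corner k j + const_mx (del / 2 * side k).
pose l' := (1 - del) * side k.
have l'0 : 0 < l' by rewrite mulr_gt0// subr_gt0.
have mc : measurable (cube c l') by exact: measurable_cube.
have md : measurable (dyadic k j : set 'rV[R]_d) by exact: dyadic_measurable.
have cube_in x : cube c l' x -> forall t,
    (j 0 t)%:~R * side k + del / 2 * side k <= x 0 t <=
    ((j 0 t)%:~R + 1) * side k - del / 2 * side k.
  move=> xc t; have := xc t; rewrite !mxE => /andP[-> h]; apply: (le_trans h).
  by rewrite le_eqVlt /l'; apply/orP; left; apply/eqP; field.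
have cube_dyadic : cube c l' `<=` dyadic k j.
  move=> x /cube_in h; apply/cellP => t; have /andP[h1 h2] := h t.
  have ds : 0 < del / 2 * side k by rewrite mulr_gt0// divr_gt0.
  by apply/andP; split; lra.
have near x : cube c l' x -> al' != [::] /\ dst x al' <= dst x al.
  move=> xc; apply: (@cell_nearest a0 (del / 2 * side k)) => //; first exact: cube_in.
  by apply: al_fine; exact: cube_dyadic.
have al'0 : al' != [::].
  have cc : cube c l' c by move=> t; rewrite lexx/= lerDl ltW.
  by have [] := near c cc.
pose m := size al'.
have m0 : (0 < m)%N by rewrite lt0n size_eq0.
have mE : count (fun p => cell k p == j) al = m by rewrite /m size_filter.
rewrite mE.
have m0' : 0 < m%:R :> R by rewrite ltr0n.
have n0' : 0 < n%:R :> R by rewrite ltr0n.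
have I_ge : ((J * (l' ^+ d * l' `^ s) * m%:R `^ (- sg))%:E <=
    \int[lam]_(x in dyadic k j) (dst x al `^ s)%:E)%E.
  have h := cube_distortion_ge hN s_gt0 c l'0 m0 al'0 (leqnn _).
  apply: (le_trans h).
  apply: (@le_trans _ _ (\int[lam]_(x in cube c l') (dst x al `^ s)%:E)%E).
    by apply: le_integral_dist => // x xc; have [] := near x xc.
  apply: ge0_subset_integral_fin => //; first exact: measurable_dist_powR.
  by move=> x; exact: powR_ge0.
pose w : R := m%:R / (n%:R * side k ^+ d).
have sdd : 0 < side k ^+ d :> R by rewrite exprn_gt0.
have w0 : 0 < w by rewrite divr_gt0// mulr_gt0.
have Y := young_dual sg_gt0 g0 w0 l0.
have del2 : 0 < 1 - del by rewrite subr_gt0.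
pose q := (1 - del) ^+ d * (1 - del) `^ s.
have q0 : 0 < q by rewrite mulr_gt0 ?powR_gt0 ?exprn_gt0.
have q1 : q <= 1.
  rewrite -[leRHS]mul1r ler_pM ?exprn_ge0 ?powR_ge0 ?(ltW del2)//.
    by rewrite exprn_ile1 ?(ltW del2)// gerBl ltW.
  have p1 : 1 = 1 `^ s :> R by rewrite powR1.
  by rewrite [leRHS]p1 ge0_ler_powR ?nnegrE ?(ltW s_gt0) ?(ltW del2)// gerBl ltW.
have wE : n%:R `^ sg * (l' ^+ d * l' `^ s * m%:R `^ (- sg)) = q * side k ^+ d * w `^ (- sg).
  have nsd : 0 < n%:R * side k ^+ d :> R by rewrite mulr_gt0.
  rewrite (powR_div (- sg) (ltW m0') nsd : w `^ (- sg) = _) opprK.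
  rewrite (powRM _ (ltW n0')) ?(ltW sdd)//.
  have -> : (side k ^+ d : R) `^ sg = side k `^ s.
    rewrite -powR_mulrn ?(ltW sd0)// -powRrM; congr (_ `^ _); field.
    by rewrite pnatr_eq0 -lt0n.
  rewrite /l' (exprMn _ (1 - del)) (powRM _ (ltW del2) (ltW sd0)) /q; ring.
have step1 : J * q * ((1 + sg) * (g `^ (1 + sg)^-1 * l `^ sg * side k ^+ d)) <=
   (n%:R `^ sg * g) * (J * (l' ^+ d * l' `^ s) * m%:R `^ (- sg)) +
   J * sg / n%:R * (l `^ (1 + sg) * m%:R).
  have -> : (n%:R `^ sg * g) * (J * (l' ^+ d * l' `^ s) * m%:R `^ (- sg)) =
      J * g * (n%:R `^ sg * (l' ^+ d * l' `^ s * m%:R `^ (- sg))) by ring.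
  rewrite wE.
  have -> : J * sg / n%:R * (l `^ (1 + sg) * m%:R) =
      J * side k ^+ d * (sg * l `^ (1 + sg) * w).
    rewrite /w; field; rewrite gt_eqF// gt_eqF//=.
    by rewrite pnatr_eq0 -lt0n.
  have Y2 : (1 + sg) * g `^ (1 + sg)^-1 * l `^ sg * q <=
      g * w `^ (- sg) * q + sg * l `^ (1 + sg) * w.
    apply: (@le_trans _ _ ((g * w `^ (- sg) + sg * l `^ (1 + sg) * w) * q)).
      by rewrite ler_wpM2r// ltW.
    by rewrite mulrDl lerD2l ler_piMr// mulr_ge0 ?(ltW w0)// mulr_ge0 ?powR_ge0 ?(ltW sg_gt0).
  have Jsd : 0 <= J * side k ^+ d by rewrite mulr_ge0 ?ltW.
  have := ler_wpM2l Jsd Y2.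
  have -> : J * side k ^+ d * ((1 + sg) * g `^ (1 + sg)^-1 * l `^ sg * q) =
     J * q * ((1 + sg) * (g `^ (1 + sg)^-1 * l `^ sg * side k ^+ d)) by ring.
  move=> h; apply: (le_trans h).
  by rewrite le_eqVlt; apply/orP; left; apply/eqP; ring.
apply: (@le_trans _ _ ((n%:R `^ sg * g)%:E * (J * (l' ^+ d * l' `^ s) * m%:R `^ (- sg))%:E +
   (J * sg / n%:R * (l `^ (1 + sg) * m%:R))%:E)%E).
  by rewrite -EFinM -EFinD lee_fin.
by rewrite leeD2r// lee_wpmul2l// lee_fin mulr_ge0 ?powR_ge0.
Qed.

Lemma sum_count_cells k K (al : seq 'rV[R]_d) (F : 'rV[R]_d -> R) :
  step k F -> (forall x, 0 <= F x) ->
  \sum_(j <- cells k K) F (corner k j) * (count (fun p => cell k p == j) al)%:R <=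
  \sum_(p <- al) F p.
Proof.
move=> Fk F0.
have -> : \sum_(j <- cells k K) F (corner k j) * (count (fun p => cell k p == j) al)%:R =
    \sum_(p <- al) \sum_(j <- cells k K | j == cell k p) F (corner k j).
  rewrite (exchange_big_dep predT)//=; apply: eq_bigr => j _.
  rewrite -sum1_count natr_sum mulr_sumr; apply: eq_big => p; first by rewrite eq_sym.
  by rewrite mulr1.
apply: ler_sum => p _; rewrite -big_filter.
have [pc|pc] := boolP (cell k p \in cells k K).
  have -> : [seq j <- cells k K | j == cell k p] = [:: cell k p].
    by rewrite (filter_pred1_uniq (cells_uniq k K) pc).
  by rewrite big_seq1 (Fk _ p)// cell_corner.
rewrite (_ : [seq j <- cells k K | j == cell k p] = [::]) ?big_nil//.
apply/eqP; rewrite -[_ == _]negbK -has_filter; apply/hasPn => j jc.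
by apply: contraNneq pc => <-.
Qed.

Lemma pierce_rate_eventually (C e1 tau : R) : 0 < C -> 0 < e1 -> 0 < tau ->
  exists n0 : nat, (0 < n0)%N /\ forall n : nat, (n0 <= n)%N ->
    (2 ^ d)%:R <= e1 * n%:R /\ C * (e1 * n%:R) `^ (- d%:R^-1) < tau.
Proof.
move=> C0 e10 tau0; pose y := Num.max (2 ^ d)%:R ((C / tau + 1) ^+ d).
exists (Num.truncn (y / e1)).+1; split=> // n nn.
have : y < e1 * n%:R.
  rewrite mulrC -ltr_pdivrMr//; apply: (lt_le_trans (truncnS_gt _)).
  by rewrite ler_nat.
rewrite gt_max => /andP[y1 y2]; split; first exact: ltW.
have y0 : 0 < e1 * n%:R by apply: lt_trans y1; rewrite ltr0n expn_gt0.
rewrite powRN ltr_pdivrMr ?powR_gt0// mulrC -ltr_pdivrMr//.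
have Ct : 0 <= C / tau by rewrite divr_ge0 ?ltW.
have Ct1 : 0 <= C / tau + 1 by rewrite addr_ge0.
apply: (@lt_le_trans _ _ (C / tau + 1)); first by rewrite ltrDl.
rewrite -[leLHS](powR_pow_inv d_gt0 Ct1).
by apply: ge0_ler_powR; rewrite ?invr_ge0 ?ler0n ?nnegrE ?exprn_ge0 ?(ltW y0) ?(ltW y2).
Qed.

Lemma shrink_factor (rho : R) : 0 <= rho < 1 -> exists del, 0 < del < 1 /\
  rho <= (1 - del) ^+ d * (1 - del) `^ s.
Proof.
move=> /andP[rho0 rho1]; pose r' := Num.max rho 2^-1.
have r'0 : 0 < r' by rewrite lt_max invr_gt0 ltr0n orbT.
have r'1 : r' < 1 by rewrite gt_max rho1/= invf_lt1 ?ltr1n.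
have ds0 : 0 < d%:R + s by rewrite addr_gt0// ltr0n.
pose q := r' `^ (d%:R + s)^-1.
have q0 : 0 < q by rewrite powR_gt0.
have q1 : q < 1.
  have p1 : 1 = 1 `^ (d%:R + s)^-1 :> R by rewrite powR1.
  by rewrite [ltRHS]p1 /q; apply: gt0_ltr_powR; rewrite ?invr_gt0 ?nnegrE ?(ltW r'0).
exists (1 - q); split; first by rewrite subr_gt0 q1/= gtrBl.
rewrite opprB addrCA subrr addr0 -powR_mulrn ?(ltW q0)// -powRD; last first.
  by rewrite (gt_eqF q0) implybT.
rewrite /q -powRrM mulVf ?gt_eqF// powRr1 ?(ltW r'0)//.
by rewrite le_max lexx.
Qed.

(** The counts of points in the cells add up to at most the sum over the quantizer. *)
Lemma cells_young (a0 del : R) (g psi : 'rV[R]_d -> R) k K n (al : seq 'rV[R]_d) :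
  (forall (y : 'rV[R]_d) t, `|y 0 t| <= a0 * N y) -> 0 < a0 ->
  0 < del < 1 -> step k g -> step k psi -> (forall x, 0 <= g x) -> (forall x, 0 <= psi x) ->
  (0 < n)%N -> al != [::] ->
  (forall x, box K x -> a0 * dst x al < del / 2 * side k) ->
  ((J * ((1 - del) ^+ d * (1 - del) `^ s) * (1 + sg))%:E *
     \int[lam]_(x in box K) (psi x `^ sg * g x `^ (1 + sg)^-1)%:E <=
   (n%:R `^ sg)%:E * \int[lam]_(x in box K) (dst x al `^ s * g x)%:E +
   (J * sg / n%:R * \sum_(p <- al) psi p `^ (1 + sg))%:E)%E.
Proof.
move=> a0N a00 del01 kg kpsi g0 psi0 n0 al0 al_fine.
have J0 := qconst_gt0 hN d_gt0 s_gt0.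
have mg := step_measurable kg.
have kF : step k (fun x => psi x `^ sg * g x `^ (1 + sg)^-1).
  exact: (step_comp2 (fun a b => a `^ sg * b `^ (1 + sg)^-1)).
have kG : step k (fun x => psi x `^ (1 + sg)).
  exact: (step_comp2 (fun a _ => a `^ (1 + sg)) kpsi kpsi).
have F0 x : 0 <= psi x `^ sg * g x `^ (1 + sg)^-1 by rewrite mulr_ge0 ?powR_ge0.
have U0 x : 0 <= dst x al `^ s * g x by rewrite mulr_ge0 ?powR_ge0.
have mU : measurable_fun setT (fun x => dst x al `^ s * g x).
  by apply: measurable_funM => //; exact: measurable_dist_powR.
rewrite (integral_step K kF)// (integral_cells lam k K)// -EFinM.
have n0' : 0 < n%:R :> R by rewrite ltr0n.
apply: (@le_trans _ _ ((n%:R `^ sg)%:E * (\sum_(j <- cells k K)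
    \int[lam]_(x in dyadic k j) (dst x al `^ s * g x)%:E) +
    (J * sg / n%:R * (\sum_(j <- cells k K) psi (corner k j) `^ (1 + sg) *
       (count (fun p => cell k p == j) al)%:R))%:E)%E); last first.
  have Jsn : 0 <= J * sg / n%:R.
    by rewrite divr_ge0// mulr_ge0; [|exact: ltW|exact: ltW].
  rewrite leeD2l// lee_fin ler_wpM2l//.
  by apply: (sum_count_cells K al kG) => x; exact: powR_ge0.
rewrite ge0_sume_distrr; last first.
  by move=> j _; apply: integral_ge0 => x _; rewrite lee_fin.
rewrite 2!mulr_sumr -!sumEFin -big_split/= !big_seq; apply: lee_sum => j jc.
have dK : dyadic k j `<=` (box K : set 'rV[R]_d).
  by move=> x xj; apply/(box_cells k); rewrite xj.
have md : measurable (dyadic k j : set 'rV[R]_d) by exact: dyadic_measurable.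
have -> : (\int[lam]_(x in dyadic k j) (dst x al `^ s * g x)%:E =
    (g (corner k j))%:E * \int[lam]_(x in dyadic k j) (dst x al `^ s)%:E)%E.
  rewrite -ge0_integralZl_fin//; last 2 first.
  - exact: measurable_dist_powR.
  - by move=> x _; exact: powR_ge0.
  by apply: eq_integral => x; rewrite inE => xj; rewrite (step_on_dyadic kg xj) mulrC.
rewrite muleA -EFinM; have := @cell_young a0 del (g (corner k j)) (psi (corner k j)) k j n al
  a0N a00 del01 (g0 _) (psi0 _) n0 al0 (fun x xj => al_fine x (dK x xj)).
apply: le_trans; rewrite lee_fin le_eqVlt; apply/orP; left; apply/eqP; ring.
Qed.

(** The source of all the lower bounds below. A small proportion of additional points makes
    any quantizer fine at the scale of the cells, so that [cells_young] applies to it; they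
    cost [e] on the right-hand side, and so does the passage from [f] to a simple function
    and then to a step function. The threshold does not depend on the quantizer. The
    integral may be infinite, hence the real number [c] below it. *)
Lemma weighted_lower_bound (f psi : 'rV[R]_d -> R) K k (Psi c e : R) :
  measurable_fun setT f -> (forall x, 0 <= f x) -> step k psi ->
  (forall x, 0 <= psi x <= Psi) -> 0 <= c ->
  (c%:E < \int[lam]_(x in box K) (psi x `^ sg * f x `^ (1 + sg)^-1)%:E)%E -> 0 < e ->
  exists n0, forall n (al : seq 'rV[R]_d), (n0 <= n)%N -> al != [::] -> (size al <= n)%N ->
  ((J * (1 + sg) * c)%:E <= (n%:R `^ sg)%:E * \int[lam]_(x in box K) (dst x al `^ s * f x)%:E +
     (J * sg / n%:R * (\sum_(p <- al) psi p `^ (1 + sg)) + e)%:E)%E.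
Proof.
move=> mf f0 kpsi psi01 c0 cint e0.
have J0 := qconst_gt0 hN d_gt0 s_gt0.
have sg1 : 0 < 1 + sg by rewrite addr_gt0.
have th0 : 0 < (1 + sg)^-1 by rewrite invr_gt0.
have mB : measurable (box K : set 'rV[R]_d) by exact: box_measurable.
have psi0 x : 0 <= psi x by have /andP[] := psi01 x.
have Psi0 : 0 <= Psi by have /andP[h1 h2] := psi01 0; exact: le_trans h2.
have mpsi : measurable_fun setT psi := step_measurable kpsi.
have mpsis : measurable_fun setT (fun x => psi x `^ sg).
  exact: (measurableT_comp (measurable_powR sg) mpsi).
have [h [hf ch]] := integral_powR_nnsfun mB mpsis mf (fun x => powR_ge0 _ _) f0 th0 cint.
have mh : measurable_fun setT (fun x => h x) by exact: measurable_funP.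
have h0 x : 0 <= h x by [].
have [M [M0 hM]] : exists M : R, 0 < M /\ forall x, h x <= M.
  have [M [_ hM]] := simple_bounded h; exists (`|M| + 1); split; first by rewrite ltr_wpDl.
  move=> x; apply: (le_trans (ler_norm _)); apply: (hM (`|M| + 1)) => //.
  by apply: (le_lt_trans (ler_norm _)); rewrite ltrDl.
have [gam gam0 cg] : exists2 gam : R, 0 < gam &
    ((c + gam)%:E <= \int[lam]_(x in box K) (psi x `^ sg * h x `^ (1 + sg)^-1)%:E)%E.
  move: ch; case: (\int[lam]_(x in _) _)%E => [v| |//]; last first.
    by exists 1; rewrite ?leey.
  by rewrite lte_fin => cv; exists (v - c); rewrite ?subr_gt0// lee_fin; lra.
pose A := J * sg * Psi `^ (1 + sg).
have Jsg0 : 0 <= J * sg by apply: mulr_ge0; exact: ltW.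
have A0 : 0 <= A by apply: mulr_ge0 => //; exact: powR_ge0.
(* the proportion of additional points; their share of the sum is at most [e / 2] *)
pose e1 := e / 2 / (A + 1).
have A10 : 0 < A + 1 by rewrite ltr_wpDl.
have e10 : 0 < e1 by rewrite !divr_gt0.
have [a0 a00 a0N] := coord_le_norm hN; have [b b0 Nb] := norm_le_coord hN.
have [C C0 gamP] := pierce_quantizer hN d_gt0 (ltr01 : 0 < (1 : R)).
pose C' := C * (1 + b * K%:R) `^ (1 + 1).
have bK : 0 < 1 + b * K%:R by rewrite ltr_pwDl// mulr_ge0 ?(ltW b0).
have C'0 : 0 < C' by rewrite mulr_gt0 ?powR_gt0.
(* with the additional points, [Kc] bounds the normalized distortion on the box *)
pose Kc := C' `^ s * e1 `^ (- sg).
have Kc0 : 0 <= Kc by rewrite mulr_ge0 ?powR_ge0.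
pose W := Psi `^ sg * M `^ (1 + sg)^-1.
have W0 : 0 <= W by rewrite mulr_ge0 ?powR_ge0.
have KcM0 : 0 <= Kc * M by rewrite mulr_ge0 ?(ltW M0).
pose eta := Num.min (gam / 2 / (W + 1)) (e / 2 / (Kc * M + 1)).
have W10 : 0 < W + 1 by rewrite ltr_wpDl.
have KM10 : 0 < Kc * M + 1 by rewrite ltr_wpDl.
have eta0 : 0 < eta by rewrite lt_min !divr_gt0.
pose mu : {measure set 'rV[R]_d -> \bar R} := mrestr lam mB.
have mu_fin : (mu setT < +oo)%E by rewrite /= /mrestr setTI; exact: lebesgue_box_fin.
have hM' x : 0 <= h x <= M by rewrite h0 hM.
have [k' [g [Bad [kg mBad gM ghB muB]]]] := step_approx_bounded (step_approx_nnsfun mu_fin h) hM' eta0.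
have g0 x : 0 <= g x by have /andP[] := gM x.
have {}muB : (lam (Bad `&` box K) <= eta%:E)%E by exact: muB.
have ghE x : ~ Bad x -> g x = h x by move=> nB; apply: contrapT => /ghB.
have mg : measurable_fun setT g := step_measurable kg.
pose m := maxn k k'.
have mkg : step m g by apply: step_refine kg; rewrite leq_maxr.
have mkpsi : step m psi by apply: step_refine kpsi; rewrite leq_maxl.
have sm0 := @side_gt0 R m.
(* the step function loses at most half of the gap *)
have G_ge : ((c + gam / 2)%:E <= \int[lam]_(x in box K) (psi x `^ sg * g x `^ (1 + sg)^-1)%:E)%E.
  have mE (u : 'rV[R]_d -> R) : measurable_fun setT u ->
      measurable_fun setT (fun x => psi x `^ sg * u x `^ (1 + sg)^-1).
    move=> mu_; apply: measurable_funM => //.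
    exact: (measurableT_comp (measurable_powR _) mu_).
  have := @integral_off_bad _ _ _ lam (box K) Bad _ _ W eta mB mBad (mE _ mh) (mE _ mg).
  move=> /(_ (fun x => mulr_ge0 (powR_ge0 _ _) (powR_ge0 _ _)) (fun x => mulr_ge0 (powR_ge0 _ _) (powR_ge0 _ _))).
  have hW x : box K x -> psi x `^ sg * h x `^ (1 + sg)^-1 <= W.
    move=> _; rewrite ler_pM ?powR_ge0//; apply: ge0_ler_powR; rewrite ?nnegrE ?(ltW sg_gt0) ?(ltW th0) ?(ltW M0)//.
    by have /andP[] := psi01 x.
  move=> /(_ hW W0) hh.
  have hG x : box K x -> ~ Bad x ->
      psi x `^ sg * h x `^ (1 + sg)^-1 <= psi x `^ sg * g x `^ (1 + sg)^-1.
    by move=> _ nB; rewrite (ghE x nB).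
  have {hh}hh := le_trans cg (hh hG muB).
  have Weta : W * eta <= gam / 2.
    apply: (@le_trans _ _ (W * (gam / 2 / (W + 1)))).
      by rewrite ler_wpM2l// /eta ge_min lexx.
    by rewrite mul_divS_le// divr_ge0// ltW.
  have cgW : c + gam / 2 + W * eta <= c + gam by lra.
  apply: (leeDr_le cgW); exact: hh.
(* shrinking the cells, so that nearest points stay in the cell, loses the other half *)
pose rho := c / (c + gam / 2).
have cg0 : 0 < c + gam / 2 by rewrite ltr_wpDl// divr_gt0.
have [|del [del01 delP]] := @shrink_factor rho.
  by rewrite divr_ge0 ?(ltW cg0)//= ltr_pdivrMr// mul1r ltrDl divr_gt0.
have /andP[del0 del1] := del01.
pose tau := del / 2 * side m / a0.
have tau0 : 0 < tau by rewrite divr_gt0// mulr_gt0// divr_gt0.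
have [n0 [n00 n0P]] := pierce_rate_eventually C'0 e10 tau0.
exists n0 => n al nn al0 aln.
have n_gt0 : (0 < n)%N by exact: leq_trans nn.
have n0' : 0 < n%:R :> R by rewrite ltr0n.
have [nb ntau] := n0P n nn.
have [ga [ga0 gas gad]] := gamP _ nb.
pose al' := al ++ ga.
have al'0 : al' != [::] by rewrite /al'; case: (al) al0.
have al_al' : [set` al] `<=` [set` al'] by move=> x /= xg; rewrite mem_cat xg.
have ga_al' : [set` ga] `<=` [set` al'] by move=> x /= xg; rewrite mem_cat xg orbT.
have d_al' x : dst x al' <= dst x al by apply: (dist_mono hN) => //; exact: seq_nonempty.
have dC x : box K x -> dst x al' <= C' * (e1 * n%:R) `^ (- d%:R^-1).
  move=> xK; apply: (@le_trans _ _ (dst x ga)).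
    by apply: (dist_mono hN) => //; exact: seq_nonempty.
  apply: (le_trans (gad x)); rewrite /C' mulrAC ler_wpM2r ?powR_ge0//.
  rewrite ler_wpM2l ?(ltW C0)//; apply: ge0_ler_powR; rewrite ?nnegrE ?addr_ge0 ?(norm_ge0 hN) ?(ltW bK) ?mulr_ge0 ?(ltW b0)//.
  rewrite lerD2l; apply: Nb => // t; have /andP[h1 h2] := xK t.
  by rewrite ler_norml h1 ltW.
have al'_fine x : box K x -> a0 * dst x al' < del / 2 * side m.
  move=> xK; rewrite mulrC -ltr_pdivlMr//; exact: le_lt_trans (dC x xK) ntau.
have := @cells_young a0 del g psi m K n al' a0N a00 del01 mkg mkpsi g0 psi0 n_gt0 al'0 al'_fine.
move=> CY.
have q0 : 0 <= (1 - del) ^+ d * (1 - del) `^ s.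
  by rewrite mulr_ge0 ?powR_ge0 ?exprn_ge0// subr_ge0 ltW.
have lhs : ((J * (1 + sg) * c)%:E <= (J * ((1 - del) ^+ d * (1 - del) `^ s) * (1 + sg))%:E *
     \int[lam]_(x in box K) (psi x `^ sg * g x `^ (1 + sg)^-1)%:E)%E.
  apply: (@le_trans _ _ ((J * ((1 - del) ^+ d * (1 - del) `^ s) * (1 + sg))%:E * (c + gam / 2)%:E)%E).
    rewrite -EFinM lee_fin.
    have : c <= (1 - del) ^+ d * (1 - del) `^ s * (c + gam / 2).
      by rewrite -ler_pdivrMr.
    have Js : 0 <= J * (1 + sg) by rewrite mulr_ge0 ?ltW.
    move=> /(ler_wpM2l Js) hh; apply: (le_trans hh).
    by rewrite le_eqVlt; apply/orP; left; apply/eqP; ring.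
  by rewrite lee_wpmul2l// lee_fin mulr_ge0 ?(ltW sg1)// mulr_ge0 ?(ltW J0).
have sums : J * sg / n%:R * \sum_(p <- al') psi p `^ (1 + sg) <=
    J * sg / n%:R * \sum_(p <- al) psi p `^ (1 + sg) + e / 2.
  rewrite /al' big_cat/= mulrDr lerD2l.
  have : \sum_(p <- ga) psi p `^ (1 + sg) <= (e1 * n%:R) * Psi `^ (1 + sg).
    apply: (@le_trans _ _ (\sum_(p <- ga) Psi `^ (1 + sg))).
      apply: ler_sum => p _; apply: ge0_ler_powR; rewrite ?nnegrE ?(ltW sg1)//.
      by have /andP[] := psi01 p.
    by rewrite big_const_seq count_predT iter_addr addr0 -[leLHS]mulr_natl ler_wpM2r ?powR_ge0.
  have Js : 0 <= J * sg / n%:R by rewrite divr_ge0.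
  move=> /(ler_wpM2l Js) hh; apply: (le_trans hh).
  have -> : J * sg / n%:R * (e1 * n%:R * Psi `^ (1 + sg)) = e1 * A.
    by rewrite /A; field; rewrite !pnatr_eq0 -!lt0n n_gt0 d_gt0.
  by rewrite mulrC mul_divS_le// divr_ge0// ltW.
have ints : ((n%:R `^ sg)%:E * \int[lam]_(x in box K) (dst x al' `^ s * g x)%:E <=
   (n%:R `^ sg)%:E * \int[lam]_(x in box K) (dst x al `^ s * f x)%:E + (e / 2)%:E)%E.
  have mds (s0 : seq 'rV[R]_d) (u : 'rV[R]_d -> R) : measurable_fun setT u ->
      measurable_fun setT (fun x => dst x s0 `^ s * u x).
    by move=> mu_; apply: measurable_funM => //; exact: measurable_dist_powR.
  have mdn (s0 : seq 'rV[R]_d) (u : 'rV[R]_d -> R) : measurable_fun setT u ->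
      measurable_fun setT (fun x => n%:R `^ sg * (dst x s0 `^ s * u x)).
    by move=> mu_; apply: measurable_funM => //; exact: mds.
  rewrite -!ge0_integralZl_fin ?powR_ge0//; [|exact: mds|by move=> x _; rewrite mulr_ge0 ?powR_ge0|exact: mds|by move=> x _; rewrite mulr_ge0 ?powR_ge0].
  apply: (@le_trans _ _ (\int[lam]_(x in box K) (n%:R `^ sg * (dst x al `^ s * f x))%:E + (Kc * M * eta)%:E)%E).
    apply: (@integral_off_bad _ _ _ lam (box K) Bad) => //; try exact: mdn.
    - by move=> x; rewrite !mulr_ge0 ?powR_ge0.
    - by move=> x; rewrite !mulr_ge0 ?powR_ge0.
    - move=> x xK; rewrite mulrA ler_pM ?mulr_ge0 ?powR_ge0//; last by have /andP[] := gM x.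
      apply: (@le_trans _ _ (n%:R `^ sg * (C' * (e1 * n%:R) `^ (- d%:R^-1)) `^ s)).
        rewrite ler_wpM2l ?powR_ge0//; apply: ge0_ler_powR; rewrite ?nnegrE.
        + exact: ltW.
        + exact: dist_ge0.
        + by apply: mulr_ge0; [exact: ltW|exact: powR_ge0].
        + exact: dC.
      rewrite powRM ?powR_ge0 ?(ltW C'0)// -powRrM mulNr (mulrC _ s) /Kc.
      rewrite (powRM _ (ltW e10) (ltW n0')) (powRN n%:R).
      rewrite le_eqVlt; apply/orP; left; apply/eqP; field.
      by rewrite gt_eqF// powR_gt0.
    - move=> x xK nB; rewrite ler_wpM2l ?powR_ge0// (ghE x nB) ler_pM ?powR_ge0//.
      apply: ge0_ler_powR; rewrite ?nnegrE ?(ltW s_gt0) ?(dist_ge0 hN)//.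
  rewrite leeD2l// lee_fin; apply: (@le_trans _ _ (Kc * M * (e / 2 / (Kc * M + 1)))).
    by rewrite ler_wpM2l// /eta ge_min lexx orbT.
  by rewrite mul_divS_le// divr_ge0// ltW.
apply: (le_trans lhs); apply: (le_trans CY).
have sumsE := sums; rewrite -lee_fin in sumsE.
apply: (le_trans (leeD ints sumsE)).
by rewrite -addeA leeD2l// -EFinD lee_fin addrCA -splitr.
Qed.

End lower_bound.

(** * The upper bound *)

Section moments.
Context {R : realType} {d : nat}.
Variable N : 'rV[R]_d -> R.
Hypothesis hN : is_norm N.
Hypothesis d_gt0 : (0 < d)%N.
Local Notation dst x s := (dist N x [set` s]).
Variable P : probability 'rV[R]_d R.

Lemma measurable_1norm_powR (t : R) : measurable_fun setT (fun x => (1 + N x) `^ t).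
Proof.
apply: (measurableT_comp (measurable_powR t)).
by apply: measurable_funD => //; exact: measurable_norm.
Qed.

Lemma moment_1norm (t : R) : 0 < t -> (\int[P]_x (N x `^ t)%:E < +oo)%E ->
  (\int[P]_x ((1 + N x) `^ t)%:E < +oo)%E.
Proof.
move=> t0 Noo.
have mN : measurable_fun setT (fun x => N x `^ t).
  by apply: (measurableT_comp (measurable_powR t)); exact: measurable_norm.
apply: (@le_lt_trans _ _ (\int[P]_x (2 `^ t * (1 + N x `^ t))%:E)%E).
  apply: ge0_le_integral_fin => //.
  - exact: measurable_1norm_powR.
  - by apply: measurable_funM => //; exact: measurable_funD.
  - by move=> x _; exact: powR_ge0.
  move=> x _; have Nx0 := norm_ge0 hN x.
  have [Nx1|Nx1] := leP (N x) 1.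
    apply: (@le_trans _ _ (2 `^ t)); last by rewrite ler_peMr ?powR_ge0// lerDl powR_ge0.
    by apply: ge0_ler_powR; rewrite ?nnegrE ?(ltW t0) ?addr_ge0//; lra.
  apply: (@le_trans _ _ ((2 * N x) `^ t)).
    by apply: ge0_ler_powR; rewrite ?nnegrE ?(ltW t0) ?addr_ge0 ?mulr_ge0//; lra.
  by rewrite powRM// ler_wpM2l ?powR_ge0// lerDr.
rewrite ge0_integralZl_fin ?powR_ge0//; last 2 first.
- by apply: measurable_funD.
- by move=> x _; rewrite addr_ge0 ?powR_ge0.
rewrite ge0_integralD_fin//; last by move=> x _; exact: powR_ge0.
have -> : (\int[P]_(x in setT) 1%:E = 1)%E.
  by rewrite -[LHS]/(\int[P]_(x in setT) cst 1%:E x)%E (integral_cst P measurableT) mul1e; exact: probability_setT.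
have I0 : (0 <= \int[P]_x (N x `^ t)%:E)%E.
  by apply: integral_ge0 => x _; rewrite lee_fin powR_ge0.
move: Noo I0; case: (\int[P]_x _)%E => [v| |]//= _ _.
by rewrite -EFinD -EFinM ltry.
Qed.

(** This is [pierce_quantizer] for [kap = eta / r], which leads to the power of the norm that
    the moment assumption controls. *)
Lemma pierce_pointwise (r eta : R) : 0 < r -> 0 < eta -> exists2 C : R, 0 < C &
  forall (e1 : R) n, 0 < e1 -> (0 < n)%N -> (2 ^ d)%:R <= e1 * n%:R ->
  exists ga : seq 'rV[R]_d, [/\ ga != [::], (size ga)%:R <= e1 * n%:R &
    forall x, n%:R `^ (r / d%:R) * dst x ga `^ r <=
      C * e1 `^ (- (r / d%:R)) * (1 + N x) `^ (r + eta)].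
Proof.
move=> r0 eta0; have kap0 : 0 < eta / r by rewrite divr_gt0.
have [C C0 CP] := pierce_quantizer hN d_gt0 kap0.
exists (C `^ r); first by rewrite powR_gt0.
move=> e1 n e10 n0 /CP[ga [ga0 gas gad]]; exists ga; split=> // x.
have n0' : 0 < n%:R :> R by rewrite ltr0n.
have Nx0 : 0 <= 1 + N x by rewrite addr_ge0// norm_ge0.
apply: (@le_trans _ _ (n%:R `^ (r / d%:R) *
   (C * (e1 * n%:R) `^ (- d%:R^-1) * (1 + N x) `^ (1 + eta / r)) `^ r)).
  rewrite ler_wpM2l ?powR_ge0//; apply: ge0_ler_powR; rewrite ?nnegrE ?(ltW r0)//.
    exact: dist_ge0.
  by rewrite !mulr_ge0 ?powR_ge0 ?(ltW C0).
rewrite !powRM ?mulr_ge0 ?powR_ge0 ?(ltW C0) ?(ltW e10) ?(ltW n0')// -!powRrM.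
rewrite mulNr (mulrC _^-1 r) powRN [n%:R `^ (- _)]powRN.
have -> : (1 + eta / r) * r = r + eta by field; exact: lt0r_neq0.
rewrite le_eqVlt; apply/orP; left; apply/eqP; field.
by rewrite !gt_eqF ?powR_gt0.
Qed.

End moments.

Section upper_bound.
Context {R : realType} {d : nat}.
Variable N : 'rV[R]_d -> R.
Hypothesis hN : is_norm N.
Hypothesis d_gt0 : (0 < d)%N.
Local Notation lam := (lebesgue_rV R d).
Local Notation dst x s := (dist N x [set` s]).
Variables (r : R) (r_gt0 : 0 < r).
Local Notation q := (r / d%:R).
Local Notation J := (qconst N r).
Variable P : probability 'rV[R]_d R.
Variable f : 'rV[R]_d -> R.
Hypothesis mf : measurable_fun setT f.
Hypothesis f_ge0 : forall x, 0 <= f x.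

Definition density_on (G : set 'rV[R]_d) := forall (X : set 'rV[R]_d) (u : 'rV[R]_d -> R),
  measurable X -> X `<=` G -> measurable_fun setT u -> (forall x, 0 <= u x) ->
  (\int[P]_(x in X) (u x)%:E = \int[lam]_(x in X) (u x * f x)%:E)%E.

Let q_gt0 : 0 < q. Proof. by rewrite divr_gt0// ltr0n. Qed.

Let mdr (al : seq 'rV[R]_d) : measurable_fun setT (fun x => dst x al `^ r).
Proof. exact: measurable_dist_powR. Qed.

Let dr0 (al : seq 'rV[R]_d) x : 0 <= dst x al `^ r. Proof. exact: powR_ge0. Qed.

(** Where [P] has a density bounded by [g], the distortion is that of a scaled quantizer of
    the cube; elsewhere only the uniform bound on the distance is available. *)
Lemma cell_upper (G : set 'rV[R]_d) k j (g e C : R) m (be al : seq 'rV[R]_d) :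
  measurable G ->
  density_on G ->
  (forall x, dyadic k j x -> G x -> f x <= g) ->
  0 <= g -> 0 < e -> 0 < C -> (0 < m)%N ->
  be != [::] ->
  (\int[lam]_(x in @unit_cube R d) (dst x be `^ r)%:E <= ((J + e) * m%:R `^ (- q))%:E)%E ->
  (forall x, @unit_cube R d x -> dst x be <= C * m%:R `^ (- d%:R^-1)) ->
  [set` map (affine (corner k j) (side k)) be] `<=` [set` al] ->
  (\int[P]_(x in dyadic k j) (dst x al `^ r)%:E <=
    (g * (side k ^+ d * side k `^ r * ((J + e) * m%:R `^ (- q))))%:E +
    (C `^ r * side k `^ r * m%:R `^ (- q))%:E * P (dyadic k j `\` G))%E.
Proof.
move=> mG PG fg g0 e0 C0 m0 be0 beI beS be_al.
have J0 := qconst_gt0 hN d_gt0 r_gt0; have l0 := @side_gt0 R k.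
have m0' : 0 < m%:R :> R by rewrite ltr0n.
pose ab := map (affine (corner k j) (side k)) be.
have ab0 : ab != [::] by rewrite /ab; case: (be) be0.
have al_ab x : dst x al <= dst x ab by apply: (dist_mono hN) => //; exact: seq_nonempty.
have md : measurable (dyadic k j : set 'rV[R]_d) by exact: dyadic_measurable.
have mc : measurable (cube (corner k j) (side k) : set 'rV[R]_d) by exact: measurable_cube.
have mdG : measurable (dyadic k j `&` G) by exact: measurableI.
have mdD : measurable (dyadic k j `\` G) by exact: measurableD.
rewrite -[X in (\int[P]_(x in X) _ <= _)%E](setUIDK (dyadic k j) G).
rewrite ge0_integral_setU//; last 3 first.
- by apply/measurable_EFinP; exact: measurable_funTS.
- by move=> x _; rewrite lee_fin.
- by apply/disj_setPS => x [[_ Gx] [_ /(_ Gx)]].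
apply: leeD.
  rewrite (PG _ _ mdG (@subIsetr _ _ _) (mdr al) (dr0 al)).
  apply: (@le_trans _ _ (\int[lam]_(x in dyadic k j `&` G) (g * dst x ab `^ r)%:E)%E).
    apply: ge0_le_integral_fin => //.
    - exact: measurable_funM.
    - exact: measurable_funM.
    - by move=> x _; rewrite mulr_ge0.
    - move=> x [xd xG]; rewrite mulrC ler_pM//; first exact: fg.
      by apply: ge0_ler_powR; rewrite ?nnegrE ?(ltW r_gt0) ?(dist_ge0 hN).
  rewrite ge0_integralZl_fin// EFinM lee_wpmul2l ?lee_fin//.
  apply: (@le_trans _ _ (\int[lam]_(x in cube (corner k j) (side k)) (dst x ab `^ r)%:E)%E).
    apply: ge0_subset_integral_fin => //.
    by apply: (subset_trans (@subIsetl _ _ _)); exact: dyadic_sub_cube.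
  rewrite (integral_cube_affine hN r (corner k j) l0 be0) [in leRHS]EFinM.
  by apply: lee_wpmul2l => //; rewrite lee_fin mulr_ge0 ?powR_ge0 ?exprn_ge0 ?(ltW l0).
have PD : P (dyadic k j `\` G) \is a fin_num by exact: fin_num_measure.
rewrite -(fineK PD) -EFinM; apply: integral_le_cst => //.
- move=> x [xd _].
  pose y := (side k)^-1 *: (x - corner k j).
  have xy : x = affine (corner k j) (side k) y.
    by rewrite /affine /y scalerA mulfV ?gt_eqF// scale1r addrC subrK.
  have yU : @unit_cube R d y.
    rewrite -(affine_cube (corner k j) l0) /preimage/= -xy; exact: dyadic_sub_cube.
  have dx : dst x ab <= side k * (C * m%:R `^ (- d%:R^-1)).
    by rewrite xy (dist_affine hN)// ler_wpM2l ?(ltW l0)//; exact: beS.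
  apply: (@le_trans _ _ ((side k * (C * m%:R `^ (- d%:R^-1))) `^ r)).
    apply: ge0_ler_powR; rewrite ?nnegrE ?(ltW r_gt0) ?(dist_ge0 hN)//.
      by rewrite !mulr_ge0 ?powR_ge0 ?(ltW l0) ?(ltW C0).
    exact: le_trans (al_ab x) dx.
  rewrite !powRM ?mulr_ge0 ?powR_ge0 ?(ltW l0) ?(ltW C0)// -powRrM mulNr (mulrC _ r).
  by rewrite le_eqVlt; apply/orP; left; apply/eqP; ring.
- by rewrite !mulr_ge0 ?powR_ge0.
- by rewrite fineK.
Qed.

(** Every cell receives a number of points proportional to its weight [w], arranged as a
    good quantizer of a cube; a proportion [e] of the points is kept for a quantizer of
    the whole space, which controls the distortion outside the box. *)
Lemma weighted_upper (eta e wmin : R) (G : set 'rV[R]_d) K k (g w : 'rV[R]_d -> R) :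
  0 < eta -> 0 < e < 1 -> 0 < wmin -> measurable G ->
  density_on G ->
  (forall x, G x -> f x <= g x) ->
  step k g -> step k w -> (forall x, 0 <= g x) -> (forall x, wmin <= w x) ->
  (\int[lam]_(x in box K) (w x)%:E <= 1)%E ->
  forall C1 C : R, 0 < C1 -> 0 < C ->
  (forall (e1 : R) n, 0 < e1 -> (0 < n)%N -> (2 ^ d)%:R <= e1 * n%:R ->
    exists ga : seq 'rV[R]_d, [/\ ga != [::], (size ga)%:R <= e1 * n%:R &
    forall x, n%:R `^ (r / d%:R) * dst x ga `^ r <=
      C1 * e1 `^ (- (r / d%:R)) * (1 + N x) `^ (r + eta)]) ->
  (exists k0, forall k, (k0 <= k)%N -> exists be : seq 'rV[R]_d,
   [/\ be != [::], (size be <= k)%N,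
    (\int[lam]_(x in @unit_cube R d) (dst x be `^ r)%:E <=
       ((J + e) * k%:R `^ (- q))%:E)%E &
    forall x, @unit_cube R d x -> dst x be <= C * k%:R `^ (- d%:R^-1)]) ->
  exists n0, forall n, (n0 <= n)%N -> exists al : seq 'rV[R]_d,
   [/\ al != [::], (size al <= n)%N,
    ((n%:R `^ q)%:E * \int[P]_(x in box K) (dst x al `^ r)%:E <=
     ((1 - e) `^ (- (2 * q)))%:E *
       ((J + e)%:E * \int[lam]_(x in box K) (g x * w x `^ (- q))%:E +
        (C `^ r)%:E * \int[P]_(x in box K) (w x `^ (- q) * \1_(~` G) x)%:E))%E &
    forall x, n%:R `^ q * dst x al `^ r <= C1 * e `^ (- q) * (1 + N x) `^ (r + eta)].
Proof.
move=> eta0 /andP[e0 e1] wmin0 mG PG fg kg kw g0 wmn wI C1 C C10 C0 gaP [k0 beP].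
have J0 := qconst_gt0 hN d_gt0 r_gt0; have l0 := @side_gt0 R k.
have w0 x : 0 < w x by exact: lt_le_trans (wmn x).
have ld0 : 0 < side k ^+ d :> R by rewrite exprn_gt0.
have e1' : 0 < 1 - e by rewrite subr_gt0.
have /choice[be {}beP] : forall i, exists b : seq 'rV[R]_d, (k0 <= i)%N ->
   [/\ b != [::], (size b <= i)%N,
    (\int[lam]_(x in @unit_cube R d) (dst x b `^ r)%:E <=
       ((J + e) * i%:R `^ (- q))%:E)%E &
    forall x, @unit_cube R d x -> dst x b <= C * i%:R `^ (- d%:R^-1)].
  move=> i; have [ki|ki] := leqP k0 i; last by exists [::].
  by have [b bP] := beP i ki; exists b.
(* with [y0] points per cell, rounding loses a proportion [e] at most and the cube
   quantizers are available *)
pose y0 := Num.max e^-1 (k0.+1)%:R.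
pose n0 := (Num.truncn (Num.max ((2 ^ d)%:R / e) (y0 / ((1 - e) * (wmin * side k ^+ d))))).+1.
exists n0 => n nn.
have n_gt0 : (0 < n)%N by exact: leq_trans nn.
have n0' : 0 < n%:R :> R by rewrite ltr0n.
have {nn} : Num.max ((2 ^ d)%:R / e) (y0 / ((1 - e) * (wmin * side k ^+ d))) <= n%:R.
  by apply: ltW; apply: (lt_le_trans (truncnS_gt _)); rewrite ler_nat.
rewrite ge_max ler_pdivrMr// ler_pdivrMr ?mulr_gt0// => /andP[nd ny].
have {}nd : (2 ^ d)%:R <= e * n%:R by rewrite mulrC.
have [ga [ga0 gas gad]] := gaP e n e0 n_gt0 nd.
pose y j := (1 - e) * (n%:R * (w (corner k j) * side k ^+ d)).
pose m j := Num.truncn (y j).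
have yge j : y0 <= y j.
  apply: (le_trans ny); rewrite /y mulrCA ler_wpM2l ?(ltW e1')// ler_wpM2l ?(ltW n0')//.
  by rewrite ler_wpM2r ?(ltW ld0).
have y_gt0 j : 0 < y j by apply: lt_le_trans (yge j); rewrite lt_max invr_gt0 e0.
have mle j : (m j)%:R <= y j by have /andP[] := truncn_itv (ltW (y_gt0 j)).
have mge j : (1 - e) * y j <= (m j)%:R.
  have /andP[_] := truncn_itv (ltW (y_gt0 j)); rewrite -/(m j) => h.
  have mS : (m j).+1%:R = (m j)%:R + 1 :> R by rewrite -natr1.
  have : e^-1 <= y j by apply: le_trans (yge j); rewrite /y0 le_max lexx.
  rewrite -(ler_pM2l e0) mulfV ?gt_eqF// => h2.
  by move: h; rewrite mS mulrBl mul1r; lra.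
have mk0 j : (k0 <= m j)%N.
  rewrite /m -ltnS -(ltr_nat R); apply: le_lt_trans (truncnS_gt _).
  by apply: le_trans (yge j); rewrite /y0 le_max ler_nat leqnSn orbT.
have m_gt0 j : (0 < m j)%N.
  rewrite -(ltr_nat R); apply: lt_le_trans (mge j).
  by rewrite mulr_gt0.
pose bj j := map (affine (corner k j) (side k)) (be (m j)).
pose al := flatten [seq bj j | j <- cells k K] ++ ga.
have ga_al : [set` ga] `<=` [set` al] by move=> x /= xg; rewrite mem_cat xg orbT.
have bj_al j : j \in cells k K -> [set` bj j] `<=` [set` al].
  move=> jc x /= xj; rewrite mem_cat; apply/orP; left; apply/flattenP.
  by exists (bj j) => //; apply: map_f.
have al0 : al != [::] by rewrite /al; case: (flatten _) => //=.
exists al; split=> //.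
- rewrite -(ler_nat R) size_cat natrD size_flatten /shape -map_comp.
  have : (sumn [seq (size \o bj) j | j <- cells k K])%:R <= (1 - e) * n%:R.
    apply: (@le_trans _ _ (\sum_(j <- cells k K) (y j))).
      rewrite sumnE big_map natr_sum; apply: ler_sum => j _.
      apply: le_trans (mle j); rewrite ler_nat /= size_map.
      by have [] := beP (m j) (mk0 j).
    rewrite /y -mulr_sumr ler_wpM2l ?(ltW e1')// -mulr_sumr ler_piMr ?(ltW n0')//.
    by rewrite -lee_fin -integral_step// => x; exact: ltW.
  by move: gas; lra.
- rewrite (integral_cells P k K (mdr al) (dr0 al)).
  have mw : measurable_fun setT (fun x => w x `^ (- q)).
    by apply: (measurableT_comp (measurable_powR _)); exact: step_measurable kw.
  have mwG : measurable_fun setT (fun x => w x `^ (- q) * \1_(~` G) x).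
    apply: measurable_funM => //; apply: measurable_indic; exact: measurableC.
  have wG0 x : 0 <= w x `^ (- q) * \1_(~` G) x by rewrite mulr_ge0 ?powR_ge0.
  have kgw : step k (fun x => g x * w x `^ (- q)).
    exact: (step_comp2 (fun a b => a * b `^ (- q))).
  rewrite (integral_cells P k K mwG wG0) (integral_step K kgw); last first.
    by move=> x; rewrite mulr_ge0 ?powR_ge0.
  rewrite -EFinM mulr_sumr -sumEFin ge0_sume_distrr; last first.
    by move=> j _; apply: integral_ge0 => x _; rewrite lee_fin.
  rewrite ge0_sume_distrr; last by move=> j _; apply: integral_ge0 => x _; rewrite lee_fin.
  rewrite -big_split/= ge0_sume_distrr; last first.
    move=> j _; rewrite adde_ge0//.
      by rewrite lee_fin !mulr_ge0 ?powR_ge0 ?exprn_ge0 ?addr_ge0 ?(ltW J0) ?(ltW e0) ?(ltW l0).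
    rewrite mule_ge0 ?lee_fin ?powR_ge0//.
    by apply: integral_ge0 => x _; rewrite lee_fin.
  rewrite !big_seq; apply: lee_sum => j jc.
  have [b0 bs bI bS] := beP (m j) (mk0 j).
  have md : measurable (dyadic k j : set 'rV[R]_d) by exact: dyadic_measurable.
  have fgj x : dyadic k j x -> G x -> f x <= g (corner k j).
    by move=> xj /fg; rewrite (step_on_dyadic kg xj).
  have PDE : (\int[P]_(x in dyadic k j) (w x `^ (- q) * \1_(~` G) x)%:E =
     (w (corner k j) `^ (- q))%:E * P (dyadic k j `\` G))%E.
    rewrite (eq_integral (fun x => ((w (corner k j)) `^ (- q) * \1_(~` G) x)%:E)); last first.
      by move=> x; rewrite inE => xj; rewrite (step_on_dyadic kw xj).
    rewrite ge0_integralZl_fin ?powR_ge0//; last by apply: measurable_indic; exact: measurableC.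
    by rewrite integral_indic ?setDE 1?setIC//; exact: measurableC.
  rewrite PDE.
  have PD : P (dyadic k j `\` G) \is a fin_num.
    by apply: fin_num_measure; exact: measurableD.
  have := cell_upper mG PG fgj (g0 _) e0 C0 (m_gt0 j) b0 bI bS (bj_al j jc).
  rewrite -(fineK PD); set pj := fine _.
  have pj0 : 0 <= pj by exact: fine_ge0.
  rewrite -!EFinM -!EFinD => /(lee_wpmul2l (_ : (0 <= (n%:R `^ q)%:E)%E)).
  move=> /(_ _)/le_trans; apply; first by rewrite lee_fin powR_ge0.
  rewrite -EFinM lee_fin.
  have key : n%:R `^ q * (m j)%:R `^ (- q) * side k `^ r <=
      (1 - e) `^ (- (2 * q)) * w (corner k j) `^ (- q).
    have wj0 := w0 (corner k j).
    have z0 : 0 < (1 - e) * y j by rewrite mulr_gt0.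
    have := ler_powRN (ltW q_gt0) z0 (mge j).
    have -> : ((1 - e) * y j) `^ (- q) =
        (1 - e) `^ (- (2 * q)) * (n%:R `^ (- q) * (w (corner k j) `^ (- q) * side k `^ (- r))).
      rewrite /y mulrA (powRM _ _ (ltW (mulr_gt0 n0' (mulr_gt0 wj0 ld0)))) ?mulr_ge0 ?(ltW e1')//.
      rewrite (powRM _ (ltW n0') (ltW (mulr_gt0 wj0 ld0))) (powRM _ (ltW wj0) (ltW ld0)).
      congr (_ * (_ * (_ * _))).
        by rewrite -expr2 -powR_mulrn ?(ltW e1')// -powRrM mulrN.
      rewrite -powR_mulrn ?(ltW l0)// -powRrM; congr (_ `^ _); field.
      by rewrite pnatr_eq0 -lt0n.
    have A : 0 <= n%:R `^ q * side k `^ r by rewrite mulr_ge0 ?powR_ge0.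
    move=> /(ler_wpM2l A) h; rewrite mulrAC; apply: (le_trans h).
    rewrite [n%:R `^ (- q)]powRN [side k `^ (- r)]powRN.
    rewrite le_eqVlt; apply/orP; left; apply/eqP; field.
    by rewrite !gt_eqF ?powR_gt0.
  rewrite mulrDr mulrDr; apply: lerD.
    have A : 0 <= g (corner k j) * side k ^+ d * (J + e).
      by rewrite !mulr_ge0 ?addr_ge0 ?exprn_ge0 ?(ltW J0) ?(ltW e0) ?(ltW l0).
    have := ler_wpM2l A key; move=> h; apply: (le_trans (le_trans _ h));
      rewrite le_eqVlt; apply/orP; left; apply/eqP; ring.
  have A : 0 <= C `^ r * pj by rewrite mulr_ge0 ?powR_ge0.
  have := ler_wpM2l A key; move=> h; apply: (le_trans (le_trans _ h));
    rewrite le_eqVlt; apply/orP; left; apply/eqP; ring.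
- move=> x; apply: le_trans (gad x); rewrite ler_wpM2l ?powR_ge0//.
  apply: ge0_ler_powR; rewrite ?nnegrE ?(ltW r_gt0) ?(dist_ge0 hN)//.
  by apply: (dist_mono hN) => //; exact: seq_nonempty.
Qed.

End upper_bound.

(** * Integrability of the power of the density *)

Section staircase_function.
Context {R : realType}.

(** The sum is [f] rounded up to a multiple of [e] and truncated at [m%:R * e]. As a sum of
    indicators it depends on finitely many level sets of [f] only. *)
Lemma staircase (e f : R) m : 0 < e -> 0 <= f ->
  let u := \sum_(0 <= i < m) e * (i%:R * e <= f)%R%:R in
  (f < m%:R * e /\ f <= u <= f + e) \/ (m%:R * e <= f /\ u = m%:R * e).
Proof.
move=> e0 f0; elim: m => [|m IHm] /=.
  by right; rewrite big_geq// mul0r.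
have mS : m.+1%:R = m%:R + 1 :> R by rewrite -natr1.
rewrite big_nat_recr//= mS mulrDl mul1r.
case: IHm => -[h1 h2].
  left; rewrite (leNgt _ f) h1/= mulr0 addr0; split=> //.
  by rewrite (lt_trans h1)// ltrDl.
rewrite h2 h1/= mulr1.
have [h|h] := leP (m%:R * e + e) f; first by right.
by left; split=> //; rewrite (ltW h)/= lerD2r.
Qed.

End staircase_function.

Section zador.
Context {R : realType} {d : nat}.
Variable N : 'rV[R]_d -> R.
Hypothesis hN : is_norm N.
Hypothesis d_gt0 : (0 < d)%N.
Local Notation lam := (lebesgue_rV R d).
Local Notation dst x s := (dist N x [set` s]).
Variables (r eta : R) (r_gt0 : 0 < r) (eta_gt0 : 0 < eta).
Local Notation q := (r / d%:R).
Local Notation p := (1 + r / d%:R)^-1.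
Local Notation J := (qconst N r).
Variable P : probability 'rV[R]_d R.
Variable f : 'rV[R]_d -> R.
Hypothesis mf : measurable_fun setT f.
Hypothesis f_ge0 : forall x, 0 <= f x.
Variable A : set 'rV[R]_d.
Hypothesis mA : measurable A.
Hypothesis lamA : (lam A = 0)%E.
Hypothesis PA : density_on P f (~` A).
Hypothesis mom : (\int[P]_x (N x `^ (r + eta))%:E < +oo)%E.

Let q_gt0 : 0 < q. Proof. by rewrite divr_gt0// ltr0n. Qed.
Let q1_gt0 : 0 < 1 + q. Proof. by rewrite addr_gt0. Qed.
Let p_gt0 : 0 < p. Proof. by rewrite invr_gt0. Qed.
Let p_le1 : p <= 1. Proof. by rewrite invf_le1// lerDl ltW. Qed.

(** The null set [A] carries the singular part. *)
Lemma ac_integral_eq (X : set 'rV[R]_d) (u : 'rV[R]_d -> R) :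
  measurable X -> measurable_fun setT u -> (forall x, 0 <= u x) ->
  (\int[lam]_(x in X) (u x * f x)%:E = \int[P]_(x in X `\` A) (u x)%:E)%E.
Proof.
move=> mX mu u0; have mXA : measurable (X `\` A) by exact: measurableD.
rewrite (PA mXA (@subIsetr _ _ _) mu u0).
have muf : measurable_fun setT (fun x => u x * f x) by exact: measurable_funM.
have uf0 x : 0 <= u x * f x by rewrite mulr_ge0.
apply/eqP; rewrite eq_le; apply/andP; split; last first.
  by apply: ge0_subset_integral_fin => //; exact: subDsetl.
apply: (@le_trans _ _ (\int[lam]_(x in (X `\` A) `|` A) (u x * f x)%:E)%E).
  apply: ge0_subset_integral_fin => //; first exact: measurableU.
  by move=> x Xx; have [xA|nA] := pselect (A x); [right|left].
rewrite ge0_integral_setU//; last 3 first.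
- by apply/measurable_EFinP; exact: measurable_funTS.
- by move=> x _; rewrite lee_fin.
- by apply/disj_setPS => x [[_ nA] /nA].
rewrite [X in (_ + X)%E](_ : _ = 0%E) ?adde0//.
apply: null_set_integral => //.
by apply/measurable_EFinP; exact: measurable_funTS.
Qed.

Lemma ac_integral_le (X : set 'rV[R]_d) (u : 'rV[R]_d -> R) :
  measurable X -> measurable_fun setT u -> (forall x, 0 <= u x) ->
  (\int[lam]_(x in X) (u x * f x)%:E <= \int[P]_(x in X) (u x)%:E)%E.
Proof.
move=> mX mu u0; rewrite ac_integral_eq//.
by apply: ge0_subset_integral_fin => //; exact: measurableD.
Qed.

(** The lower bound for the trivial weight, against quantizers whose distortion has the
    optimal rate, bounds the integral of [f `^ p]. *)
Lemma integral_powR_density_lty : (\int[lam]_x (f x `^ p)%:E < +oo)%E.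
Proof.
have J0 := qconst_gt0 hN d_gt0 r_gt0.
have [C1 C10 gaP] := pierce_pointwise hN d_gt0 r_gt0 eta_gt0.
have m1 := @measurable_1norm_powR _ _ _ hN (r + eta).
have mfp : measurable_fun setT (fun x => f x `^ p).
  exact: (measurableT_comp (measurable_powR _) mf).
pose M := fine (\int[P]_x ((1 + N x) `^ (r + eta))%:E)%E.
have I0 : (0 <= \int[P]_x ((1 + N x) `^ (r + eta))%:E)%E.
  by apply: integral_ge0 => x _; rewrite lee_fin powR_ge0.
have ME : (\int[P]_x ((1 + N x) `^ (r + eta))%:E = M%:E)%E.
  rewrite /M fineK// ge0_fin_numE; last exact: I0.
  have Moo := moment_1norm hN (addr_gt0 r_gt0 eta_gt0) mom.
  exact: Moo.
have M0 : 0 <= M by rewrite -lee_fin -ME.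
pose Bd := (C1 * M + J * q + 1) / (J * (1 + q)).
have Bd0 : 0 <= Bd.
  apply: divr_ge0; last by apply: mulr_ge0; exact: ltW.
  by rewrite !addr_ge0// mulr_ge0// ?(ltW J0) ?(ltW C10)// ltW.
have box_le K : (\int[lam]_(x in box K) (f x `^ p)%:E <= (Bd + 1)%:E)%E.
  rewrite leNgt; apply/negP => lt.
  have kI : step 0 (\1_(box K) : 'rV[R]_d -> R) := @step_box_indic _ _ _ _.
  have I01 (x : 'rV[R]_d) : 0 <= (\1_(box K) x : R) <= 1 := indic01 _ _.
  have Bd10 : 0 <= Bd + 1 by rewrite addr_ge0.
  have lt' : ((Bd + 1)%:E <
      \int[lam]_(x in box K) (\1_(box K) x `^ q * f x `^ (1 + q)^-1)%:E)%E.
    rewrite (eq_integral (fun x => (f x `^ p)%:E))// => x xK.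
    by rewrite indicE xK/= powR1 mul1r.
  have [n0 lb] := weighted_lower_bound hN d_gt0 r_gt0 mf f_ge0 kI I01 Bd10 lt' ltr01.
  pose n := maxn n0 (2 ^ d).
  have n_gt0 : (0 < n)%N by rewrite leq_max expn_gt0 orbT.
  have nd : (2 ^ d)%:R <= 1 * n%:R :> R by rewrite mul1r ler_nat leq_maxr.
  have [ga [ga0]] := gaP 1 n ltr01 n_gt0 nd.
  rewrite mul1r ler_nat => gan gad.
  have := lb n ga (leq_maxl _ _) ga0 gan.
  apply/negP; rewrite -ltNge.
  have mB : measurable (box K : set 'rV[R]_d) by exact: box_measurable.
  have h1 : ((n%:R `^ q)%:E * \int[lam]_(x in box K) (dst x ga `^ r * f x)%:E <=
      (C1 * M)%:E)%E.
    apply: (@le_trans _ _ ((n%:R `^ q)%:E * \int[P]_(x in box K) (dst x ga `^ r)%:E)%E).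
      apply: lee_wpmul2l; first by rewrite lee_fin powR_ge0.
      apply: (ac_integral_le mB); first exact: measurable_dist_powR.
      by move=> x; exact: powR_ge0.
    rewrite -ge0_integralZl_fin ?powR_ge0//; last 2 first.
    - exact: measurable_dist_powR.
    - by move=> x _; exact: powR_ge0.
    have C1M := ge0_integralZl_fin P measurableT m1 (fun x _ => powR_ge0 _ _) (ltW C10).
    rewrite EFinM -ME -C1M.
    apply: (@le_trans _ _ (\int[P]_(x in box K) (C1 * (1 + N x) `^ (r + eta))%:E)%E).
      apply: ge0_le_integral_fin => //.
      - by apply: measurable_funM => //; exact: measurable_dist_powR.
      - exact: measurable_funM.
      - by move=> x _; rewrite mulr_ge0 ?powR_ge0.
      - by move=> x _; have := gad x; rewrite powR1 mulr1.
    apply: ge0_subset_integral_fin => //; first exact: measurable_funM.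
    by move=> x; rewrite mulr_ge0 ?powR_ge0 ?(ltW C10).
  have h2 : J * q / n%:R * (\sum_(a <- ga) \1_(box K) a `^ (1 + q)) <= J * q.
    have Jq : 0 <= J * q by apply: mulr_ge0; exact: ltW.
    have n0' : 0 < n%:R :> R by rewrite ltr0n.
    rewrite -mulrA -[leRHS]mulr1 ler_wpM2l//.
    rewrite mulrC ler_pdivrMr// mul1r.
    apply: (@le_trans _ _ (\sum_(a <- ga) 1)).
      apply: ler_sum => a _; have /andP[a0 a1] := I01 a.
      have p1 : 1 = 1 `^ (1 + q) :> R by rewrite powR1.
      by rewrite [leRHS]p1; apply: ge0_ler_powR; rewrite ?nnegrE ?(ltW q1_gt0).
    by rewrite big_const_seq count_predT iter_addr_0 ler_nat.
  apply: (@le_lt_trans _ _ ((C1 * M)%:E + (J * q + 1)%:E)%E).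
    by apply: leeD => //; rewrite lee_fin lerD2r.
  rewrite -EFinD lte_fin.
  have JQ : 0 < J * (1 + q) by rewrite mulr_gt0.
  have BdE : J * (1 + q) * Bd = C1 * M + J * q + 1 by rewrite /Bd mulrC divfK// gt_eqF.
  by rewrite mulrDr mulr1 BdE addrA ltrDl.
apply: (@le_lt_trans _ _ (Bd + 1)%:E); last exact: ltry.
rewrite leNgt; apply/negP => lt.
have [k0 kP] := integral_exhaust box_measurable (@box_nd R d) (@box_cover R d) mfp (fun x => powR_ge0 _ _) lt.
by have := kP k0 (leqnn _); rewrite ltNge box_le.
Qed.

Local Notation S := (fine (\int[lam]_x (f x `^ p)%:E)).

Let mfp : measurable_fun setT (fun x => f x `^ p).
Proof. exact: (measurableT_comp (measurable_powR _) mf). Qed.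

Let SE : (\int[lam]_x (f x `^ p)%:E = S%:E)%E.
Proof.
rewrite fineK// ge0_fin_numE ?integral_powR_density_lty//.
by apply: integral_ge0 => x _; rewrite lee_fin powR_ge0.
Qed.

Let S_ge0 : 0 <= S.
Proof. by apply: fine_ge0; apply: integral_ge0 => x _; rewrite lee_fin powR_ge0. Qed.

(** Markov's inequality, as [f] has integral at most [1]. *)
Lemma lebesgue_density_ge (M : R) : 0 < M ->
  (lam [set x | (M <= f x)%R] <= (M^-1)%:E)%E.
Proof.
move=> M0; set E := [set x | _].
have mE : measurable E.
  rewrite -[E]setTI (_ : E = f @^-1` `[M, +oo[%classic); last first.
    by apply/seteqP; split=> x; rewrite /E /= in_itv/= andbT.
  exact: mf.
have h1 : (M%:E * lam E <= 1)%E.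
  apply: (@le_trans _ _ (\int[lam]_(x in E) (1 * f x)%:E)%E).
    rewrite -(integral_cst lam mE); apply: ge0_le_integral_fin => //.
    - exact: measurable_funM.
    - by move=> x _; exact: ltW.
    - by move=> x; rewrite mul1r.
  apply: (le_trans (ac_integral_le mE _ _)) => //.
  by rewrite (integral_cst P mE) mul1e; exact: probability_le1.
by rewrite -[leRHS]mul1e (muleC 1%E) lee_pdivlMl ?invr_gt0// invrK.
Qed.

(** The optimal weight is proportional to [f `^ p], here [g `^ p] for a step function [g]
    that exceeds [f] on [G]. The complement of [G] contains the singular part and the set
    where [f] is large; it has small Lebesgue measure but its mass need not be small.
    Up to a set of small mass, it is covered by the step function [D], where the weight is
    at least of order [T]: this uses few points and makes the distortion there small. *)
Lemma good_weights K (T tau : R) : 0 < T -> 0 < tau ->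
  exists (k : nat) (g w : 'rV[R]_d -> R) (G : set 'rV[R]_d) (wmin : R),
  [/\ [/\ 0 < wmin, measurable G, density_on P f G & forall x, G x -> f x <= g x],
     [/\ step k g, step k w, forall x, 0 <= g x & forall x, wmin <= w x],
     (\int[lam]_(x in box K) (w x)%:E <= 1)%E,
     (\int[lam]_(x in box K) (g x * w x `^ (- q))%:E <= ((S + tau) `^ (1 + q))%:E)%E &
     (\int[P]_(x in box K) (w x `^ (- q) * \1_(~` G) x)%:E <=
        (((S + tau) / T) `^ q + tau)%:E)%E].
Proof.
move=> T0 tau0; set Z := S + tau.
have Z0 : 0 < Z by rewrite ltr_wpDl.
have mB : measurable (box K : set 'rV[R]_d) by exact: box_measurable.
pose V := fine (lam (box K)).
have VE : (lam (box K) = V%:E)%E.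
  by rewrite /V fineK// ge0_fin_numE//; exact: lebesgue_box_fin.
have V0 : 0 <= V by exact: fine_ge0.
(* the weights exceed [S] by at most five errors of size [tau / 5] *)
pose tau5 := tau / 5; have tau50 : 0 < tau5 by rewrite divr_gt0.
pose e2 := tau5 / (V + 1).
have e20 : 0 < e2 by rewrite divr_gt0// ltr_wpDl.
have e2V : e2 * V <= tau5.
  by rewrite /e2 mulrAC ler_pdivrMr ?ltr_wpDl// ler_wpM2l ?(ltW tau50)// lerDl.
have e2lam : (e2%:E * lam (box K) <= (e2 * V)%:E)%E by rewrite VE EFinM.
pose e1 := e2 `^ (1 + q).
have e10 : 0 < e1 by rewrite powR_gt0.
have e1p : e1 `^ p = e2 by rewrite -powRrM mulfV ?gt_eqF// powRr1// ltW.
pose m := (Num.truncn (T / (tau5 * e1))).+1.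
pose M := m%:R * e1.
have M0 : 0 < M by rewrite mulr_gt0// ltr0n.
have TM : T * M^-1 <= tau5.
  rewrite ler_pdivrMr// /M mulrCA -ler_pdivrMr ?mulr_gt0//.
  by apply: ltW; exact: truncnS_gt.
pose b := (Z / e2) `^ q.
have b0 : 0 <= b by exact: powR_ge0.
pose ep := Num.min (tau5 / (M `^ p + 1)) (Num.min (tau5 / T) (tau / (b * 2 + 1))).
have Mp0 : 0 < M `^ p + 1 by rewrite ltr_wpDl ?powR_ge0.
have b20 : 0 < b * 2 + 1 by rewrite ltr_wpDl ?mulr_ge0.
have ep0 : 0 < ep by rewrite !lt_min !divr_gt0.
have epM : M `^ p * ep <= tau5.
  apply: (@le_trans _ _ (M `^ p * (tau5 / (M `^ p + 1)))).
    by rewrite ler_wpM2l ?powR_ge0// ge_min lexx.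
  by rewrite mulrA ler_pdivrMr// mulrC ler_wpM2l ?(ltW tau50)// lerDl.
have epT : T * ep <= tau5.
  apply: (@le_trans _ _ (T * (tau5 / T))); last by rewrite mulrC divfK// gt_eqF.
  by rewrite ler_wpM2l ?(ltW T0)// !ge_min lexx orbT.
have epb : b * (ep + ep) <= tau.
  apply: (@le_trans _ _ (b * 2 * (tau / (b * 2 + 1)))).
    rewrite -mulrA ler_wpM2l// [2 * _]mulr_natl mulr2n.
    by apply: lerD; rewrite !ge_min lexx !orbT.
  by rewrite mulrA ler_pdivrMr// mulrC ler_wpM2l ?(ltW tau0)// lerDl.
have lamA0 : (lam A <= 0)%E by rewrite lamA.
pose E := A `|` [set x | (M <= f x)%R].
have mfM : measurable [set x | (M <= f x)%R].
  rewrite -[X in measurable X]setTI (_ : [set x | _] = f @^-1` `[M, +oo[%classic); last first.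
    by apply/seteqP; split=> x; rewrite /= in_itv/= andbT.
  exact: mf.
have mE : measurable E by exact: measurableU.
have lamE : (lam E <= (M^-1)%:E)%E.
  apply: (le_trans (measureU2 _ mA mfM)).
  rewrite -[leRHS]add0e; apply: leeD; last exact: lebesgue_density_ge.
  exact: lamA0.
(* exceptional sets must be small for the Lebesgue measure and for [P] *)
pose mu : {measure set 'rV[R]_d -> \bar R} := measure_add (mrestr lam mB) P.
have muE X : mu X = (lam (X `&` box K) + P X)%E by exact: measure_addE.
have mu_fin : (mu setT < +oo)%E.
  rewrite muE setTI; apply: lte_add_pinfty; first exact: lebesgue_box_fin.
  by rewrite probability_setT ltry.
have mulam X : (mu X <= ep%:E)%E -> (lam (X `&` box K) <= ep%:E)%E.
  by apply: le_trans; rewrite muE leeDl.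
have muP X : (mu X <= ep%:E)%E -> (P X <= ep%:E)%E.
  by apply: le_trans; rewrite muE leeDr.
have E01 (x : 'rV[R]_d) : 0 <= (\1_E x : R) <= 1 := indic01 _ _.
have [kD [D [BD [kkD mBD D01 DB muBD]]]] :=
  step_approx_bounded (step_approx_indic mu_fin mE) E01 ep0.
pose h x := \sum_(0 <= i < m) e1 * (i%:R * e1 <= f x)%R%:R.
have hP x : (f x < M /\ f x <= h x <= f x + e1) \/ (M <= f x /\ h x = M).
  exact: staircase.
have h0 x : 0 <= h x.
  by apply: sumr_ge0 => i _; rewrite mulr_ge0 ?(ltW e10).
have hM x : 0 <= h x <= M.
  rewrite h0 /h /M /index_iota subn0 -mulr_sumr mulrC ler_wpM2r ?(ltW e10)//.
  apply: (@le_trans _ _ (\sum_(i <- iota 0 m) 1)).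
    by apply: ler_sum => i _; case: (_ <= f x).
  by rewrite big_const_seq count_predT iter_addr_0 size_iota.
have hf x : h x <= f x + e1.
  case: (hP x) => [[_ /andP[]]//|[Mf ->]].
  by apply: (le_trans Mf); rewrite lerDl ltW.
have mi (i : nat) : measurable [set x | (i%:R * e1 <= f x)%R].
  rewrite -[X in measurable X]setTI (_ : [set x | _] = f @^-1` `[i%:R * e1, +oo[%classic).
    exact: mf.
  by apply/seteqP; split=> x; rewrite /= in_itv/= andbT.
have hI (i : nat) : (fun x => e1 * (i%:R * e1 <= f x)%R%:R) =
    (fun x => e1 * \1_[set x | (i%:R * e1 <= f x)%R] x).
  apply/funext => x; rewrite indicE; congr (_ * (nat_of_bool _)%:R).
  by apply/idP/idP; rewrite inE.
have hE : step_approx mu h.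
  apply: step_approx_sum => i; rewrite hI.
  have a := step_approx_indic mu_fin (mi i).
  exact: (step_approx_comp2 (fun u _ => e1 * u) a a).
have mh : measurable_fun setT h.
  apply: measurable_sum => i; rewrite hI.
  by apply: measurable_funM => //; exact: measurable_indic.
have [kg [g [Bg [kkg mBg gM gB muBg]]]] := step_approx_bounded hE hM ep0.
have g0 x : 0 <= g x by have /andP[] := gM x.
have D0 x : 0 <= D x by have /andP[] := D01 x.
pose w x := (g x `^ p + e2 + T * D x) / Z.
pose k := maxn kD kg.
have {}kkD : step k D by apply: step_refine kkD; rewrite leq_maxl.
have {}kkg : step k g by apply: step_refine kkg; rewrite leq_maxr.
have kw : step k w.
  exact: (step_comp2 (fun a b => (a `^ p + e2 + T * b) / Z)).
have w_ge x : e2 / Z <= w x.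
  rewrite ler_wpM2r ?invr_ge0 ?(ltW Z0)// addrAC lerDr addr_ge0 ?powR_ge0//.
  by rewrite mulr_ge0 ?(ltW T0).
have w0 x : 0 < w x by apply: lt_le_trans (w_ge x); rewrite divr_gt0.
pose G := ~` (Bg `|` BD `|` E).
have mG : measurable G by apply: measurableC; apply: measurableU => //; exact: measurableU.
have mg := step_measurable kkg; have mD := step_measurable kkD; have mw := step_measurable kw.
have mgp : measurable_fun setT (fun x => g x `^ p).
  exact: (measurableT_comp (measurable_powR _) mg).
have mhp : measurable_fun setT (fun x => h x `^ p).
  exact: (measurableT_comp (measurable_powR _) mh).
have gp0 x : 0 <= g x `^ p by exact: powR_ge0.
have gS : (\int[lam]_(x in box K) (g x `^ p)%:E <= (S + tau5 + tau5)%:E)%E.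
  have le_gM x : box K x -> g x `^ p <= M `^ p.
    by move=> _; have /andP[_ h2] := gM x; apply: ge0_ler_powR; rewrite ?nnegrE ?(ltW p_gt0) ?(ltW M0).
  have le_gh x : box K x -> ~ Bg x -> g x `^ p <= h x `^ p.
    by move=> _ nB; rewrite (_ : g x = h x)//; apply: contrapT => /gB.
  have := integral_off_bad mB mBg mgp mhp gp0 (fun x => powR_ge0 _ _) le_gM (powR_ge0 _ _) le_gh (mulam _ muBg).
  move=> /le_trans; apply; rewrite EFinD; apply: leeD; last by rewrite lee_fin.
  apply: (@le_trans _ _ (\int[lam]_(x in box K) (f x `^ p + e2)%:E)%E).
    apply: ge0_le_integral_fin => //.
    - exact: measurable_funD.
    - by move=> x _; exact: powR_ge0.
    move=> x _; rewrite -e1p; apply: (@le_trans _ _ ((f x + e1) `^ p)).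
      by apply: ge0_ler_powR; rewrite ?nnegrE ?(ltW p_gt0) ?addr_ge0 ?(ltW e10).
    by apply: powR_subadd; rewrite ?(ltW e10).
  rewrite ge0_integralD_fin//; last 2 first.
  - by move=> x _; exact: powR_ge0.
  - by move=> x _; exact: ltW.
  rewrite EFinD; apply: leeD.
    by rewrite -SE; apply: ge0_subset_integral_fin => // x; exact: powR_ge0.
  rewrite -[X in (X <= _)%E]/(\int[lam]_(x in box K) cst e2%:E x)%E (integral_cst lam mB).
  by apply: (le_trans e2lam); rewrite lee_fin.
have DS : (\int[lam]_(x in box K) (D x)%:E <= (M^-1 + ep)%:E)%E.
  have mI : measurable_fun setT (\1_E : 'rV[R]_d -> R) by exact: measurable_indic.
  have le_D1 x : box K x -> D x <= 1 by move=> _; have /andP[] := D01 x.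
  have I0 x : 0 <= \1_E x :> R by have /andP[] := E01 x.
  have le_DE x : box K x -> ~ BD x -> D x <= \1_E x.
    by move=> _ nB; rewrite (_ : D x = \1_E x)//; apply: contrapT => /DB.
  have := integral_off_bad mB mBD mD mI D0 I0 le_D1 ler01 le_DE (mulam _ muBD).
  move=> /le_trans; apply; rewrite mul1r EFinD leeD2r//.
  rewrite integral_indic//; apply: le_trans lamE.
  by apply: le_measure; rewrite ?inE//; exact: measurableI.
exists k, g, w, G, (e2 / Z); split.
- split=> //; first by rewrite divr_gt0.
    move=> X u mX XG mu_ u0; apply: PA => // x /XG nG xA; apply: nG.
    by right; left.
  move=> x nG; have -> : g x = h x.
    by apply: contrapT => /gB xB; apply: nG; left; left.
  by case: (hP x) => [[_ /andP[]]//|[Mf _]]; exfalso; apply: nG; right; right.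
- by split.
- rewrite (eq_integral (fun x => (Z^-1 * (g x `^ p + e2 + T * D x))%:E)); last first.
    by move=> x _; rewrite mulrC.
  have mTD : measurable_fun setT (fun x => T * D x) by exact: measurable_funM.
  have TD0 x : 0 <= T * D x by rewrite mulr_ge0 ?(ltW T0).
  have mge : measurable_fun setT (fun x => g x `^ p + e2) by exact: measurable_funD.
  rewrite ge0_integralZl_fin ?invr_ge0 ?(ltW Z0)//; last 2 first.
  - exact: measurable_funD.
  - by move=> x _; rewrite !addr_ge0 ?(ltW e20).
  rewrite lee_pdivrMl// mule1 ge0_integralD_fin//; last first.
    by move=> x _; rewrite addr_ge0 ?(ltW e20).
  rewrite ge0_integralD_fin//; last by move=> x _; exact: ltW.
  rewrite [X in (_ + X <= _)%E]ge0_integralZl_fin ?(ltW T0)//.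
  rewrite -[X in (_ + X + _ <= _)%E]/(\int[lam]_(x in box K) cst e2%:E x)%E (integral_cst lam mB).
  apply: (@le_trans _ _ ((S + tau5 + tau5)%:E + (e2 * V)%:E + (T * (M^-1 + ep))%:E)%E).
    apply: leeD; first by apply: leeD.
    by rewrite EFinM lee_wpmul2l ?lee_fin ?(ltW T0).
  rewrite -!EFinD lee_fin mulrDr /Z; move: e2V TM epT; rewrite /tau5; lra.
- apply: (@le_trans _ _ (\int[lam]_(x in box K) (Z `^ q * g x `^ p)%:E)%E).
    apply: ge0_le_integral_fin => //.
    - by apply: measurable_funM => //; exact: (measurableT_comp (measurable_powR _) mw).
    - exact: measurable_funM.
    - by move=> x _; rewrite mulr_ge0 ?powR_ge0.
    move=> x _; have [->|gx0] := eqVneq (g x) 0.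
      by rewrite mul0r mulr_ge0 ?powR_ge0.
    have {}gx0 : 0 < g x by rewrite lt_def gx0 g0.
    have z0 : 0 < g x `^ p / Z by rewrite divr_gt0// powR_gt0.
    have zw : g x `^ p / Z <= w x.
      rewrite ler_wpM2r ?invr_ge0 ?(ltW Z0)// -addrA lerDl addr_ge0 ?(ltW e20)//.
      by rewrite mulr_ge0 ?(ltW T0).
    apply: (le_trans (ler_wpM2l (g0 x) (ler_powRN (ltW q_gt0) z0 zw))).
    rewrite powR_div ?powR_ge0// opprK -powRrM.
    have pqE : p = 1 + p * - q.
      have h1 : p + p * q = 1 by rewrite -[X in X + _]mulr1 -mulrDr mulVf ?gt_eqF.
      by apply/eqP; rewrite mulrN eq_sym subr_eq h1.
    rewrite mulrA mulrC; apply: ler_wpM2l; first exact: powR_ge0.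
    rewrite [in leRHS]pqE powRD ?powRr1//.
    by apply/implyP => _; rewrite gt_eqF.
  rewrite ge0_integralZl_fin ?powR_ge0//.
  rewrite powRD ?(gt_eqF Z0) ?implybT// powRr1 ?(ltW Z0)// EFinM [leRHS]muleC.
  rewrite lee_wpmul2l ?lee_fin ?powR_ge0//; apply: (le_trans gS).
  by rewrite lee_fin /Z; move: tau50; rewrite /tau5; lra.
- pose B := Bg `|` BD.
  have mBB : measurable B by exact: measurableU.
  have muB : (P (B `&` box K) <= (ep + ep)%:E)%E.
    apply: (@le_trans _ _ (P B)).
      by apply: le_measure; rewrite ?inE//; exact: measurableI.
    apply: (le_trans (measureU2 _ mBg mBD)); rewrite EFinD leeD//; exact: muP.
  have mF : measurable_fun setT (fun x => w x `^ (- q) * \1_(~` G) x).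
    apply: measurable_funM; first exact: (measurableT_comp (measurable_powR _) mw).
    by apply: measurable_indic; exact: measurableC.
  have I01 (x : 'rV[R]_d) : 0 <= (\1_(~` G) x : R) <= 1 := indic01 _ _.
  have F0 x : 0 <= w x `^ (- q) * \1_(~` G) x.
    by rewrite mulr_ge0 ?powR_ge0//; have /andP[] := I01 x.
  have mC : measurable_fun setT (cst ((Z / T) `^ q) : 'rV[R]_d -> R) by [].
  have Fb x : box K x -> w x `^ (- q) * \1_(~` G) x <= b.
    move=> _; apply: (@le_trans _ _ (w x `^ (- q))).
      by rewrite ler_piMr ?powR_ge0//; have /andP[] := I01 x.
    have z0 : 0 < e2 / Z by rewrite divr_gt0.
    apply: (le_trans (ler_powRN (ltW q_gt0) z0 (w_ge x))).
    by rewrite /b (powR_div _ (ltW Z0) e20) (powR_div _ (ltW e20) Z0) opprK mulrC.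
  have FC x : box K x -> ~ B x -> w x `^ (- q) * \1_(~` G) x <= cst ((Z / T) `^ q) x.
    move=> _ nB; rewrite /cst /= indicE.
    have [|] := boolP (x \in _); last by rewrite mulr0 powR_ge0.
    rewrite inE /G setCK => -[//|xE]; rewrite mulr1.
    have Dx : D x = 1.
      have -> : D x = \1_E x by apply: contrapT => /DB xB; apply: nB; right.
      by rewrite indicE mem_set.
    have z0 : 0 < T / Z by rewrite divr_gt0.
    have zw : T / Z <= w x.
      rewrite ler_wpM2r ?invr_ge0 ?(ltW Z0)// Dx mulr1 lerDr addr_ge0 ?powR_ge0//.
      exact: ltW.
    apply: (le_trans (ler_powRN (ltW q_gt0) z0 zw)).
    by rewrite (powR_div _ (ltW Z0) T0) (powR_div _ (ltW T0) Z0) opprK mulrC.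
  have := integral_off_bad mB mBB mF mC F0 (fun x => powR_ge0 _ _) Fb b0 FC muB.
  move=> /le_trans; apply; rewrite EFinD; apply: leeD; last by rewrite lee_fin.
  rewrite -[X in (X <= _)%E]/(\int[P]_(x in box K) cst ((Z / T) `^ q)%:E x)%E (integral_cst P mB).
  rewrite -[leRHS]mule1 lee_wpmul2l ?lee_fin ?powR_ge0//; exact: probability_le1.
Qed.

Hypothesis S_gt0 : 0 < S.

(** Continuity at [t = 0]. *)
Lemma upper_constant (e : R) : 0 < e -> exists t : R, [/\ 0 < t, t < 1 &
  (1 - t) `^ (- (2 * q)) * ((J + t) * (S + t) `^ (1 + q) + t) <= J * S `^ (1 + q) + e].
Proof.
move=> e0.
pose F (t : R) := (1 - t) `^ (- (2 * q)) * ((J + t) * (S + t) `^ (1 + q) + t).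
have F0 : F 0 = J * S `^ (1 + q) by rewrite /F subr0 powR1 mul1r !addr0.
have c1 : (fun t : R => (1 - t) `^ (- (2 * q))) @ (0 : R) --> (1 - 0 : R) `^ (- (2 * q)).
  have c : (fun t : R => 1 - t) @ (0 : R) --> (1 - 0 : R).
    by apply: cvgB; [exact: cvg_cst|exact: cvg_id].
  apply: (cvg_comp _ (fun x : R => x `^ (- (2 * q))) c).
  by apply: powR_continuous; rewrite subr0.
have c2 : (fun t : R => (S + t) `^ (1 + q)) @ (0 : R) --> (S + 0 : R) `^ (1 + q).
  have c : (fun t : R => S + t) @ (0 : R) --> (S + 0 : R).
    by apply: cvgD; [exact: cvg_cst|exact: cvg_id].
  apply: (cvg_comp _ (fun x : R => x `^ (1 + q)) c).
  by apply: powR_continuous; rewrite addr0.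
have c3 : (fun t : R => J + t) @ (0 : R) --> (J + 0 : R).
  by apply: cvgD; [exact: cvg_cst|exact: cvg_id].
have cF : F @ (0 : R) --> F 0.
  by apply: cvgM => //; apply: cvgD; [exact: cvgM|exact: cvg_id].
move/cvgrPdist_le : cF => /(_ e e0)/nbhs_ballP[D /= D0 DF].
exists (Num.min (D / 2) (1 / 2)); set t := Num.min _ _.
have t0 : 0 < t by rewrite lt_min !divr_gt0.
have tD : t < D.
  by apply: (@le_lt_trans _ _ (D / 2)); [rewrite ge_min lexx|lra].
have t1 : t < 1.
  by apply: (@le_lt_trans _ _ (1 / 2)); [rewrite ge_min lexx orbT|lra].
split=> //; have := DF t; rewrite /ball /= sub0r normrN gtr0_norm// => /(_ tD).
by rewrite F0 distrC ler_norml lerBlDl => /andP[].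
Qed.

(** The upper half of Zador's theorem. Inside a large box the weights of [good_weights] are
    used; outside, the moment assumption makes the distortion of the quantizer of the whole
    space small. *)
Lemma zador_upper_bound (e : R) : 0 < e ->
  exists n0, forall n, (n0 <= n)%N -> exists al : seq 'rV[R]_d,
   [/\ al != [::], (size al <= n)%N &
    ((n%:R `^ q)%:E * \int[P]_x (dst x al `^ r)%:E <= (J * S `^ (1 + q) + e)%:E)%E].
Proof.
move=> e0; have e20 : 0 < e / 2 by rewrite divr_gt0.
have J0 := qconst_gt0 hN d_gt0 r_gt0.
have [t [t0 t1 tP]] := upper_constant e20.
have [C1 C10 gaP] := pierce_pointwise hN d_gt0 r_gt0 eta_gt0.
have [C [k0 [C0 beP]]] := cube_quantizer hN d_gt0 r_gt0 t0.
have Cr0 : 0 < C `^ r by rewrite powR_gt0.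
pose a := t / (C `^ r * 2).
have a0 : 0 < a by rewrite divr_gt0// mulr_gt0.
pose tau := Num.min t a.
have tau0 : 0 < tau by rewrite lt_min t0.
have Stau : 0 < S + tau by rewrite addr_gt0.
pose T := (S + tau) / a `^ q^-1.
have T0 : 0 < T by rewrite divr_gt0// powR_gt0.
have TE : ((S + tau) / T) `^ q = a.
  rewrite /T invf_div mulrCA mulfV ?gt_eqF// mulr1 -powRrM mulVf ?gt_eqF//.
  by rewrite powRr1 ?(ltW a0).
have m1 := @measurable_1norm_powR _ _ _ hN (r + eta).
have Moo := moment_1norm hN (addr_gt0 r_gt0 eta_gt0) mom.
pose c := C1 * t `^ (- q).
have c0 : 0 < c by rewrite mulr_gt0// powR_gt0.
have ec0 : 0 < e / 2 / c by rewrite divr_gt0.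
have [K KP] := integral_tail box_measurable (@box_nd R d) (@box_cover R d) m1
   (fun x => powR_ge0 _ _) Moo ec0.
have {}KP := KP K (leqnn _).
have [k [g [w [G [wmin [[wmin0 mG PG fg] [kg kw g0 wmn] wI gwI wGI]]]]]] :=
  good_weights K T0 tau0.
have t01 : 0 < t < 1 by rewrite t0.
have [n0 nP] := weighted_upper hN d_gt0 r_gt0 mf f_ge0 eta_gt0 t01 wmin0 mG PG fg kg kw g0 wmn wI
  C10 C0 gaP (ex_intro _ k0 beP).
exists n0 => n nn; have [al [al0 als alI alp]] := nP n nn.
exists al; split=> //.
have mB : measurable (box K : set 'rV[R]_d) by exact: box_measurable.
have mBC : measurable (~` box K : set 'rV[R]_d) by exact: measurableC.
have md : measurable_fun setT (fun x => dst x al `^ r) by exact: measurable_dist_powR.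
have d0 x : 0 <= dst x al `^ r by exact: powR_ge0.
rewrite -[X in (\int[P]_(x in X) _)%E](setUv (box K)) ge0_integral_setU//; last 3 first.
- by apply/measurable_EFinP; exact: measurable_funTS.
- by move=> x _; rewrite lee_fin.
- by apply/disj_setPS => x [].
rewrite ge0_muleDr; last 2 first.
- by apply: integral_ge0 => x _; rewrite lee_fin.
- by apply: integral_ge0 => x _; rewrite lee_fin.
have -> : J * S `^ (1 + q) + e = J * S `^ (1 + q) + e / 2 + e / 2.
  by rewrite -addrA -splitr.
rewrite EFinD; apply: leeD.
  apply: (le_trans alI).
  apply: (@le_trans _ _ ((1 - t) `^ (- (2 * q)) * ((J + t) * (S + t) `^ (1 + q) + t))%:E);
    last by rewrite lee_fin.
  rewrite EFinM; apply: lee_wpmul2l; first by rewrite lee_fin powR_ge0.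
  rewrite [leRHS]EFinD; apply: leeD.
    rewrite [leRHS]EFinM; apply: lee_wpmul2l; first by rewrite lee_fin addr_ge0 ?ltW.
    apply: (le_trans gwI); rewrite lee_fin; apply: ge0_ler_powR.
    - by rewrite addr_ge0// ltW.
    - by rewrite nnegrE ltW.
    - by rewrite nnegrE addr_ge0// ltW.
    - by rewrite lerD2l ge_min lexx.
  apply: (@le_trans _ _ ((C `^ r)%:E * (a + a)%:E)%E).
    apply: lee_wpmul2l; first by rewrite lee_fin ltW.
    by apply: (le_trans wGI); rewrite TE lee_fin lerD2l ge_min lexx orbT.
  rewrite -EFinM lee_fin (_ : _ * (a + a) = a * (C `^ r * 2)); last by ring.
  by rewrite /a divfK// gt_eqF// mulr_gt0.
rewrite -ge0_integralZl_fin ?powR_ge0//.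
apply: (@le_trans _ _ (\int[P]_(x in ~` box K) (c * (1 + N x) `^ (r + eta))%:E)%E).
  apply: ge0_le_integral_fin => //.
  - exact: measurable_funM.
  - exact: measurable_funM.
  - by move=> x _; rewrite mulr_ge0 ?powR_ge0.
rewrite ge0_integralZl_fin ?(ltW c0)//; last by move=> x _; exact: powR_ge0.
apply: (@le_trans _ _ (c%:E * (e / 2 / c)%:E)%E).
  by apply: lee_wpmul2l => //; rewrite lee_fin ltW.
by rewrite -EFinM mulrC divfK// gt_eqF.
Qed.

End zador.

(** * The distribution of an asymptotically optimal quantizer *)

Section point_density.
Context {R : realType} {d : nat}.
Variable N : 'rV[R]_d -> R.
Hypothesis hN : is_norm N.
Hypothesis d_gt0 : (0 < d)%N.
Local Notation lam := (lebesgue_rV R d).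
Local Notation dst x s := (dist N x [set` s]).
Variables (r : R) (r_gt0 : 0 < r).
Local Notation q := (r / d%:R).
Local Notation p := (1 + r / d%:R)^-1.
Local Notation J := (qconst N r).
Variable f : 'rV[R]_d -> R.
Hypothesis mf : measurable_fun setT f.
Hypothesis f_ge0 : forall x, 0 <= f x.
Variable S : R.
Hypothesis S_gt0 : 0 < S.
Hypothesis SE : (\int[lam]_x (f x `^ p)%:E = S%:E)%E.
Variable al : nat -> seq 'rV[R]_d.
Hypothesis alP : forall n, (0 < n)%N -> al n != [::] /\ (size (al n) <= n)%N.
Hypothesis al_opt : forall e : R, 0 < e -> exists n0, forall n K, (n0 <= n)%N ->
  ((n%:R `^ q)%:E * \int[lam]_(x in box K) (dst x (al n) `^ r * f x)%:E <=
    (J * S `^ (1 + q) + e)%:E)%E.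

Let q_gt0 : 0 < q. Proof. by rewrite divr_gt0// ltr0n. Qed.
Let q1_gt0 : 0 < 1 + q. Proof. by rewrite addr_gt0. Qed.
Let p_gt0 : 0 < p. Proof. by rewrite invr_gt0. Qed.

(** The proportion of points in a region cannot exceed its share of [f `^ p]: the lower
    bound for a weight slightly decreased on the region would otherwise contradict
    optimality. *)
Lemma point_density_le (phi : 'rV[R]_d -> R) k K (Phi e : R) :
  step k phi -> (forall x, 0 <= phi x <= 1) -> (forall x, ~ box K x -> phi x = 0) ->
  (\int[lam]_(x in box K) (phi x * f x `^ p)%:E = Phi%:E)%E -> 0 < e ->
  exists n0, forall n, (n0 <= n)%N ->
    n%:R^-1 * (\sum_(a <- al n) phi a) <= S^-1 * Phi + e.
Proof.
move=> kphi phi01 phi_out PhiE e0.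
have J0 := qconst_gt0 hN d_gt0 r_gt0.
have mphi := step_measurable kphi.
have phi0 x : 0 <= phi x by have /andP[] := phi01 x.
have phi1 x : phi x <= 1 by have /andP[] := phi01 x.
have mfp : measurable_fun setT (fun x => f x `^ p).
  exact: (measurableT_comp (measurable_powR _) mf).
have fp0 x : 0 <= f x `^ p by exact: powR_ge0.
have mphif : measurable_fun setT (fun x => phi x * f x `^ p) by exact: measurable_funM.
have phif0 x : 0 <= phi x * f x `^ p by rewrite mulr_ge0.
have Phi0 : 0 <= Phi by rewrite -lee_fin -PhiE; apply: integral_ge0 => x _; rewrite lee_fin.
have PhiS : Phi <= S.
  rewrite -lee_fin -PhiE -SE.
  apply: (@le_trans _ _ (\int[lam]_(x in box K) (f x `^ p)%:E)%E).
    apply: ge0_le_integral_fin => //; first exact: box_measurable.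
    by move=> x _; rewrite ler_piMl.
  by apply: ge0_subset_integral_fin => //; exact: box_measurable.
pose h := Num.min (1 / 2) (e / 6).
have h0 : 0 < h by rewrite lt_min !divr_gt0.
have h2 : h <= 1 / 2 by rewrite ge_min lexx.
have he : h <= e / 6 by rewrite ge_min lexx orbT.
have h1 : 0 < 1 - h by lra.
(* relative loss in the integral when [1 - h * phi] is raised to the power [q * p] *)
pose kap := q * p * (h / (1 - h)).
have kap0 : 0 <= kap by rewrite !mulr_ge0 ?invr_ge0 ?(ltW h0) ?(ltW h1) ?(ltW p_gt0)// ltW.
have hh : h / (1 - h) <= h * (1 + 2 * h).
  rewrite ler_pdivrMr//.
  have : 0 <= h * h * (1 - 2 * h) by rewrite !mulr_ge0 ?(ltW h0)//; lra.
  by nra.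
have kapE : (1 + q) * kap <= q * h * (1 + 2 * h).
  have -> : (1 + q) * kap = (1 + q) * p * (q * (h / (1 - h))) by rewrite /kap; ring.
  by rewrite mulfV ?gt_eqF// mul1r -(mulrA q h) ler_wpM2l// ltW.
have kap1 : kap < 1.
  rewrite -(ltr_pM2l q1_gt0) mulr1; apply: (le_lt_trans kapE).
  have : q * (h * (1 + 2 * h)) <= q * 1.
    by rewrite ler_wpM2l ?(ltW q_gt0)//; nra.
  by rewrite mulr1 mulrA; lra.
have SkP : 0 < S - kap * Phi.
  have : kap * Phi <= kap * S by rewrite ler_wpM2l.
  have : kap * S < 1 * S by rewrite ltr_pM2r.
  by rewrite mul1r; lra.
have qhS : 0 < q * h * S by do 2 apply: mulr_gt0 => //.
pose del := Num.min (S - kap * Phi) (q * h * S * (e / 3) / (1 + q)).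
have del0 : 0 < del by rewrite lt_min SkP !divr_gt0// mulr_gt0// divr_gt0.
have delq : (1 + q) * del <= q * h * S * (e / 3).
  by rewrite -ler_pdivlMl// mulrC ge_min lexx orbT.
have Sq0 : 0 < S `^ q by rewrite powR_gt0.
pose e1 := J * S `^ q * (q * h * S * (e / 6)).
have e10 : 0 < e1.
  apply: mulr_gt0; apply: mulr_gt0 => //.
  exact: divr_gt0.
have Sdel : ((S - del)%:E < \int[lam]_x (f x `^ p)%:E)%E.
  by rewrite SE lte_fin ltrBlDr ltrDl.
have [K1 K1P] := integral_exhaust box_measurable (@box_nd R d) (@box_cover R d) mfp fp0 Sdel.
pose K' := maxn K K1.
have {}K1P := K1P K' (leq_maxr _ _).
have mB : measurable (box K' : set 'rV[R]_d) by exact: box_measurable.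
have PhiE' : (\int[lam]_(x in box K') (phi x * f x `^ p)%:E = Phi%:E)%E.
  rewrite -PhiE [LHS]integral_mkcond [RHS]integral_mkcond; apply: eq_integral => x _.
  rewrite !patchE; case: ifPn; rewrite ?inE => xK'.
    case: ifPn => // /negP; rewrite inE => xK.
    by rewrite phi_out// mul0r.
  case: ifPn => //; rewrite inE => xK; exfalso; move: xK' => /negP; apply.
  by rewrite inE; exact: (box_mono (leq_maxl _ _)) xK.
pose psi x := S * (1 - h * phi x) `^ p * \1_(box K') x.
have kB : step k (\1_(box K') : 'rV[R]_d -> R) := @step_box_indic _ _ _ _.
have kpsi : step k psi by exact: (step_comp2 (fun a b => S * (1 - h * a) `^ p * b)).
have I01 (x : 'rV[R]_d) : 0 <= (\1_(box K') x : R) <= 1 := indic01 _ _.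
have hp0 x : 0 <= 1 - h * phi x.
  have : h * phi x <= h * 1 by rewrite ler_wpM2l// ltW.
  by rewrite mulr1; lra.
have hp1 x : 1 - h * phi x <= 1 by rewrite gerBl mulr_ge0// ltW.
have psi01 x : 0 <= psi x <= S.
  have /andP[i0 i1] := I01 x.
  rewrite /psi; apply/andP; split; first by rewrite !mulr_ge0 ?powR_ge0// ltW.
  rewrite -mulrA ler_piMr ?(ltW S_gt0)// mulr_ile1 ?powR_ge0//.
  have p1 : 1 = 1 `^ p :> R by rewrite powR1.
  by rewrite [leRHS]p1; apply: ge0_ler_powR; rewrite ?nnegrE ?(ltW p_gt0).
pose c := S `^ q * (S - del - kap * Phi).
have c0 : 0 <= c.
  rewrite mulr_ge0 ?powR_ge0//.
  have : del <= S - kap * Phi by rewrite ge_min lexx.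
  lra.
have mpsi : measurable_fun setT (fun x => psi x `^ q * f x `^ p).
  apply: measurable_funM => //.
  exact: (measurableT_comp (measurable_powR _) (step_measurable kpsi)).
have cint : (c%:E < \int[lam]_(x in box K') (psi x `^ q * f x `^ (1 + q)^-1)%:E)%E.
  rewrite ltNge; apply/negP => cge; move: K1P; apply/negP; rewrite -leNgt.
  apply: (@le_trans _ _ (\int[lam]_(x in box K')
     (S `^ (- q) * (psi x `^ q * f x `^ p) + kap * (phi x * f x `^ p))%:E)%E).
    apply: ge0_le_integral_fin => //.
    - by apply: measurable_funD; exact: measurable_funM.
    move=> x xK; rewrite /psi indicE mem_set// mulr1.
    rewrite (powRM _ (ltW S_gt0)) ?powR_ge0// -powRrM.
    rewrite [leRHS](_ : _ = (S `^ (- q) * S `^ q * (1 - h * phi x) `^ (p * q) + kap * phi x) *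
      f x `^ p); last by ring.
    rewrite ler_peMl//.
    rewrite powRN mulVf ?gt_eqF// mul1r.
    have y1 : h * phi x < 1.
      by apply: (@le_lt_trans _ _ h); [rewrite ler_piMr// ltW|lra].
    have pq0 : 0 < p * q by rewrite mulr_gt0.
    have := powR_1B_ge pq0 (mulr_ge0 (ltW h0) (phi0 x)) y1.
    have : p * q * (h * phi x / (1 - h * phi x)) <= kap * phi x.
      have -> : kap * phi x = p * q * (h * phi x / (1 - h)) by rewrite /kap; ring.
      rewrite ler_wpM2l ?(ltW pq0)// ler_wpM2l ?mulr_ge0 ?(ltW h0)//.
      rewrite lef_pV2 ?posrE//; last by rewrite subr_gt0.
      by rewrite lerD2l lerN2 ler_piMr// ltW.
    by lra.
  rewrite ge0_integralD_fin//; last 4 first.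
  - exact: measurable_funM.
  - exact: measurable_funM.
  - by move=> x _; rewrite !mulr_ge0 ?powR_ge0.
  - by move=> x _; rewrite mulr_ge0.
  rewrite ge0_integralZl_fin ?powR_ge0//; last by move=> x _; rewrite mulr_ge0 ?powR_ge0.
  rewrite [X in (_ + X <= _)%E]ge0_integralZl_fin// PhiE'.
  apply: (@le_trans _ _ ((S `^ (- q))%:E * c%:E + (kap * Phi)%:E)%E).
    by apply: leeD => //; apply: lee_wpmul2l; rewrite ?lee_fin ?powR_ge0.
  rewrite -EFinM -EFinD lee_fin /c mulrA powRN mulVf ?gt_eqF// mul1r.
  lra.
have [n1 lb] := weighted_lower_bound hN d_gt0 r_gt0 mf f_ge0 kpsi psi01 c0 cint e10.
have [n2 opt] := al_opt e10.
exists (maxn 1 (maxn n1 n2)) => n; rewrite !geq_max => /and3P[n_gt0 n1n n2n].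
have n0' : 0 < n%:R :> R by rewrite ltr0n.
have [aln0 alns] := alP n_gt0.
have := lb n (al n) n1n aln0 alns.
have := opt n K' n2n.
set D := (X in (X <= _)%E) => Dle lbn.
pose M := n%:R^-1 * (\sum_(a <- al n) phi a); rewrite -/M.
have sum_le : (\sum_(a <- al n) psi a `^ (1 + q)) <= S * S `^ q * (n%:R * (1 - h * M)).
  apply: (@le_trans _ _ (\sum_(a <- al n) S * S `^ q * (1 - h * phi a))).
    apply: ler_sum => a _; have /andP[i0 i1] := I01 a.
    have S1q : S `^ (1 + q) = S * S `^ q.
      by rewrite powRD ?powRr1 ?(ltW S_gt0)//; apply/implyP => _; rewrite gt_eqF.
    apply: (@le_trans _ _ ((S * (1 - h * phi a) `^ p) `^ (1 + q))).
      apply: ge0_ler_powR.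
      - exact: ltW.
      - by rewrite nnegrE; have /andP[] := psi01 a.
      - by rewrite nnegrE mulr_ge0 ?powR_ge0// ltW.
      - by rewrite ler_piMr// mulr_ge0 ?powR_ge0// ltW.
    rewrite (powRM _ (ltW S_gt0)) ?powR_ge0// -powRrM mulVf ?gt_eqF// powRr1//.
    by rewrite S1q.
  rewrite -mulr_sumr ler_wpM2l ?mulr_ge0 ?powR_ge0 ?(ltW S_gt0)//.
  rewrite big_split/= big_const_seq count_predT iter_addr_0 sumrN -mulr_sumr.
  rewrite mulrBr mulr1 [n%:R * _]mulrCA /M [n%:R * _]mulrA mulfV ?gt_eqF// mul1r.
  by rewrite lerD2r ler_nat.
have {lbn} : J * (1 + q) * c <= J * S `^ (1 + q) + e1 + (J * q * (S * S `^ q * (1 - h * M)) + e1).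
  rewrite -lee_fin; apply: (le_trans lbn); rewrite [leRHS]EFinD; apply: leeD => //.
  have Jq : 0 <= J * q by apply: mulr_ge0; exact: ltW.
  rewrite lee_fin lerD2r -(mulrA (J * q)) ler_wpM2l//.
  rewrite mulrC ler_pdivrMr//; apply: (le_trans sum_le).
  by rewrite le_eqVlt; apply/orP; left; apply/eqP; ring.
rewrite (_ : S `^ (1 + q) = S * S `^ q); last first.
  by rewrite powRD ?powRr1 ?(ltW S_gt0)//; apply/implyP => _; rewrite gt_eqF.
have JS0 : 0 < J * S `^ q by rewrite mulr_gt0.
have -> : J * (1 + q) * c = J * S `^ q * ((1 + q) * (S - del - kap * Phi)) by rewrite /c; ring.
have -> : J * (S * S `^ q) + e1 + (J * q * (S * S `^ q * (1 - h * M)) + e1) =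
   J * S `^ q * (S + q * S * (1 - h * M) + 2 * (q * h * S * (e / 6))) by rewrite /e1; ring.
rewrite ler_pM2l// => key.
have kP : (1 + q) * (kap * Phi) <= q * h * (Phi + 2 * h * S).
  rewrite mulrA; apply: (@le_trans _ _ (q * h * (1 + 2 * h) * Phi)).
    by rewrite ler_wpM2r.
  have qh0 : 0 <= q * h by apply: mulr_ge0; exact: ltW.
  rewrite -(mulrA (q * h)) ler_wpM2l//.
  rewrite mulrDl mul1r lerD2l ler_wpM2l// mulr_ge0// ltW//.
rewrite -(ler_pM2l qhS).
have -> : q * h * S * (S^-1 * Phi + e) = q * h * Phi + q * h * S * e.
  by rewrite mulrDr [_ * (S^-1 * _)]mulrA mulfK ?gt_eqF.
have hS : q * h * S * (2 * h) <= q * h * S * (e / 3).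
  by rewrite ler_wpM2l ?(ltW qhS)//; move: he; lra.
move: key delq kP hS; lra.
Qed.

End point_density.

(** * The lower bound for another exponent *)

Section mismatch.
Import HBNNSimple.
Context {R : realType} {d : nat}.
Variable N : 'rV[R]_d -> R.
Hypothesis hN : is_norm N.
Hypothesis d_gt0 : (0 < d)%N.
Local Notation lam := (lebesgue_rV R d).
Local Notation dst x s := (dist N x [set` s]).
Variables (r s : R) (r_gt0 : 0 < r) (s_gt0 : 0 < s).
Local Notation q := (r / d%:R).
Local Notation p := (1 + r / d%:R)^-1.
Local Notation sg := (s / d%:R).
Local Notation th := (1 + s / d%:R)^-1.
Local Notation Jr := (qconst N r).
Local Notation J := (qconst N s).
Variable P : probability 'rV[R]_d R.
Variable f : 'rV[R]_d -> R.
Hypothesis mf : measurable_fun setT f.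
Hypothesis f_ge0 : forall x, 0 <= f x.
Variable A : set 'rV[R]_d.
Hypothesis mA : measurable A.
Hypothesis lamA : (lam A = 0)%E.
Hypothesis PA : density_on P f (~` A).
Variable S : R.
Hypothesis S_gt0 : 0 < S.
Hypothesis SE : (\int[lam]_x (f x `^ p)%:E = S%:E)%E.
Variable al : nat -> seq 'rV[R]_d.
Hypothesis alP : forall n, (0 < n)%N -> al n != [::] /\ (size (al n) <= n)%N.
Hypothesis al_opt : forall e : R, 0 < e -> exists n0, forall n K, (n0 <= n)%N ->
  ((n%:R `^ q)%:E * \int[lam]_(x in box K) (dst x (al n) `^ r * f x)%:E <=
    (Jr * S `^ (1 + q) + e)%:E)%E.

Let q_gt0 : 0 < q. Proof. by rewrite divr_gt0// ltr0n. Qed.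
Let q1_gt0 : 0 < 1 + q. Proof. by rewrite addr_gt0. Qed.
Let p_gt0 : 0 < p. Proof. by rewrite invr_gt0. Qed.
Let p_le1 : p <= 1. Proof. by rewrite invf_le1// lerDl ltW. Qed.
Let sg_gt0 : 0 < sg. Proof. by rewrite divr_gt0// ltr0n. Qed.
Let sg1_gt0 : 0 < 1 + sg. Proof. by rewrite addr_gt0. Qed.
Let th_gt0 : 0 < th. Proof. by rewrite invr_gt0. Qed.
Let th_le1 : th <= 1. Proof. by rewrite invf_le1// lerDl ltW. Qed.

(** The integral of [1 + f] over the exceptional set [B] is controlled by the Lebesgue
    measure and by [P]. *)
Lemma integral_off_bad_dominated (D B : set 'rV[R]_d) (F G : 'rV[R]_d -> R) (W ep : R) :
  measurable D -> measurable B -> measurable_fun setT F -> measurable_fun setT G ->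
  (forall x, 0 <= F x) -> (forall x, 0 <= G x) -> 0 <= W ->
  (forall x, D x -> F x <= W * (1 + f x)) ->
  (forall x, D x -> ~ B x -> F x <= G x) -> (lam (B `&` D) + P B <= ep%:E)%E ->
  (\int[lam]_(x in D) (F x)%:E <= \int[lam]_(x in D) (G x)%:E + (W * ep)%:E)%E.
Proof.
move=> mD mB mF mG F0 G0 W0 FW FG Bep.
have mI : measurable_fun setT (\1_B : 'rV[R]_d -> R) by exact: measurable_indic.
have I0 (x : 'rV[R]_d) : 0 <= (\1_B x : R) by rewrite indicE; case: (_ \in _).
have mIf : measurable_fun setT (fun x => \1_B x * f x) by exact: measurable_funM.
have If0 x : 0 <= \1_B x * f x by rewrite mulr_ge0.
have mH : measurable_fun setT (fun x => \1_B x + \1_B x * f x) by exact: measurable_funD.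
have H0 x : 0 <= \1_B x + \1_B x * f x by rewrite addr_ge0.
apply: (@le_trans _ _ (\int[lam]_(x in D) (G x + W * (\1_B x + \1_B x * f x))%:E)%E).
  apply: ge0_le_integral_fin => //.
    by apply: measurable_funD => //; exact: measurable_funM.
  move=> x xD; have [xB|nB] := pselect (B x).
    by rewrite indicE mem_set//= mul1r; apply: (le_trans (FW x xD)); rewrite lerDr.
  by apply: (le_trans (FG x xD nB)); rewrite lerDl mulr_ge0.
rewrite ge0_integralD_fin//; last 2 first.
- exact: measurable_funM.
- by move=> x _; rewrite mulr_ge0.
apply: leeD2l; rewrite ge0_integralZl_fin// EFinM; apply: lee_wpmul2l => //.
rewrite ge0_integralD_fin//; apply: le_trans Bep; apply: leeD.
  by rewrite integral_indic.
apply: (le_trans (ac_integral_le mf f_ge0 mA lamA PA mD mI I0)).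
rewrite integral_indic//; apply: le_measure; rewrite ?inE//; exact: measurableI.
Qed.

Definition core K := [set x : 'rV[R]_d | box K x /\ K.+1%:R^-1 <= f x <= K.+1%:R].

Lemma core_measurable K : measurable (core K).
Proof.
rewrite (_ : core K = box K `&` f @^-1` `[K.+1%:R^-1, K.+1%:R]%classic).
  apply: measurableI; first exact: box_measurable.
  by rewrite -[X in measurable X]setTI; exact: mf.
by apply/seteqP; split=> x /=; rewrite in_itv.
Qed.

(** The weight [S * f `^ (th - p)] turns Young's inequality into an equality for the
    asymptotic density of points [f `^ p / S]. It is bounded on the set [core K], and an upper
    estimate of the sum over the points suffices, which is what [point_density_le] gives. *)
Lemma mismatch_core K (I e : R) :
  (\int[lam]_(x in core K) (f x `^ (1 - p * sg))%:E = I%:E)%E -> 0 < e ->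
  exists n0, forall n, (n0 <= n)%N ->
    ((J * S `^ sg * I - e)%:E <= (n%:R `^ sg)%:E * \int[P]_x (dst x (al n) `^ s)%:E)%E.
Proof.
move=> IE e0; have J0 := qconst_gt0 hN d_gt0 s_gt0.
have mE := core_measurable K.
have mB : measurable (box K : set 'rV[R]_d) by exact: box_measurable.
have I0 : 0 <= I.
  by rewrite -lee_fin -IE; apply: integral_ge0 => x _; rewrite lee_fin powR_ge0.
pose m : R := K.+1%:R.
have m1 : 1 <= m by rewrite /m ler1n.
have m0 : 0 < m by exact: lt_le_trans m1.
pose M0 := S * m `^ `|th - p|.
have M00 : 0 < M0 by rewrite mulr_gt0// powR_gt0.
pose v x := S * f x `^ (th - p) * \1_(core K) x.
have mv : measurable_fun setT v.
  apply: measurable_funM; last exact: measurable_indic.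
  by apply: measurable_funM => //; exact: (measurableT_comp (measurable_powR _) mf).
have core01 (x : 'rV[R]_d) : 0 <= (\1_(core K) x : R) <= 1 := indic01 _ _.
have v0 x : 0 <= v x.
  by have /andP[i0 _] := core01 x; rewrite /v !mulr_ge0 ?powR_ge0// ltW.
have vM x : v x <= M0.
  rewrite /v indicE; have [|] := boolP (x \in _); last by rewrite mulr0 ltW.
  rewrite inE mulr1 => -[_ fx]; rewrite ler_wpM2l ?(ltW S_gt0)//.
  exact: powR_le_between.
pose a x := f x `^ th.
have ma : measurable_fun setT a by exact: (measurableT_comp (measurable_powR _) mf).
have a0 x : 0 <= a x by exact: powR_ge0.
have mfp : measurable_fun setT (fun x => f x `^ p).
  exact: (measurableT_comp (measurable_powR _) mf).
have mfe : measurable_fun setT (fun x => f x `^ (1 - p * sg)).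
  exact: (measurableT_comp (measurable_powR _) mf).
(* the exponents of the weight make both functionals proportional to [I] *)
have fpow x b (u t : R) : core K x -> u * t + b = 1 - p * sg ->
    f x `^ b * (S * f x `^ u) `^ t = S `^ t * f x `^ (1 - p * sg).
  move=> [_ /andP[fx _]] h.
  have fx0 : 0 < f x by apply: lt_le_trans fx; rewrite invr_gt0.
  rewrite (powRM _ (ltW S_gt0)) ?powR_ge0// mulrCA; congr (_ * _).
  rewrite -powRrM -h addrC powRD//.
  by apply/implyP => _; rewrite gt_eqF.
have core_sub : core K `<=` box K by move=> x [].
have int_v b (t : R) : 0 < t -> (th - p) * t + b = 1 - p * sg ->
    (\int[lam]_(x in box K) (f x `^ b * v x `^ t)%:E = (S `^ t * I)%:E)%E.
  move=> t0 h.
  rewrite (_ : (\int[lam]_(x in box K) _)%E =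
    (\int[lam]_(x in core K) (S `^ t * f x `^ (1 - p * sg))%:E)%E).
    by rewrite ge0_integralZl_fin ?powR_ge0// ?IE// => x _; exact: powR_ge0.
  rewrite [LHS]integral_mkcond [RHS]integral_mkcond; apply: eq_integral => x _.
  rewrite !patchE; have [xc|xc] := boolP (x \in core K).
    have xB : x \in box K by rewrite inE; apply: core_sub; rewrite -inE.
    rewrite xB /v indicE xc mulr1; congr (_%:E); apply: fpow => //.
    by rewrite -inE.
  rewrite /v indicE (negbTE xc) mulr0 powR0 ?gt_eqF// mulr0.
  by case: ifP.
have v_sg := int_v th sg sg_gt0.
have {}v_sg : (\int[lam]_(x in box K) (a x * v x `^ sg)%:E = (S `^ sg * I)%:E)%E.
  apply: v_sg; have h1 : th * (1 + sg) = 1 by rewrite mulVf ?gt_eqF.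
  rewrite mulrDr mulr1 in h1.
  rewrite mulrBl; lra.
have v_sg1 : (\int[lam]_(x in box K) (f x `^ p * v x `^ (1 + sg))%:E =
    (S `^ (1 + sg) * I)%:E)%E.
  apply: int_v => //.
  have h1 : th * (1 + sg) = 1 by rewrite mulVf ?gt_eqF.
  rewrite mulrBl h1 mulrDr mulr1; lra.
have S1s : S `^ (1 + sg) = S * S `^ sg.
  by rewrite powRD ?powRr1 ?(ltW S_gt0)//; apply/implyP => _; rewrite gt_eqF.
have Ss0 : 0 < S `^ sg by rewrite powR_gt0.
pose del := e / (8 * (J * (1 + sg))).
have J1s : 0 < J * (1 + sg) by rewrite mulr_gt0.
have del0 : 0 < del by rewrite divr_gt0// mulr_gt0.
have delE : J * (1 + sg) * del = e / 8.
  by rewrite /del; move: J1s; move: (J * (1 + sg)) => j j0; field; rewrite gt_eqF.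
have delJ : J * del <= e / 8.
  rewrite -delE ler_wpM2r ?(ltW del0)// -[leLHS]mulr1 ler_wpM2l ?(ltW J0)//.
  by rewrite lerDl ltW.
have [small|big] := leP (S `^ sg * I) (2 * del).
  exists 0%N => n _; apply: (@le_trans _ _ 0%E).
    rewrite lee_fin -mulrA subr_le0; have := ler_wpM2l (ltW J0) small; lra.
  rewrite mule_ge0 ?lee_fin ?powR_ge0//.
  by apply: integral_ge0 => x _; rewrite lee_fin powR_ge0.
(* simple functions below [v], then step functions *)
have v_lt : ((S `^ sg * I - del)%:E < \int[lam]_(x in box K) (a x * v x `^ sg)%:E)%E.
  by rewrite v_sg lte_fin ltrBlDr ltrDl.
have [psi1 [psi1v psi1I]] := integral_powR_nnsfun mB ma mv a0 v0 sg_gt0 v_lt.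
have psi10 x : 0 <= psi1 x by [].
have psi1M x : 0 <= psi1 x <= M0 by rewrite psi10 (le_trans (psi1v x)).
pose W1 := M0 `^ sg; have W10 : 0 < W1 by rewrite powR_gt0.
pose W2 := M0 `^ (1 + sg); have W20 : 0 < W2 by rewrite powR_gt0.
pose ep := Num.min (del / W1) (e * S / (8 * (J * sg) * W2)).
have Jsg : 0 < J * sg by rewrite mulr_gt0.
have JsW : 0 < 8 * (J * sg) * W2 by rewrite mulr_gt0// mulr_gt0.
have ep0 : 0 < ep by rewrite lt_min !divr_gt0// mulr_gt0.
have epW1 : W1 * ep <= del by rewrite -ler_pdivlMl// mulrC ge_min lexx.
have epW2 : J * sg * (S^-1 * (W2 * ep)) <= e / 8.
  have : ep <= e * S / (8 * (J * sg) * W2) by rewrite ge_min lexx orbT.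
  rewrite ler_pdivlMr// => h.
  have -> : J * sg * (S^-1 * (W2 * ep)) = ep * (8 * (J * sg) * W2) / (S * 8).
    by move: (J * sg) => j; field; rewrite gt_eqF.
  rewrite ler_pdivrMr ?mulr_gt0//; apply: (le_trans h).
  by rewrite le_eqVlt; apply/orP; left; apply/eqP; field.
(* exceptional sets must be small for the Lebesgue measure and for [P] *)
pose mu : {measure set 'rV[R]_d -> \bar R} := measure_add (mrestr lam mB) P.
have muE X : mu X = (lam (X `&` box K) + P X)%E by exact: measure_addE.
have mu_fin : (mu setT < +oo)%E.
  rewrite muE setTI; apply: lte_add_pinfty; first exact: lebesgue_box_fin.
  by rewrite probability_setT ltry.
have [k [g [Bad [kg mBad gM gB muBad]]]] :=
  step_approx_bounded (step_approx_nnsfun mu_fin psi1) psi1M ep0.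
rewrite muE in muBad.
pose psi x := g x * \1_(box K) x.
have kB : step k (\1_(box K) : 'rV[R]_d -> R) := @step_box_indic _ _ _ _.
have kpsi : step k psi by exact: (step_comp2 (fun a b => a * b)).
have psi_in x : box K x -> psi x = g x by move=> xB; rewrite /psi indicE mem_set// mulr1.
have psi_out x : ~ box K x -> psi x = 0.
  by move=> xB; rewrite /psi indicE memNset// mulr0.
have psiM x : 0 <= psi x <= M0.
  have [xB|xB] := pselect (box K x); first by rewrite psi_in.
  by rewrite psi_out// lexx ltW.
have psi0 x : 0 <= psi x by have /andP[] := psiM x.
have psiE x : box K x -> ~ Bad x -> psi x = psi1 x.
  by move=> xB nB; rewrite psi_in//; apply: contrapT => /gB.
have mpsi := step_measurable kpsi.
have mpow (u : 'rV[R]_d -> R) (b : R) : measurable_fun setT u -> measurable_fun setT (fun x => u x `^ b).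
  by move=> mu_; exact: (measurableT_comp (measurable_powR _) mu_).
have mpsi1 : measurable_fun setT (psi1 : 'rV[R]_d -> R) by [].
pose c := S `^ sg * I - 2 * del.
have c0 : 0 <= c by rewrite subr_ge0 ltW.
have cint : (c%:E < \int[lam]_(x in box K) (psi x `^ sg * f x `^ th)%:E)%E.
  rewrite ltNge; apply/negP => cge; move: psi1I; apply/negP; rewrite -leNgt.
  have := @integral_off_bad_dominated (box K) Bad (fun x => a x * psi1 x `^ sg)
    (fun x => psi x `^ sg * f x `^ th) W1 ep mB mBad.
  move=> /(_ (measurable_funM ma (mpow _ _ mpsi1)) (measurable_funM (mpow _ _ mpsi) (mpow _ _ mf))).
  move=> /(_ (fun x => mulr_ge0 (a0 x) (powR_ge0 _ _)) (fun x => mulr_ge0 (powR_ge0 _ _) (powR_ge0 _ _)) (ltW W10)) h.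
  apply: le_trans; first apply: h => //.
  - move=> x _; rewrite mulrC ler_pM ?powR_ge0//.
      have /andP[_ h] := psi1M x.
      by apply: ge0_ler_powR; rewrite ?nnegrE ?(ltW sg_gt0) ?(ltW M00).
    exact: powR_le_1D.
  - by move=> x xB nB; rewrite psiE// mulrC.
  apply: (@le_trans _ _ (c%:E + del%:E)%E); first by apply: leeD; rewrite ?lee_fin.
  by rewrite -EFinD lee_fin /c; lra.
have e40 : 0 < e / 4 by rewrite divr_gt0.
have [n1 lb] := weighted_lower_bound hN d_gt0 s_gt0 mf f_ge0 kpsi psiM c0 cint e40.
pose phi x := psi x `^ (1 + sg) / W2.
have kphi : step k phi by exact: (step_comp2 (fun a _ => a `^ (1 + sg) / W2) kpsi kpsi).
have mphi := step_measurable kphi.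
have phi0 x : 0 <= phi x by rewrite divr_ge0 ?powR_ge0// ltW.
have phi01 x : 0 <= phi x <= 1.
  rewrite phi0/= ler_pdivrMr// mul1r; have /andP[_ h] := psiM x.
  by apply: ge0_ler_powR; rewrite ?nnegrE ?(ltW sg1_gt0) ?(ltW M00).
have phi_out x : ~ box K x -> phi x = 0.
  by move=> xB; rewrite /phi psi_out// powR0 ?mul0r// gt_eqF.
have phiI : (W2%:E * \int[lam]_(x in box K) (phi x * f x `^ p)%:E <=
    (S `^ (1 + sg) * I + W2 * ep)%:E)%E.
  rewrite -ge0_integralZl_fin ?(ltW W20)//; last 2 first.
  - exact: measurable_funM.
  - by move=> x _; rewrite mulr_ge0 ?powR_ge0.
  have := @integral_off_bad_dominated (box K) Bad (fun x => W2 * (phi x * f x `^ p))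
    (fun x => f x `^ p * v x `^ (1 + sg)) W2 ep mB mBad.
  move=> /(_ (measurable_funM (measurable_cst _) (measurable_funM mphi mfp)) (measurable_funM mfp (mpow _ _ mv))).
  move=> /(_ (fun x => mulr_ge0 (ltW W20) (mulr_ge0 (phi0 x) (powR_ge0 _ _))) (fun x => mulr_ge0 (powR_ge0 _ _) (powR_ge0 _ _)) (ltW W20)) h.
  rewrite EFinD -v_sg1; apply: h => //.
  - move=> x _; rewrite ler_wpM2l ?(ltW W20)//; apply: (@le_trans _ _ (1 * f x `^ p)).
      by rewrite ler_wpM2r ?powR_ge0//; have /andP[] := phi01 x.
    by rewrite mul1r; exact: powR_le_1D.
  - move=> x xB nB; rewrite mulrA (mulrC W2) /phi divfK ?gt_eqF// mulrC.
    rewrite ler_wpM2l ?powR_ge0//; apply: ge0_ler_powR; rewrite ?nnegrE ?(ltW sg1_gt0)//.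
    by rewrite psiE.
pose Phi := fine (\int[lam]_(x in box K) (phi x * f x `^ p)%:E)%E.
have PhiE : (\int[lam]_(x in box K) (phi x * f x `^ p)%:E = Phi%:E)%E.
  rewrite /Phi fineK// ge0_fin_numE; last first.
    by apply: integral_ge0 => x _; rewrite lee_fin mulr_ge0 ?powR_ge0.
  apply: (@le_lt_trans _ _ S%:E); last exact: ltry.
  rewrite -SE; apply: (@le_trans _ _ (\int[lam]_(x in box K) (f x `^ p)%:E)%E).
    apply: ge0_le_integral_fin => //.
    - exact: measurable_funM.
    - by move=> x _; rewrite mulr_ge0 ?powR_ge0.
    - by move=> x _; rewrite ler_piMl ?powR_ge0//; have /andP[] := phi01 x.
  by apply: ge0_subset_integral_fin => // x; exact: powR_ge0.
pose e2 := e / (8 * (J * sg) * W2).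
have e20 : 0 < e2 by rewrite divr_gt0.
have e2E : J * sg * (W2 * e2) = e / 8.
  by rewrite /e2; move: Jsg; move: (J * sg) => j j0; field; rewrite !gt_eqF.
have [n2 pd] := point_density_le hN d_gt0 r_gt0 mf f_ge0 S_gt0 SE alP al_opt kphi phi01
  phi_out PhiE e20.
exists (maxn 1 (maxn n1 n2)) => n; rewrite !geq_max => /and3P[n_gt0 n1n n2n].
have [aln0 alns] := alP n_gt0.
have {}pd := pd n n2n; have {}lb := lb n (al n) n1n aln0 alns.
have sumE : \sum_(x <- al n) psi x `^ (1 + sg) = W2 * \sum_(x <- al n) phi x.
  by rewrite mulr_sumr; apply: eq_bigr => x _; rewrite /phi [RHS]mulrC divfK// gt_eqF.
have md : measurable_fun setT (fun x => dst x (al n) `^ s) by exact: measurable_dist_powR.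
have d0 x : 0 <= dst x (al n) `^ s by exact: powR_ge0.
have DP : ((n%:R `^ sg)%:E * \int[lam]_(x in box K) (dst x (al n) `^ s * f x)%:E <=
    (n%:R `^ sg)%:E * \int[P]_x (dst x (al n) `^ s)%:E)%E.
  apply: lee_wpmul2l; first by rewrite lee_fin powR_ge0.
  apply: (le_trans (ac_integral_le mf f_ge0 mA lamA PA mB md d0)).
  exact: ge0_subset_integral_fin.
apply: le_trans DP.
have D0 : (0 <= (n%:R `^ sg)%:E * \int[lam]_(x in box K) (dst x (al n) `^ s * f x)%:E)%E.
  rewrite mule_ge0 ?lee_fin ?powR_ge0//.
  by apply: integral_ge0 => x _; rewrite lee_fin mulr_ge0.
move: lb D0.
case: ((n%:R `^ sg)%:E * _)%E => [D| |]// lb _; last by rewrite leey.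
rewrite -EFinD lee_fin in lb; rewrite lee_fin.
have Phi_le : W2 * Phi <= S * S `^ sg * I + W2 * ep.
  by rewrite -S1s -lee_fin EFinM -PhiE.
have bound : J * sg / n%:R * (\sum_(x <- al n) psi x `^ (1 + sg)) <= J * sg * (S `^ sg * I) + e / 4.
  rewrite sumE.
  have -> : J * sg / n%:R * (W2 * \sum_(x <- al n) phi x) =
    J * sg * W2 * (n%:R^-1 * \sum_(x <- al n) phi x) by ring.
  apply: (@le_trans _ _ (J * sg * W2 * (S^-1 * Phi + e2))).
    by rewrite ler_wpM2l// mulr_ge0// ltW.
  have -> : J * sg * W2 * (S^-1 * Phi + e2) = J * sg * (S^-1 * (W2 * Phi)) + J * sg * (W2 * e2).
    by ring.
  rewrite e2E; have : J * sg * (S^-1 * (W2 * Phi)) <=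
      J * sg * (S^-1 * (S * S `^ sg * I + W2 * ep)).
    by rewrite ler_wpM2l ?(ltW Jsg)// ler_wpM2l ?invr_ge0 ?(ltW S_gt0).
  have -> : J * sg * (S^-1 * (S * S `^ sg * I + W2 * ep)) =
     J * sg * (S `^ sg * I) + J * sg * (S^-1 * (W2 * ep)).
    by rewrite mulrDr mulrDr -(mulrA S) mulKf ?gt_eqF.
  by move: epW2; lra.
have {bound}lb : J * (1 + sg) * c <= D + (J * sg * (S `^ sg * I) + e / 4 + e / 4).
  by apply: (le_trans lb); rewrite lerD2l lerD2r.
rewrite /c (_ : J * (1 + sg) * (S `^ sg * I - 2 * del) =
  J * S `^ sg * I + J * sg * (S `^ sg * I) - 2 * (J * (1 + sg) * del)) in lb; last by ring.
by move: lb; rewrite delE; lra.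
Qed.

End mismatch.

(** * The mismatch bound *)

Section limits.
Context {R : realType}.
Local Open Scope ereal_scope.

Lemma lee_reals (x y : \bar R) : (forall c : R, c%:E < x -> c%:E <= y) -> x <= y.
Proof.
case: x => [x| |] h; last by rewrite leNye.
  apply/lee_subgt0Pr => e e0; rewrite -EFinB; apply: h.
  by rewrite lte_fin ltrBlDr ltrDl.
case: y h => [y| |] h //.
  by have := h (y + 1)%R (ltry _); rewrite lee_fin gerDl lt_geF.
by have := h 0%R (ltry _).
Qed.

Lemma limn_einf_ge (u : (\bar R)^nat) c : (exists n0, forall n, (n0 <= n)%N -> c <= u n) ->
  c <= limn_einf u.
Proof.
move=> [n0 h]; rewrite limn_einf_lim (cvg_lim _ (@cvg_einfs_sup _ u))//.
apply: (@le_trans _ _ (einfs u n0)); last by apply: ereal_sup_ubound; exists n0.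
by apply: le_ereal_inf_tmp => _ [n /= nn <-]; exact: h.
Qed.

End limits.

Section core_limit.
Context {R : realType} {d : nat}.
Local Notation lam := (lebesgue_rV R d).
Variable f : 'rV[R]_d -> R.
Hypothesis mf : measurable_fun setT f.
Hypothesis f_ge0 : forall x, 0 <= f x.

Lemma core_nd : nondecreasing_seq (core f).
Proof.
move=> m n mn; apply/subsetPset => x [xm /andP[h1 h2]]; split.
  exact: box_mono xm.
have mn' : m.+1%:R <= n.+1%:R :> R by rewrite ler_nat.
rewrite (le_trans h2 mn') andbT; apply: le_trans h1.
by rewrite lef_pV2 ?posrE.
Qed.

Lemma core_cover : \bigcup_K core f K = [set x | (0 < f x)%R].
Proof.
apply/seteqP; split=> [x [K _ [_ /andP[h _]]]|x /= fx].
  by apply: lt_le_trans h; rewrite invr_gt0.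
have : (\bigcup_K box K) x by rewrite box_cover.
move=> [K _ xK]; pose K' := maxn K (maxn (Num.truncn (f x)) (Num.truncn (f x)^-1)).
exists K' => //; split; first exact: box_mono (leq_maxl _ _) _ xK.
have h1 : f x <= K'.+1%:R.
  apply: ltW; apply: (lt_le_trans (truncnS_gt _)).
  by rewrite ler_nat ltnS !leq_max leqnn orbT.
rewrite h1 andbT -[leRHS]invrK lef_pV2 ?posrE ?invr_gt0//.
apply: ltW; apply: (lt_le_trans (truncnS_gt _)).
by rewrite ler_nat ltnS !leq_max leqnn !orbT.
Qed.

Lemma core_integral_lty a K : (\int[lam]_(x in core f K) (f x `^ a)%:E < +oo)%E.
Proof.
have mc := core_measurable mf K.
have V : (lam (core f K) <= (fine (lam (box K)))%:E)%E.
  rewrite fineK; last by rewrite ge0_fin_numE//; exact: lebesgue_box_fin.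
  by apply: le_measure; rewrite ?inE//; [exact: box_measurable|move=> x []].
apply: (@le_lt_trans _ _ (K.+1%:R `^ `|a| * fine (lam (box K)))%:E); last exact: ltry.
apply: integral_le_cst => //.
- exact: (measurableT_comp (measurable_powR _) mf).
- by move=> x _; exact: powR_ge0.
- by move=> x [_ h]; apply: powR_le_between h; rewrite ler1n.
Qed.

End core_limit.

(** A density with a vanishing power integral vanishes almost everywhere. *)
Lemma integral_powR_density_gt0 (R : realType) (disp : measure_display) (T : measurableType disp)
    (mu Pa : {measure set T -> \bar R}) (f : T -> R) (p : R) :
  is_density mu Pa f -> 0 < p -> (exists2 A, measurable A & Pa A != 0%E) ->
  (0 < \int[mu]_x (f x `^ p)%:E)%E.
Proof.
move=> [mf f0 Paf] p0 [A mA PaA].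
have mfp : measurable_fun setT (fun x => (f x `^ p)%:E).
  by apply/measurable_EFinP; exact: (measurableT_comp (measurable_powR _) mf).
rewrite lt_neqAle integral_ge0 ?andbT; last by move=> x _; rewrite lee_fin powR_ge0.
apply/eqP => I0; move: PaA => /eqP; apply; rewrite Paf//.
have : (\int[mu]_x `|(f x `^ p)%:E| = 0)%E.
  by rewrite I0; apply: eq_integral => x _; rewrite gee0_abs// lee_fin powR_ge0.
move=> /(ae_eq_integral_abs mu measurableT mfp) ae0.
have mfE : measurable_fun A (fun x => (f x)%:E) by apply/measurable_EFinP; exact: measurable_funTS.
have : (\int[mu]_(x in A) `|(f x)%:E| = 0)%E.
  apply/(ae_eq_integral_abs mu mA mfE); apply: filterS ae0 => x h _.
  have := h I; rewrite /= => -[/eqP]; rewrite powR_eq0 => /andP[/eqP -> _] //.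
by move=> <-; apply: eq_integral => x _; rewrite gee0_abs// lee_fin.
Qed.

Section asymptotic_optimality.
Context {R : realType} {d : nat}.
Variable N : 'rV[R]_d -> R.
Variable P : probability 'rV[R]_d R.
Variables (r B : R) (alpha : nat -> set 'rV[R]_d).
Hypothesis r_gt0 : 0 < r.
Hypothesis opt : asymptotically_optimal N P r alpha.
Local Notation q := (r / d%:R).

Lemma asymptotically_optimal_le : 0 < B ->
  (forall e : R, 0 < e -> exists n0, forall n, (n0 <= n)%N -> exists be : seq 'rV[R]_d,
   [/\ be != [::], (size be <= n)%N &
    ((n%:R `^ q)%:E * \int[P]_x (dist N x [set` be] `^ r)%:E <= (B + e)%:E)%E]) ->
  forall e : R, 0 < e -> exists n0, forall n, (n0 <= n)%N ->
    ((n%:R `^ q)%:E * distortion N P r (alpha n) <= (B + e)%:E)%E.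
Proof.
move=> B0 up e e0; have e20 : 0 < e / 2 by rewrite divr_gt0.
have [n1 n1P] := up _ e20.
pose del := e / 2 / (B + e / 2).
have Be0 : 0 < B + e / 2 by rewrite addr_gt0.
have del0 : 0 < del by rewrite divr_gt0.
have lt1 : (1 < (1 + del)%:E :> \bar R)%E by rewrite lte_fin ltrDl.
have [_ /(_ _ (open_ereal_lt' lt1))[n2 _ n2P]] := opt.
exists (maxn 1 (maxn n1 n2)) => n; rewrite !geq_max => /and3P[n_gt0 n1n n2n].
have {n2P} := n2P n n2n => /=.
have [be [be0 bes beI]] := n1P n n1n.
have Ebe := quantization_error_le N P r_gt0 be0 bes.
have nq0 : 0 < n%:R `^ q by rewrite powR_gt0// ltr0n.
have D0 := distortion_ge0 N P r (alpha n).
have : (0 <= quantization_error N P n r `^ r)%E by exact: poweR_ge0.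
have {beI} : (quantization_error N P n r `^ r <= ((n%:R `^ q)^-1 * (B + e / 2))%:E)%E.
  by apply: (le_trans Ebe); rewrite EFinM lee_pdivlMl.
case: (quantization_error N P n r `^ r)%E => [E| |]//.
rewrite !lee_fin inver => EB E0.
(* a vanishing optimal error makes the ratio infinite, unless the distortion vanishes too *)
case: eqP => [_|/eqP En0].
  move: D0; rewrite le_eqVlt => /predU1P[<- _|D0]; first by rewrite mule0 lee_fin ltW// addr_gt0.
  by rewrite gt0_muley// => /lt_geF; rewrite leey.
have {}E0 : 0 < E by rewrite lt_def En0.
rewrite lte_pdivrMr// => /ltW h.
have h2 : (distortion N P r (alpha n) <= ((1 + del) * ((n%:R `^ q)^-1 * (B + e / 2)))%:E)%E.
  apply: (le_trans h); rewrite -EFinM lee_fin ler_wpM2l// addr_ge0// ltW//.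
rewrite -lee_pdivlMl//; apply: (le_trans h2).
rewrite -EFinM lee_fin mulrCA ler_wpM2l ?invr_ge0 ?(ltW nq0)//.
by rewrite mulrDl mul1r /del divfK ?gt_eqF// -addrA -splitr.
Qed.

End asymptotic_optimality.

Theorem theorem1 (R : realType) (d : nat) (N : 'rV[R]_d -> R) (r s : R)
    (P : probability 'rV[R]_d R) (Pa : {measure set 'rV[R]_d -> \bar R})
    (f : 'rV[R]_d -> R) (alpha : nat -> set 'rV[R]_d) :
  (0 < d)%N -> is_norm N -> 0 < r -> 0 < s ->
  is_ac_part (lebesgue_rV R d) P Pa ->
  is_density (lebesgue_rV R d) Pa f ->
  (exists2 A, measurable A & Pa A != 0%E) ->
  (exists2 eta : R, 0 < eta & (\int[P]_x (N x `^ (r + eta))%:E < +oo)%E) ->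
  asymptotically_optimal N P r alpha ->
  (mismatch_bound N r s f <=
     limn_einf (fun n => (n%:R `^ (s / d%:R))%:E *
                         \int[P]_x (dist N x (alpha n) `^ s)%:E))%E.
Proof.
move=> d0 hN r0 s0 acP dPa Pa0 [eta eta0 mom] opt.
have [mf f0 _] := dPa.
have [A [mA lamA PA]] := ac_part_density acP dPa.
have {}PA : density_on P f (~` A) by [].
have d0' : 0 < d%:R :> R by rewrite ltr0n.
have dr0 : 0 < d%:R + r by rewrite addr_gt0.
set lam := lebesgue_rV R d in lamA *.
pose p := (1 + r / d%:R)^-1.
have p0 : 0 < p by rewrite invr_gt0 addr_gt0// divr_gt0.
have pE : d%:R / (d%:R + r) = p.
  by rewrite /p; field; rewrite !gt_eqF// addrC.
pose S := fine (\int[lam]_x (f x `^ p)%:E).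
have Soo := integral_powR_density_lty hN d0 r0 eta0 mf f0 mA lamA PA mom.
have SE : (\int[lam]_x (f x `^ p)%:E = S%:E)%E.
  rewrite /S fineK// ge0_fin_numE//.
  by apply: integral_ge0 => x _; rewrite lee_fin powR_ge0.
have S0 : 0 < S.
  by rewrite -lte_fin -SE; exact: integral_powR_density_gt0 dPa p0 Pa0.
have J0 := qconst_gt0 hN d0 s0.
(* finite lists replace the sets of codes; index 0 carries no constraint *)
have /choice[al alE] : forall n, exists a : seq 'rV[R]_d, (0 < n)%N ->
    [/\ a != [::], (size a <= n)%N & alpha n = [set` a]].
  case=> [|n]; first by exists [::].
  have [an0 ann] := opt.1 n.+1 isT.
  by have [a aP] := quantizer_seq an0 ann; exists a.
have alP n : (0 < n)%N -> al n != [::] /\ (size (al n) <= n)%N.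
  by move=> /alE[].
have JrS0 : 0 < qconst N r * S `^ (1 + r / d%:R).
  by rewrite mulr_gt0 ?powR_gt0//; exact: qconst_gt0.
have up := asymptotically_optimal_le r0 opt JrS0
  (fun e e0 => zador_upper_bound hN d0 r0 eta0 mf f0 mA lamA PA mom S0 e0).
have al_opt (e : R) : 0 < e -> exists n0, forall n K, (n0 <= n)%N ->
  ((n%:R `^ (r / d%:R))%:E * \int[lam]_(x in box K) (dist N x [set` al n] `^ r * f x)%:E <=
    (qconst N r * S `^ (1 + r / d%:R) + e)%:E)%E.
  move=> /up[n0 n0P]; exists (maxn 1 n0) => n K; rewrite geq_max => /andP[n_gt0 n0n].
  have [_ _ aE] := alE n n_gt0; have := n0P n n0n; rewrite aE; apply: le_trans.
  apply: lee_wpmul2l; first by rewrite lee_fin powR_ge0.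
  have md : measurable_fun setT (fun x => dist N x [set` al n] `^ r) by exact: measurable_dist_powR.
  have dd0 x : 0 <= dist N x [set` al n] `^ r by exact: powR_ge0.
  apply: (le_trans (ac_integral_le mf f0 mA lamA PA (box_measurable K) md dd0)).
  by apply: ge0_subset_integral_fin => //; exact: box_measurable.
rewrite /mismatch_bound pE SE poweR_EFin (qconstE hN s0) -EFinM.
have -> : 1 - s / (d%:R + r) = 1 - p * (s / d%:R).
  by rewrite /p; field; rewrite !gt_eqF// addrC.
set a := 1 - _; set b := qconst N s * S `^ (s / d%:R).
have b0 : 0 < b by rewrite mulr_gt0// powR_gt0.
apply: lee_reals => c cb; apply: limn_einf_ge.
have mfa : measurable_fun setT (fun x => f x `^ a).
  exact: (measurableT_comp (measurable_powR _) mf).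
have {cb} : ((b^-1 * c)%:E < \int[lam]_(x in [set x | (0 < f x)%R]) (f x `^ a)%:E)%E.
  by rewrite EFinM lte_pdivrMl.
move=> /(integral_exhaust (core_measurable mf) (core_nd f) (core_cover f) mfa (fun x => powR_ge0 _ _)).
move=> [K /(_ K (leqnn K)) cK].
pose I := fine (\int[lam]_(x in core f K) (f x `^ a)%:E).
have IE : (\int[lam]_(x in core f K) (f x `^ a)%:E = I%:E)%E.
  rewrite /I fineK// ge0_fin_numE; first exact: core_integral_lty.
  by apply: integral_ge0 => x _; rewrite lee_fin powR_ge0.
have e0 : 0 < b * I - c by rewrite subr_gt0 -ltr_pdivrMl// -lte_fin -IE.
have [n0 n0P] := mismatch_core hN d0 r0 s0 mf f0 mA lamA PA S0 SE alP al_opt IE e0.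
exists (maxn 1 n0) => n; rewrite geq_max => /andP[n_gt0 n0n].
have [_ _ ->] := alE n n_gt0; apply: le_trans (n0P n n0n).
by rewrite lee_fin opprB addrC subrK.
Qed.
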